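(* Let $\Gamma$ be a convex lattice configuration in $\mathfrak B_d$ and let $M,M'$ be two sub-representations of $M_\Gamma$ of dimension $\mathbf 1=(1,\dots,1)$. The following are equivalent: (1) $\mathcal S_M\subset\mathcal S_{M'}^c$, where ${}^c$ denotes closure in $\mathrm{Gr}(\mathbf 1,M_\Gamma)$; (2) $\Phi(M)\le\Phi(M')$ coordinatewise; (3) $\Delta_{M'}\subset\Delta_M$. In particular, the (generalized) Bruhat order on $LG_1(\Gamma)_0=\mathrm{Gr}(\mathbf 1,M_\Gamma)$ agrees with the topological order and the rank-vector order.
   Context: SETTING. $R$ is a discrete valuation ring with fraction field $K$, uniformizer $\pi$ and algebraically closed residue field $\kappa$; $d\ge2$. A lattice in $K^d$ is a free $R$-submodule $L\subset K^d$ with $L\otimes_RK\to K^d$ an isomorphism; $[L]$ is its homothety class. Distinct classes are adjacent if they have representatives with $\pi L_1\subset L_2\subset L_1$; $\mathfrak B_d$ is the flag complex of homothety classes under adjacency. A convex lattice configuration is a finite nonempty set $\Gamma$ of classes such that $[L_1\cap L_2]\in\Gamma$ for any representatives $L_1,L_2$ of two members of $\Gamma$. Write $\Gamma=\{[L_v]\}_v$ with fixed representatives and identify $\Gamma$ with the index set. For $u,v\in\Gamma$ let $n_{u,v}$ be the minimal integer with $\pi^{n_{u,v}}L_u\subset L_v$, put $\overline L_v=L_v/\pi L_v$, and let $f_{u,v}:\overline L_u\to\overline L_v$ be induced by multiplication by $\pi^{n_{u,v}}$. QUIVER. $Q(\Gamma)'$ has vertex set $\Gamma$ and one arrow $(u,v)$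 for each ordered pair $u\ne v$. $Q(\Gamma)$ is obtained from it by removing every arrow $(u,v)$ for which some path of length $\ge2$ from $u$ to $v$ in $Q(\Gamma)'$ has composite map equal to $f_{u,v}$. $M_\Gamma=(\overline L_v)_v$ is the representation of $Q(\Gamma)$ with maps $f_{u,v}$. $\mathrm{Gr}(\mathbf 1,M_\Gamma)$ is the quiver Grassmannian over $\kappa$ of sub-representations of dimension $\mathbf 1$; it is set-theoretically the special fiber $LG_1(\Gamma)_0$ of the $R$-scheme $LG_1(\Gamma)$ whose $T$-points are collections of rank-1 sub-bundles $E_v\subset L_v\otimes\mathcal O_T$ compatible with all maps induced by inclusions $\pi^k:L_u\hookrightarrow L_v$. For $M=(\langle\epsilon_v\rangle)_v$ of dimension $\mathbf 1$, a vertex $u\in\Gamma$ is maximal with respect to $M$ if $f_{v,u}(\epsilon_v)=0$ for all $v\ne u$; $\Delta_M$ is the set of maximal vertices (these are mutually adjacent, so $\Delta_M$ is a simplex). $\mathcal S_M$ is the quiver stratum: the set of points isomorphic to $M$ as representations. $\Phi(M)=(\dim f_{u,v}(U_u))_{u,v\in\Gamma}$ is the rank vector of $M=(U_v)_v$; rank-vector strata are the fibers of $\Phi$, ordered coordinatewise (rank-vector order). Topological order: $S\preceq_{\rm top}S'$ iff $S$ is contained in the closure of $S'$. The quiver, rank-vector and Bruhat stratifications of $\mathrm{Gr}(\mathbf 1,M_\Gamma)$ coincide. BRUHAT STRATIFICATION (here $r=1$). It is defined for $\Gamma$ contained in an apartment, i.e. when there is a basis $e_1,\dots,e_d$ of $K^d$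 with all classes of $\Gamma$ of the form $[\langle\pi^{c_1}e_1,\dots,\pi^{c_d}e_d\rangle]$. For $a\in\mathbb Z^d$ put $L(a)=\langle\pi^{-a(1)}e_1,\dots,\pi^{-a(d)}e_d\rangle$. $\widetilde W=\mathbb S_d\ltimes\mathbb Z^d$ acts on $\mathbb Z^d$ by $(\sigma,v)\cdot a=(a(\sigma^{-1}(1)),\dots,a(\sigma^{-1}(d)))+v$, with group law $(\sigma_1,v_1)(\sigma_2,v_2)=(\sigma_2\sigma_1,v_1+\sigma_1\cdot v_2)$, where $\sigma_2\sigma_1$ means first $\sigma_2$, then $\sigma_1$ (so the group law is composition of transformations); $W_a\subset\widetilde W$ consists of the elements with $\sum_kv(k)=0$. Put $\omega_i=(1^i,0^{d-i})$ and $\omega_I=(\omega_i)_{i\in I}$ for $I\subset\{0,\dots,d-1\}$. Let $\tau_j$ $(j\in\mathcal J)$ be the maximal simplices of the complex spanned by $\Gamma$. Choose representatives $L_v=L(a_v)$ such that those of the vertices of each $\tau_j$ can be ordered as $L_0\subset L_1\subset\dots\subset\pi^{-1}L_0$; then $(a_v)_{v\in\tau_j}=g_j\cdot\omega_{I_j}$ for some $g_j\in\widetilde W$ and some $I_j$. Let $W_j$ (resp. $W_{j,j'}$) be the subgroup of $W_a$ fixing $a_v$ for all $v\in\tau_j$ (resp. $v\in\tau_j\cap\tau_{j'}$). $\mathbf{adm}_1(\Gamma)$ is the set of tuples $\mathbf x=(h_jW_j)_{j\in\mathcal J}$, $h_j\in\widetilde W$, with $a_v\le h_j\cdot a_v\le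 a_v+(1,\dots,1)$ coordinatewise and $\sum_k (h_j\cdot a_v)(k)-\sum_k a_v(k)=1$ for $v\in\tau_j$, and $W_{j,j'}h_jW_{j,j'}=W_{j,j'}h_{j'}W_{j,j'}$ for all $j,j'$. For $a\in\mathbb Z^d$ let $\Lambda(a)=\langle t^{-a(1)}e_1,\dots,t^{-a(d)}e_d\rangle_{\kappa[[t]]}\subset\kappa((t))^d$; identify $\overline L_v$ with $\Lambda(a_v)/t\Lambda(a_v)$ by sending the class of $\pi^{-a_v(k)}e_k$ to that of $t^{-a_v(k)}e_k$. Let $P_j\subset\mathrm{SL}_d(\kappa((t)))$ be the common stabilizer of the $\Lambda(a_v)$, $v\in\tau_j$. The Bruhat stratum $S_{\mathbf x}$ (a fiber product of Schubert cells) is the set of points $(E_v)_v$ such that for each $j$ the tuple $(t^{-1}\widetilde E_v)_{v\in\tau_j}$ lies in the $P_j$-orbit of $(\Lambda(h_j\cdot a_v))_{v\in\tau_j}$, where $\widetilde E_v\subset\Lambda(a_v)$ is the preimage of $E_v$. GENERALIZED BRUHAT ORDER (on $\mathbf{adm}_1(\Gamma)$, the index set of the Bruhat strata). $W_a$ is a Coxeter group with generators $s_0=((1\,d),(1,0,\dots,0,-1))$, $s_i=((i\ i{+}1),0)$, $1\le i\le d-1$, with its length function and Bruhat order. Let $\iota=((12\cdots d),(1,0^{d-1}))$. Let $F_j$ be the face whose vertices are represented by $(\iota g_j)\cdot\omega_{I_j}$, and let $W_{F_j}\subset W_a$ be the subgroup fixing its vertices. For $\mathbf x=(h_jW_j)_j$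 and $\mathbf y=(h'_jW_j)_j$: $\mathbf x\preceq\mathbf y$ iff $W_j(h_j\iota^{-1})W_{F_j}\preceq_jW_j(h'_j\iota^{-1})W_{F_j}$ for all $j\in\mathcal J$, where $\preceq_j$ is the Bruhat order on $W_j\backslash W_a/W_{F_j}$, i.e. the order induced by the Bruhat order of $W_a$ when a double coset $W_jwW_{F_j}$ is identified with its representative, the unique element of maximal length in $\{(uw)^{F_j}\mid u\in W_j\}$, with $x^{F_j}$ the unique element of minimal length in $xW_{F_j}$.
   Formalization: The Bruhat order on double cosets is taken relative to an alcove containing the simplex (transported by g_j to the base alcove), as the literal order reverses closures for d=2, a=(1,0),(2,0); agreement of orders is stated for nonempty Bruhat strata only. *)

(* Defs.v *)
From HB Require Import structures.
From mathcomp Require Export all_boot all_order all_fingroup all_algebra.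
From mathcomp Require Export boolp classical_sets functions mpoly.
From Stdlib Require Export Relations.

Set Implicit Arguments.
Unset Strict Implicit.
Unset Printing Implicit Defensive.

Import GRing.Theory.
Local Open Scope classical_set_scope.
Local Open Scope ring_scope.

(* Vectors are row vectors: linear maps act by multiplication on the right. *)

Section Lattices.
Variables (R : idomainType) (pi : R) (k : fieldType) (red : R -> k) (d : nat).
Local Notation K := {fraction R}.
Local Notation inK := (@FracField.tofrac R).

Definition is_dvr_uniformizer : Prop :=
  [/\ pi != 0, pi \isn't a GRing.unit &
      forall x : R, x != 0 ->
        exists (n : nat) (u : R), u \is a GRing.unit /\ x = u * pi ^+ n].

(* [red] identifies [k] with the residue field R / pi R. *)
Definition is_residue_map : Prop :=
  (forall c : k, exists x : R, red x = c) /\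
  (forall x : R, red x = 0 <-> exists y : R, x = pi * y).

(* A lattice is given by an R-basis, which is also a K-basis of K^d: the rows
   of an invertible matrix.  [lat B] is its underlying R-submodule. *)
Definition lat (B : 'M[K]_d) : set 'rV[K]_d :=
  [set x | exists y : 'rV[R]_d, x = map_mx inK y *m B].

Definition scale_set (c : K) (L : set 'rV[K]_d) : set 'rV[K]_d :=
  (fun x => c *: x) @` L.

Definition homothetic (L L' : set 'rV[K]_d) : Prop :=
  exists c : K, c != 0 /\ L' = scale_set c L.

(* The residue of an element of R inside K (0 elsewhere). *)
Definition res (x : K) : k := red (xget 0 [set r : R | x = inK r]).

(* The map L -> L / pi L for L = lat B, where L / pi L is identified with k^d
   by means of the images of the rows of B. *)
Definition reduction (B : 'M[K]_d) (x : 'rV[K]_d) : 'rV[k]_d :=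
  map_mx res (x *m invmx B).

(* The preimage in lat B of a subspace of lat B / pi (lat B). *)
Definition lat_preim (B : 'M[K]_d) (E : {vspace 'rV[k]_d}) : set 'rV[K]_d :=
  [set x | lat B x /\ reduction B x \in E].

(* The basis pi^(-a(1)) e_1, ..., pi^(-a(d)) e_d, where e_i is row i of e. *)
Definition apt_basis (e : 'M[K]_d) (a : 'rV[int]_d) : 'M[K]_d :=
  \matrix_(i, j) (inK pi ^ (- a 0 i) * e i j).

Section Configurations.
Variables (V : finType) (B : V -> 'M[K]_d).
Local Notation L v := (lat (B v)).

Definition convex_config : Prop :=
  [/\ (0 < #|V|)%N,
      forall v, B v \in unitmx,
      forall u v, homothetic (L u) (L v) -> u = v &
      forall u v (L1 L2 : set 'rV[K]_d),
        homothetic (L u) L1 -> homothetic (L v) L2 ->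
        exists w, homothetic (L w) (L1 `&` L2)].

Definition adjacent (u v : V) : Prop :=
  u <> v /\
  exists L1 L2 : set 'rV[K]_d,
    [/\ homothetic (L u) L1, homothetic (L v) L2,
        scale_set (inK pi) L1 `<=` L2 & L2 `<=` L1].

Definition simplex (tau : {set V}) : Prop :=
  (0 < #|tau|)%N /\
  forall u v, u \in tau -> v \in tau -> u != v -> adjacent u v.

Definition max_simplex (tau : {set V}) : Prop :=
  simplex tau /\
  forall sigma : {set V}, simplex sigma -> tau \subset sigma -> sigma = tau.

Definition nmin (u v : V) : int :=
  xget 0 [set n : int | scale_set (inK pi ^ n) (L u) `<=` L v /\
            forall m : int, scale_set (inK pi ^ m) (L u) `<=` L v -> n <= m].

(* f_{u,v} in the coordinates given by the bases B u and B v. *)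
Definition fmap (u v : V) : 'End('rV[k]_d) :=
  linfun (mulmxr (map_mx res (inK pi ^ nmin u v *: (B u *m invmx (B v))))).

(* The composite map along the path u, w_1, ..., w_m of Q(Gamma)'. *)
Fixpoint fpath (u : V) (p : seq V) : 'End('rV[k]_d) :=
  if p is w :: p' then (fpath w p' \o fmap u w)%VF else \1%VF.

(* The arrows of Q(Gamma). *)
Definition arrow (u v : V) : Prop :=
  u != v /\
  ~ exists p : seq V,
      [/\ path (fun x y => x != y) u p, last u p = v, (2 <= size p)%N &
          fpath u p = fmap u v].

Definition lines (U : V -> {vspace 'rV[k]_d}) : Prop := forall v, \dim (U v) = 1%N.

(* The k-points of Gr(1, M_Gamma). *)
Definition Gr : set (V -> {vspace 'rV[k]_d}) :=
  [set U | lines U /\ forall u v, arrow u v -> (fmap u v @: U u <= U v)%VS].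

(* Isomorphism of sub-representations; a linear isomorphism U v -> U' v is
   given here as the restriction of an endomorphism of k^d. *)
Definition isorep (U U' : V -> {vspace 'rV[k]_d}) : Prop :=
  exists g : V -> 'End('rV[k]_d),
    (forall v, (g v @: U v)%VS = U' v /\ {in U v &, injective (g v)}) /\
    (forall u v, arrow u v ->
       forall x, x \in U u -> g v (fmap u v x) = fmap u v (g u x)).

Definition stratum (M : V -> {vspace 'rV[k]_d}) : set (V -> {vspace 'rV[k]_d}) :=
  [set U | Gr U /\ isorep M U].

Definition rankv (U : V -> {vspace 'rV[k]_d}) (u v : V) : nat :=
  \dim (fmap u v @: U u).

Definition rank_le (U U' : V -> {vspace 'rV[k]_d}) : Prop :=
  forall u v, (rankv U u v <= rankv U' u v)%N.

(* Delta_U, the set of maximal vertices. *)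
Definition Delta (U : V -> {vspace 'rV[k]_d}) : set V :=
  [set u | forall v, v != u -> (fmap v u @: U v = 0)%VS].

(* Zariski topology on the product over v of the P(k^d): closed sets are the
   zero loci of families of polynomials in the homogeneous coordinates, indexed
   by V * 'I_d, that are homogeneous in each of the groups {v} * 'I_d. *)
Definition multihomogeneous (p : {mpoly k[#|{: V * 'I_d}|]}) : Prop :=
  exists deg : V -> nat, forall m, m \in msupp p ->
    forall v, (\sum_(i < d) m (enum_rank (v, i)))%N = deg v.

Definition vanishes (p : {mpoly k[#|{: V * 'I_d}|]})
    (U : V -> {vspace 'rV[k]_d}) : Prop :=
  forall eps : V -> 'rV[k]_d, (forall v, U v = <[eps v]>%VS) ->
    p.@[fun i => eps (enum_val i).1 0 (enum_val i).2] = 0.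

Definition zariski_closed (Z : set (V -> {vspace 'rV[k]_d})) : Prop :=
  exists P : set {mpoly k[#|{: V * 'I_d}|]},
    (forall p, P p -> multihomogeneous p) /\
    Z = [set U | lines U /\ forall p, P p -> vanishes p U].

(* Closure in Gr(1, M_Gamma) with the induced topology. *)
Definition Gr_closure (S : set (V -> {vspace 'rV[k]_d})) :
    set (V -> {vspace 'rV[k]_d}) :=
  [set U | Gr U /\ forall Z, zariski_closed Z -> S `<=` Z -> Z U].

End Configurations.

End Lattices.

Section Reduction.
Variables (R : idomainType) (pi : R) (k : fieldType) (red : {rmorphism R -> k}).
Variables (d : nat).
Local Notation K := {fraction R}.
Local Notation inK := (@FracField.tofrac R).

Lemma res_tofrac (r : R) : res red (inK r) = red r.
Proof.
rewrite /res; congr (red _); apply/eqP; rewrite -tofrac_eq eq_sym; apply/eqP.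
exact: (xgetPex 0 (ex_intro (fun s => [set s : R | inK r = inK s] s) r erefl)).
Qed.

Lemma map_res_tofrac m n (A : 'M[R]_(m, n)) :
  map_mx (res red) (map_mx inK A) = map_mx red A.
Proof. by apply/matrixP => i j; rewrite !mxE res_tofrac. Qed.

(* reduction B is onto, with kernel pi (lat B), as a map on lat B. *)
Lemma reduction_surj (B : 'M[K]_d) (c : 'rV[k]_d) :
  is_residue_map pi red -> B \in unitmx ->
  exists2 x, lat B x & reduction red B x = c.
Proof.
move=> [surj _] uB; have /choice [y yc] i := surj (c 0 i).
exists (map_mx inK (\row_i y i) *m B); first by exists (\row_i y i).
rewrite /reduction mulmxK // map_res_tofrac; apply/rowP => i.
by rewrite !mxE yc.
Qed.

Lemma reduction_eq0 (B : 'M[K]_d) (x : 'rV[K]_d) :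
  is_residue_map pi red -> B \in unitmx -> lat B x ->
  reduction red B x = 0 <-> scale_set (inK pi) (lat B) x.
Proof.
move=> [_ ker] uB [y ->]; rewrite /reduction mulmxK // map_res_tofrac; split.
  move=> y0; have /choice [z yz] i : exists z, y 0 i = pi * z.
    by apply/ker; move/rowP: y0 => /(_ i); rewrite !mxE.
  exists (map_mx inK (\row_i z i) *m B); first by exists (\row_i z i).
  rewrite scalemxAl; congr (_ *m _); apply/rowP => i.
  by rewrite !mxE yz rmorphM.
move=> [_ [z ->]]; rewrite scalemxAl => /(can_inj (mulmxK uB)) yz.
apply/rowP => i; rewrite !mxE; apply/ker; exists (z 0 i).
by apply/eqP; rewrite -tofrac_eq rmorphM; move/rowP: yz => /(_ i); rewrite !mxE => ->.
Qed.

(* fmap u v is the map induced by multiplication by pi ^ nmin u v. *)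
Lemma fmap_reduction (V : finType) (B : V -> 'M[K]_d) (u v : V) (x : 'rV[K]_d) :
  B u \in unitmx -> B v \in unitmx -> lat (B u) x ->
  scale_set (inK pi ^ nmin pi B u v) (lat (B u)) `<=` lat (B v) ->
  fmap pi red B u v (reduction red (B u) x)
    = reduction red (B v) (inK pi ^ nmin pi B u v *: x).
Proof.
rewrite /fmap; move: (inK pi ^ _) => c uBu uBv [y ->] sub.
have /choice [z rowz] i : exists z : 'rV[R]_d,
    row i (c *: (B u *m invmx (B v))) = map_mx inK z.
  have [|z zE] := sub (c *: row i (B u)).
    by exists (row i (B u)) => //; exists (delta_mx 0 i); rewrite map_delta_mx -rowE.
  exists z; rewrite rowE -scalemxAr mulmxA -rowE.
  by apply: (can_inj (mulmxK uBv)); rewrite -scalemxAl mulmxKV.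
have AE : c *: (B u *m invmx (B v)) = map_mx inK (\matrix_i z i).
  by apply/row_matrixP => i; rewrite rowz -map_row rowK.
have -> : reduction red (B u) (map_mx inK y *m B u) = map_mx red y.
  by rewrite /reduction (mulmxK uBu) map_res_tofrac.
have -> : reduction red (B v) (c *: (map_mx inK y *m B u))
            = map_mx red (y *m \matrix_i z i).
  rewrite /reduction -scalemxAl -mulmxA scalemxAr AE -map_mxM.
  by rewrite map_res_tofrac.
by rewrite AE map_res_tofrac lfunE map_mxM.
Qed.

End Reduction.

(* Formal power series: k[[t]] is the type of coefficient sequences, with the
   Cauchy product, and k((t)) is {fraction fps k}. *)
Definition fps (k : fieldType) : Type := nat -> k.

Section PowerSeries.
Variable k : fieldType.
Implicit Types f g h : fps k.

HB.instance Definition _ := gen_eqMixin (fps k).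
HB.instance Definition _ := gen_choiceMixin (fps k).

Definition fps_zero : fps k := fun=> 0.
Definition fps_opp f : fps k := fun n => - f n.
Definition fps_add f g : fps k := fun n => f n + g n.
Definition fps_one : fps k := fun n => (n == 0%N)%:R.
Definition fps_mul f g : fps k := fun n => \sum_(i < n.+1) f i * g (n - i)%N.
Definition fps_X : fps k := fun n => (n == 1%N)%:R.
Definition fps_red (f : fps k) : k := f 0%N.

Fact fps_addA : associative fps_add.
Proof. by move=> f g h; apply/funext => n; apply: addrA. Qed.
Fact fps_addC : commutative fps_add.
Proof. by move=> f g; apply/funext => n; apply: addrC. Qed.
Fact fps_add0 : left_id fps_zero fps_add.
Proof. by move=> f; apply/funext => n; apply: add0r. Qed.
Fact fps_addN : left_inverse fps_zero fps_opp fps_add.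
Proof. by move=> f; apply/funext => n; apply: addNr. Qed.

HB.instance Definition _ :=
  GRing.isZmodule.Build (fps k) fps_addA fps_addC fps_add0 fps_addN.

Let trunc N f : {poly k} := \poly_(i < N) f i.

Let coef_trunc_mul N f g n : (n < N)%N ->
  fps_mul f g n = (trunc N f * trunc N g)`_n.
Proof.
move=> ltnN; rewrite coefM; apply: eq_bigr => i _.
have leiN : (i < N)%N by apply: leq_ltn_trans ltnN; rewrite -ltnS.
by rewrite !coef_poly leiN (leq_ltn_trans (leq_subr _ _) ltnN).
Qed.

Fact fps_mulA : associative fps_mul.
Proof.
move=> f g h; apply/funext => n.
transitivity ((trunc n.+1 f * trunc n.+1 g * trunc n.+1 h)`_n).
  rewrite -mulrA coefM; apply: eq_bigr => i _.
  rewrite coef_poly ltn_ord; congr (_ * _).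
  by apply: coef_trunc_mul; rewrite ltnS leq_subr.
rewrite coefM; apply: eq_bigr => i _; rewrite -coef_trunc_mul //.
by rewrite coef_poly ltnS leq_subr.
Qed.

Fact fps_mulC : commutative fps_mul.
Proof.
by move=> f g; apply/funext => n; rewrite !(@coef_trunc_mul n.+1) // mulrC.
Qed.

Fact fps_mul1 : left_id fps_one fps_mul.
Proof.
move=> f; apply/funext => n; rewrite /fps_mul big_ord_recl /fps_one mul1r subn0.
by rewrite big1 ?addr0 // => i _; rewrite mul0r.
Qed.

Fact fps_mulDl : left_distributive fps_mul fps_add.
Proof.
move=> f g h; apply/funext => n; rewrite /fps_mul /fps_add -big_split /=.
by apply: eq_bigr => i _; rewrite mulrDl.
Qed.

Fact fps_one_neq0 : fps_one != 0 :> fps k.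
Proof.
by apply/eqP => /(congr1 (fun f : fps k => f 0%N)) /eqP; rewrite oner_eq0.
Qed.

HB.instance Definition _ := GRing.Zmodule_isComNzRing.Build (fps k)
  fps_mulA fps_mulC fps_mul1 fps_mulDl fps_one_neq0.

Let unitb (f : fps k) : bool := `[< exists g : fps k, g * f = 1 >].
Let inv (f : fps k) : fps k :=
  if unitb f then xget 0 [set g : fps k | g * f = 1] else f.

Fact fps_mulVr : {in unitb, left_inverse 1 inv *%R}.
Proof.
move=> f uf; have uf' : unitb f := uf.
rewrite /inv uf'; have /asboolP [g gf] := uf'.
exact: (xgetPex 0 (ex_intro (fun g => [set g : fps k | g * f = 1] g) g gf)).
Qed.

Fact fps_unitPl (f g : fps k) : g * f = 1 -> unitb f.
Proof. by move=> gf; apply/asboolP; exists g. Qed.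

Fact fps_inv_out : {in [predC unitb], inv =1 id}.
Proof.
by move=> f nuf; have /negbTE nuf' : ~~ unitb f := nuf; rewrite /inv nuf'.
Qed.

HB.instance Definition _ := GRing.ComNzRing_hasMulInverse.Build (fps k)
  fps_mulVr fps_unitPl fps_inv_out.

Let fps_neq0 (f : fps k) : f != 0 ->
  exists n, f n != 0 /\ forall m, (m < n)%N -> f m = 0.
Proof.
move=> f0; have ex : exists n, f n != 0.
  apply: contrapT => /forallNP nf; case/eqP: f0.
  by apply/funext => n; apply/eqP; apply: contraT => /nf.
exists (ex_minn ex); case: ex_minnP => n fn minn; split=> // m.
by apply: contraTeq => /minn; rewrite leqNgt.
Qed.

Fact fps_mulf_eq0 : GRing.integral_domain_axiom (fps k).
Proof.
move=> f g fg0; apply: contraT; rewrite negb_or => /andP[/fps_neq0 [i [fi ltf]]].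
move=> /fps_neq0 [j [gj ltg]].
have : (f * g) (i + j)%N = f i * g j.
  have ltij : (i < (i + j).+1)%N by rewrite ltnS leq_addr.
  rewrite [LHS](bigD1 (Ordinal ltij)) //= addKn big1 ?addr0 // => l.
  rewrite -val_eqE /= neq_ltn => /orP[/ltf->|lil]; first by rewrite mul0r.
  by rewrite ltg ?mulr0 // ltn_subLR ?ltn_add2r // -ltnS.
rewrite fg0 => /esym/eqP; change ((0 : fps k) (i + j)%N) with (0 : k).
by rewrite mulf_eq0 (negbTE fi) (negbTE gj).
Qed.

HB.instance Definition _ :=
  GRing.ComUnitRing_isIntegral.Build (fps k) fps_mulf_eq0.

End PowerSeries.

Section AffineWeyl.
Variable d : nat.

(* The extended affine Weyl group S_d |x Z^d.  In the group law, the product of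
   permutations (s2 * s1)%g means: first s2, then s1. *)
Definition affW : Type := 'S_d * 'rV[int]_d.
Implicit Types w x y : affW.

Definition perm_act (s : 'S_d) (a : 'rV[int]_d) : 'rV[int]_d :=
  \row_i a 0 ((s^-1)%g i).
Definition wact w (a : 'rV[int]_d) : 'rV[int]_d := perm_act w.1 a + w.2.
Definition wone : affW := (1%g, 0).
Definition wmul w x : affW := ((x.1 * w.1)%g, w.2 + perm_act w.1 x.2).
Definition winv w : affW := ((w.1^-1)%g, - perm_act (w.1^-1)%g w.2).

Lemma wactM w x a : wact (wmul w x) a = wact w (wact x a).
Proof.
by apply/rowP => i; rewrite !mxE invMg permM addrC [in RHS]addrC addrAC addrA.
Qed.

Lemma wact1 a : wact wone a = a.
Proof. by apply/rowP => i; rewrite !mxE invg1 perm1 addr0. Qed.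

Lemma wactVK w : cancel (wact w) (wact (winv w)).
Proof.
by move=> a; apply/rowP => i; rewrite !mxE invgK permK addrK.
Qed.

Definition Wa : set affW := [set w : affW | \sum_i w.2 0 i = 0].

Definition Wfix (A : set 'rV[int]_d) : set affW :=
  [set w : affW | Wa w /\ forall a, A a -> wact w a = a].

(* Coordinates are numbered 0, ..., d-1, so that ord_pred 0 is the last one;
   simple_refl i swaps the coordinates i-1 and i (s_0 : the last and first). *)
Definition simple_refl (i : 'I_d) : affW :=
  (tperm (ord_pred i) i,
   if val i == 0%N then \row_j ((val j == 0%N)%:R - (val j == d.-1)%:R) else 0).

Definition iota_w : affW :=
  (perm (@ordS_inj d), \row_j (val j == 0%N)%:R).

Definition omega (i : 'I_d) : 'rV[int]_d := \row_j (j < i)%N%:R.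

Definition word_prod (s : seq 'I_d) : affW :=
  foldr (fun i w => wmul (simple_refl i) w) wone s.

Definition wlength w : nat :=
  xget 0%N [set n | (exists s, word_prod s = w /\ size s = n) /\
                    forall s, word_prod s = w -> (n <= size s)%N].

Definition reflection (t : affW) : Prop :=
  exists x i, Wa x /\ t = wmul (wmul x (simple_refl i)) (winv x).

Definition bruhat : affW -> affW -> Prop :=
  clos_refl_trans affW (fun x y =>
    exists t, [/\ reflection t, y = wmul x t & (wlength x < wlength y)%N]).

(* Double cosets in W_a and the order induced on them by the Bruhat order, when
   lengths and the Bruhat order are transported along a bijection c of W_a. *)
Section DoubleCosets.
Variables (c : affW -> affW) (WJ WF : set affW).

(* y is the element of minimal length of x WF. *)
Definition coset_min x y : Prop :=
  (exists z, WF z /\ y = wmul x z) /\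
  forall z, WF z -> (wlength (c y) <= wlength (c (wmul x z)))%N.

Definition dcoset_rep x y : Prop :=
  (exists z, WJ z /\ coset_min (wmul z x) y) /\
  forall z y', WJ z -> coset_min (wmul z x) y' ->
    (wlength (c y') <= wlength (c y))%N.

Definition dcoset_le x x' : Prop :=
  exists y y', [/\ dcoset_rep x y, dcoset_rep x' y' & bruhat (c y) (c y')].

End DoubleCosets.

(* The bijection w |-> g^-1 w (iota g iota^-1) of W_a.  It maps the double
   cosets of the fixers of g.omega_I and (iota g).omega_I to the double cosets
   of the fixers of omega_I and iota.omega_I, which are faces of the base
   alcove; it is the identity for g = 1. *)
Definition to_base_alcove (g w : affW) : affW :=
  wmul (wmul (winv g) w) (wmul (wmul iota_w g) (winv iota_w)).

Definition dcoset (W W' : set affW) w : set affW :=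
  [set x | exists y z, [/\ W y, W' z & x = wmul (wmul y w) z]].

End AffineWeyl.

Section Bruhat.
Variables (R : idomainType) (pi : R) (k : fieldType) (red : R -> k) (d : nat).
Local Notation K := {fraction R}.
Local Notation inK := (@FracField.tofrac R).
Variables (V : finType) (e : 'M[K]_d) (a : V -> 'rV[int]_d).

(* The lattices L(a_v). *)
Definition apt_config (v : V) : 'M[K]_d := apt_basis pi e (a v).
Local Notation B := apt_config.

(* The chosen representatives of the vertices of tau can be ordered as
   L_0 <= L_1 <= ... <= pi^-1 L_0. *)
Definition chain_representatives (tau : {set V}) : Prop :=
  exists (u : V) (s : seq V),
    [/\ u :: s =i tau,
        path (fun v w => `[< lat (B v) `<=` lat (B w) >]) u s &
        lat (B (last u s)) `<=` scale_set (inK pi)^-1 (lat (B u))].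

Definition face_of (tau : {set V}) (g : affW d) (I : {set 'I_d}) : Prop :=
  a @` [set` tau] = (fun i => wact g (omega i)) @` [set` I].

Definition Wsimplex (tau : {set V}) : set (affW d) := Wfix (a @` [set` tau]).

Definition WF (g : affW d) (I : {set 'I_d}) : set (affW d) :=
  Wfix ((fun i => wact (wmul (@iota_w d) g) (omega i)) @` [set` I]).

(* A tuple (h_j W_j)_j, indexed by the maximal simplices, is given by
   representatives h_j; nothing below depends on their choice. *)
Definition adm1 (h : {set V} -> affW d) : Prop :=
  (forall tau, max_simplex pi B tau -> forall v, v \in tau ->
     (forall i, a v 0 i <= wact (h tau) (a v) 0 i <= a v 0 i + 1) /\
     \sum_i wact (h tau) (a v) 0 i - \sum_i a v 0 i = 1) /\
  (forall tau tau', max_simplex pi B tau -> max_simplex pi B tau' ->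
     let W := Wsimplex (tau :&: tau') in
     dcoset W W (h tau) = dcoset W W (h tau')).

(* The lattice Lambda(b) in k((t))^d, with its basis. *)
Definition Lambda_basis (b : 'rV[int]_d) : 'M[{fraction fps k}]_d :=
  apt_basis (fps_X k) 1%:M b.
Definition Lambda (b : 'rV[int]_d) : set 'rV[{fraction fps k}]_d :=
  lat (Lambda_basis b).

Definition translate (L : set 'rV[{fraction fps k}]_d)
    (g : 'M[{fraction fps k}]_d) : set 'rV[{fraction fps k}]_d :=
  (fun x => x *m g) @` L.

(* The group P_j, acting on rows on the right. *)
Definition parahoric (tau : {set V}) : set 'M[{fraction fps k}]_d :=
  [set g | \det g = 1 /\
           forall v, v \in tau -> translate (Lambda (a v)) g = Lambda (a v)].

Definition bruhat_stratum (h : {set V} -> affW d) :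
    set (V -> {vspace 'rV[k]_d}) :=
  [set U | Gr pi red B U /\
    forall tau, max_simplex pi B tau ->
      exists g, parahoric tau g /\
        forall v, v \in tau ->
          scale_set (FracField.tofrac (fps_X k))^-1
            (lat_preim (@fps_red k) (Lambda_basis (a v)) (U v))
          = translate (Lambda (wact (h tau) (a v))) g].

(* Here (a_v)_{v in tau} = g_tau . omega_(I_tau).  The order on the double
   cosets is relative to an alcove that contains the face tau, namely the
   translate of the base alcove by g_tau; it does not depend on the choice of
   (g_tau, I_tau).  Lengths relative to the base alcove itself would describe
   closures of P_tau-orbits only when tau is a face of the base alcove. *)
Definition gen_bruhat_le (g : {set V} -> affW d) (I : {set V} -> {set 'I_d})
    (h h' : {set V} -> affW d) : Prop :=
  forall tau, max_simplex pi B tau ->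
    dcoset_le (to_base_alcove (g tau)) (Wsimplex tau) (WF (g tau) (I tau))
      (wmul (h tau) (winv (@iota_w d))) (wmul (h' tau) (winv (@iota_w d))).

End Bruhat.

(* Main.v *)
(** Multiplication maps compose or vanish, so on a subrepresentation "[f_(u,v)]
    does not vanish" is a partial order on the vertices.  By convexity its minimal
    elements, the set [Delta_M], can be represented by a chain of lattices between
    some [L] and [pi^-1 L], and every vertex [w] receives its line from exactly one
    of them, the one selected by the largest chain member contained in [L_w].
    Hence [Delta_M] determines [M] up to isomorphism, and shrinking [Delta_M]
    increases the rank vector.  Removing a single vertex [v] from [Delta_M] is
    achieved by deforming the line [eps_u] of another vertex [u] of [Delta_M] to
    [eps_u + t eta] with [f_(u,v) eta = eps_v], which puts [M] in the closure of the
    larger stratum; conversely the vanishing of [f_(u,v)] is a closed condition.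

    For the Bruhat order, the extended affine Weyl group acts on [Z] by bijections
    commuting with the shift by [d], and an admissible [h] on a maximal simplex maps
    each half-line of that simplex to itself plus one point.  Recording which
    half-lines receive the same point turns the rank conditions into inclusions that
    are monotone for the Bruhat order.  The representative of the double coset of [h]
    is [h_D iota^-1], with [h_D] the successor map of a [d]-periodic set [D] cut out
    by the maximal vertices; removing a class from [D] multiplies [h_D] by a
    reflection which increases its length.  Convexity lets one pass from the maximal
    simplices to all of [Gamma]. *)
From HB Require Import structures.
Require Import Defs.
From mathcomp Require Import generic_quotient zify ring.

Set Implicit Arguments.
Unset Strict Implicit.
Unset Printing Implicit Defensive.

Import Order.TTheory GRing.Theory Num.Theory.
Local Open Scope classical_set_scope.
Local Open Scope ring_scope.

(** * The extended affine Weyl group as permutations of Z: words, length and reflections *)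

Section AffinePermutations.
Variable d : nat.
Hypothesis d_gt1 : (1 < d)%N.
Implicit Types (w x y z : affW d) (n m : int) (i k : 'I_d).

(** No length formula and no lifting property of the Bruhat order is used. Two facts suffice: a
    reflection lengthens or shortens according to the order of the two values it exchanges, which
    the exchange property of words gives directly; and inclusions between half-lines are inherited
    downwards. A Bruhat stratum is given by orbits over [k((t))], whereas closures are computed from
    [Delta] over [R]. The bridge has two parts. In an apartment the multiplication maps are
    coordinate projections determined by the exponents alone, so ranks on a stratum can be read off
    over [k[[t]]]. Conversely the closure argument needs every point with the same [Delta] as a
    given point of the stratum to lie in that stratum, so for each maximal simplex an element of the
    parahoric group has to be exhibited. It is taken as [1 + N] with [N] of square zero, which makes
    invertibility and determinant 1 automatic and leaves only the preservation of the lattices to be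
    checked. *)

Fact ordz_subproof n : (`|(n %% d%:Z)%Z| < d)%N.
Proof.
have dN : d%:Z != 0 by lia.
have := ltz_pmod n (_ : 0 < d%:Z); have := modz_ge0 n dN; lia.
Qed.

Definition ordz n : 'I_d := Ordinal (ordz_subproof n).

Definition enc (k : 'I_d) (m : int) : int := m * d%:Z + k%:Z.

Lemma enc_ordz n : enc (ordz n) (n %/ d%:Z)%Z = n.
Proof.
have dN : d%:Z != 0 by lia.
by rewrite /enc /= gez0_abs ?modz_ge0 // -divz_eq.
Qed.

Lemma enc_div k m : (enc k m %/ d%:Z)%Z = m.
Proof.
have dN : d%:Z != 0 by lia.
rewrite /enc divzMDl // divz_small ?addr0 //=.
have := ltn_ord k; lia.
Qed.

Lemma ordz_enc k m : ordz (enc k m) = k.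
Proof.
apply: val_inj; rewrite /= /enc modzMDl modz_small //.
have := ltn_ord k; lia.
Qed.

Lemma int_encP n : exists k m, n = enc k m.
Proof. by exists (ordz n), (n %/ d%:Z)%Z; rewrite enc_ordz. Qed.

Lemma encD k m c : enc k m + c * d%:Z = enc k (m + c).
Proof. rewrite /enc; ring. Qed.

Lemma enc_inj k m k' m' : enc k m = enc k' m' -> k = k' /\ m = m'.
Proof.
move=> E; split; first by rewrite -(ordz_enc k m) E ordz_enc.
by rewrite -(enc_div k m) E enc_div.
Qed.

Lemma ordzD n c : ordz (n + c * d%:Z) = ordz n.
Proof. by have [k [m ->]] := int_encP n; rewrite encD !ordz_enc. Qed.

Lemma ordz_ord k : ordz k%:Z = k.
Proof. by rewrite -[k%:Z]add0r -(mul0r d%:Z) -/(enc k 0) ordz_enc. Qed.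

Lemma enc0 k : enc k 0 = k%:Z.
Proof. by rewrite /enc mul0r add0r. Qed.

Lemma ordz_eq n m : (ordz n == ordz m) = (d%:Z %| n - m)%Z.
Proof.
have [k [b ->]] := int_encP n; have [k' [b' ->]] := int_encP m.
rewrite !ordz_enc; apply/eqP/dvdzP => [->|[c cE]].
  by exists (b - b'); rewrite /enc; ring.
have : enc k b = enc k' (b' + c) by rewrite -encD -cE; ring.
by case/enc_inj.
Qed.

Lemma ordz_eqP n m : reflect (exists c, n = m + c * d%:Z) (ordz n == ordz m).
Proof.
rewrite ordz_eq; apply: (iffP dvdzP) => -[c cE]; exists c; first by rewrite -cE; ring.
by rewrite cE; ring.
Qed.

(* The action of the extended affine Weyl group on Z; the integer m d + k stands
   for the vector t^(-m) e_k of k((t))^d. *)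
Definition aff w n : int :=
  enc (w.1 (ordz n)) ((n %/ d%:Z)%Z + w.2 0 (w.1 (ordz n))).

Lemma affE w k m : aff w (enc k m) = enc (w.1 k) (m + w.2 0 (w.1 k)).
Proof. by rewrite /aff ordz_enc enc_div. Qed.

Lemma aff_mul w x n : aff (wmul w x) n = aff w (aff x n).
Proof.
have [k [m ->]] := int_encP n; rewrite !affE /= permM !mxE permK.
by congr enc; ring.
Qed.

Lemma aff_one n : aff (wone d) n = n.
Proof.
by have [k [m ->]] := int_encP n; rewrite !affE /= perm1 !mxE addr0.
Qed.

Lemma affD w n c : aff w (n + c * d%:Z) = aff w n + c * d%:Z.
Proof.
have [k [m ->]] := int_encP n; rewrite encD !affE encD.
by congr enc; ring.
Qed.

Lemma aff_inj w x : aff w =1 aff x -> w = x.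
Proof.
case: w x => [s v] [s' v'] E.
have E0 k := E (enc k 0); have {E0} E0 k : s k = s' k /\ v 0 (s k) = v' 0 (s' k).
  by have := E0 k; rewrite !affE /= !add0r => /enc_inj.
have ss' : s = s' by apply/permP => k; case: (E0 k).
congr (_, _) => //; apply/rowP => k.
by have [] := E0 ((s^-1)%g k); rewrite -ss' permKV.
Qed.

Lemma wmulA w x y : wmul w (wmul x y) = wmul (wmul w x) y.
Proof. by apply: aff_inj => n; rewrite !aff_mul. Qed.
Lemma wmul1 w : wmul w (wone d) = w.
Proof. by apply: aff_inj => n; rewrite !aff_mul aff_one. Qed.
Lemma w1mul w : wmul (wone d) w = w.
Proof. by apply: aff_inj => n; rewrite !aff_mul aff_one. Qed.

Lemma affK w : cancel (aff w) (aff (winv w)).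
Proof.
move=> n; have [k [m ->]] := int_encP n; rewrite !affE /= permK !mxE invgK.
by congr enc; ring.
Qed.

Lemma affVK w : cancel (aff (winv w)) (aff w).
Proof.
move=> n; have [k [m ->]] := int_encP n; rewrite !affE /= permKV !mxE invgK permKV.
by congr enc; ring.
Qed.

Lemma wmulV w : wmul w (winv w) = wone d.
Proof. by apply: aff_inj => n; rewrite aff_mul affVK aff_one. Qed.
Lemma wmulVw w : wmul (winv w) w = wone d.
Proof. by apply: aff_inj => n; rewrite aff_mul affK aff_one. Qed.
Lemma winv1 : winv (wone d) = wone d.
Proof. by rewrite -[LHS]w1mul wmulV. Qed.
Lemma wmulK w x : wmul (wmul x w) (winv w) = x.
Proof. by rewrite -wmulA wmulV wmul1. Qed.
Lemma wmulVK w x : wmul (wmul x (winv w)) w = x.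
Proof. by rewrite -wmulA wmulVw wmul1. Qed.
Lemma winvK w : winv (winv w) = w.
Proof. by rewrite -[LHS]w1mul -(wmulV w) wmulK. Qed.
Lemma winvM w x : winv (wmul w x) = wmul (winv x) (winv w).
Proof.
apply: aff_inj => n; apply: (can_inj (affK (wmul w x))).
by rewrite affVK !aff_mul !affVK.
Qed.

Lemma aff_eq w n m : (aff w n == aff w m) = (n == m).
Proof. exact/(inj_eq (can_inj (affK w))). Qed.

Lemma aff_ordz w n m : (ordz (aff w n) == ordz (aff w m)) = (ordz n == ordz m).
Proof.
apply/ordz_eqP/ordz_eqP => -[c]; last by move=> ->; exists c; rewrite affD.
by rewrite -affD => /eqP; rewrite aff_eq => /eqP ->; exists c.
Qed.

Lemma aff_iota n : aff (iota_w d) n = n + 1.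
Proof.
have [k [m ->]] := int_encP n; rewrite affE /= permE mxE /enc /=.
have := ltn_ord k; rewrite leq_eqVlt => /orP[/eqP kd|kd].
  have -> : (k.+1 %% d = 0)%N by rewrite kd modnn.
  by rewrite /= -{2}kd; lia.
by rewrite modn_small //=; lia.
Qed.

(** A permutation of the residues does not change their sum, so the total displacement over one
    period is [d] times the total translation. *)
Lemma Wa_sum w : Wa w <-> \sum_(k < d) (aff w k%:Z - k%:Z) = 0.
Proof.
have -> : \sum_(k < d) (aff w k%:Z - k%:Z) = (\sum_k w.2 0 k) * d%:Z.
  rewrite sumrB [X in _ - X](reindex_inj (@perm_inj _ w.1)) -sumrB mulr_suml.
  rewrite [in RHS](reindex_inj (@perm_inj _ w.1)); apply: eq_bigr => k _ /=.
  by rewrite -enc0 affE /enc; ring.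
rewrite /Wa /=; split=> [->|/eqP]; first by rewrite mul0r.
by rewrite mulf_eq0 => /orP[/eqP->//|]; lia.
Qed.

Lemma perm_act_sum (s : 'S_d) (v : 'rV[int]_d) :
  \sum_k perm_act s v 0 k = \sum_k v 0 k.
Proof.
rewrite (reindex_inj (@perm_inj _ s)); apply: eq_bigr => k _ /=.
by rewrite mxE permK.
Qed.

Definition wdeg w := \sum_k w.2 0 k.

Lemma wdegM w x : wdeg (wmul w x) = wdeg w + wdeg x.
Proof.
rewrite /wdeg -(perm_act_sum w.1 x.2) -big_split; apply: eq_bigr => k _.
by rewrite mxE.
Qed.

Lemma wdegV w : wdeg (winv w) = - wdeg w.
Proof.
apply/eqP; rewrite -addr_eq0 -wdegM wmulVw /wdeg.
by rewrite big1 // => k _; rewrite mxE.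
Qed.

Lemma WaM w x : Wa w -> Wa x -> Wa (wmul w x).
Proof. by rewrite /Wa /= => ww wx; apply: (etrans (wdegM _ _)); rewrite /wdeg ww wx. Qed.
Lemma WaV w : Wa w -> Wa (winv w).
Proof. by rewrite /Wa /= => ww; apply: (etrans (wdegV _)); rewrite /wdeg ww oppr0. Qed.
Lemma Wa1 : Wa (wone d).
Proof. by rewrite /Wa /= big1 // => k _; rewrite mxE. Qed.

(** The affine reflection exchanging [a + c d] and [b + c d] for all [c]. When [a] and [b] have the
    same residue it degenerates to a translation of that class, hence the recurrent hypothesis
    [ordz a != ordz b]. *)
Definition swp (a b n : int) : int :=
  if ordz n == ordz a then n - a + b else
  if ordz n == ordz b then n - b + a else n.

Lemma swpl a b : swp a b a = b.
Proof. by rewrite /swp eqxx subrr add0r. Qed.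

Lemma swpr a b : ordz a != ordz b -> swp a b b = a.
Proof. by move=> ab; rewrite /swp [_ == ordz a]eq_sym (negbTE ab) eqxx subrr add0r. Qed.

Lemma swpD a b n c : swp a b (n + c * d%:Z) = swp a b n + c * d%:Z.
Proof. by rewrite /swp ordzD; case: ifP => _; [ring | case: ifP => // _; ring]. Qed.

Variant swp_spec a b n : int -> Prop :=
  | SwpL c of n = a + c * d%:Z : swp_spec a b n (b + c * d%:Z)
  | SwpR c of n = b + c * d%:Z & ordz b != ordz a : swp_spec a b n (a + c * d%:Z)
  | SwpN of ordz n != ordz a & ordz n != ordz b : swp_spec a b n n.

Lemma swpP a b n : swp_spec a b n (swp a b n).
Proof.
rewrite /swp; case: (ordz_eqP n a) => [[c ->]|na].
  have -> : a + c * d%:Z - a + b = b + c * d%:Z by ring.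
  by constructor.
move/ordz_eqP in na; case: (ordz_eqP n b) => [[c nE]|nb].
  have -> : n - b + a = a + c * d%:Z by rewrite nE; ring.
  by apply: SwpR => //; move: na; rewrite nE ordzD.
by constructor => //; apply/ordz_eqP.
Qed.

Lemma swpK a b : ordz a != ordz b -> involutive (swp a b).
Proof.
move=> ab n; case: (swpP a b n) => [c ->|c -> _|na nb].
- by rewrite swpD swpr.
- by rewrite swpD swpl.
by rewrite /swp (negbTE na) (negbTE nb).
Qed.

Lemma swpC a b : ordz a != ordz b -> swp a b =1 swp b a.
Proof.
move=> ab n; rewrite /swp; case: eqP => [->|//]; by rewrite (negbTE ab).
Qed.

Lemma aff_swp w a b n : aff w (swp a b n) = swp (aff w a) (aff w b) (aff w n).
Proof.
case: (swpP a b n) => [c ->|c -> ba|na nb].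
- by rewrite !affD swpD swpl.
- by rewrite !affD swpD swpr // aff_ordz eq_sym.
by rewrite /swp !aff_ordz (negbTE na) (negbTE nb).
Qed.

Lemma aff_swpM w t a b : aff t =1 swp a b ->
  forall n, aff (wmul w t) n = swp (aff w a) (aff w b) (aff w n).
Proof. by move=> tE n; rewrite aff_mul tE aff_swp. Qed.

Lemma ord_predE i : (ord_pred i)%:Z = i%:Z - 1 + (val i == 0%N)%:Z * d%:Z.
Proof.
rewrite /=; case: (posnP i) => [->|i0] /=.
  by rewrite add0n modn_small ?ltn_predL //; lia.
have -> : ((i + d).-1 = i.-1 + d)%N by lia.
by have lti := ltn_ord i; rewrite modnDr modn_small; lia.
Qed.

Lemma ordz_pred i : ordz (i%:Z - 1) = ord_pred i.
Proof. by rewrite -[RHS]ordz_ord ord_predE ordzD. Qed.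

Lemma ordz_neq a b : 0 < b - a -> b - a < d%:Z -> ordz a != ordz b.
Proof.
move=> h1 h2; apply/eqP => /eqP /ordz_eqP [c cE].
have : (b - a) = - c * d%:Z by rewrite cE; ring.
case: (ltrP c 0) => c0 E; last by nia.
by nia.
Qed.

(** For [i = 0] the translation part of [simple_refl] compensates the wrap-around of [ord_pred], so
    that every generator exchanges adjacent integers. *)
Lemma aff_simple i : aff (simple_refl i) =1 swp (i%:Z - 1) i%:Z.
Proof.
have ii : ordz (i%:Z - 1) != ordz i%:Z by apply: ordz_neq; lia.
move=> n; have [k [m ->]] := int_encP n.
have -> : enc k m = k%:Z + m * d%:Z by rewrite /enc addrC.
rewrite affD swpD; congr (_ + _).
rewrite -{1}enc0 affE add0r /=.
have ip : ord_pred i != i by rewrite -ordz_pred -{2}(ordz_ord i).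
case: tpermP => [->|->|kp ki].
- rewrite ord_predE swpD swpl /enc; case: eqP => [i0|]; rewrite !mxE //=; last by lia.
  have -> : (i == d.-1 :> nat)%N = false by lia.
  by rewrite i0 eqxx subr0; lia.
- rewrite swpr // /enc ord_predE; case: eqP => [i0|]; rewrite !mxE ?mul0r //=; last by lia.
  have -> : (ord_pred i == d.-1 :> nat)%N by rewrite /= i0 add0n modn_small ?ltn_predL //; lia.
  have -> : (ord_pred i == 0 :> nat)%N = false by rewrite /= i0 add0n modn_small ?ltn_predL //; lia.
  by rewrite i0 /= sub0r; lia.
move/eqP: kp => kp; move/eqP: ki => ki.
rewrite /swp ordz_pred !ordz_ord (negbTE kp) (negbTE ki) /enc.
case: eqP => [i0|]; rewrite !mxE ?mul0r ?add0r //.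
have -> : (k == 0 :> nat)%N = false by apply: contraNF ki => /eqP k0; apply/eqP/val_inj; rewrite /= k0 i0.
have -> : (k == d.-1 :> nat)%N = false; last by rewrite subrr mul0r add0r.
apply: contraNF kp => /eqP k0; apply/eqP/val_inj; rewrite /= k0 i0 add0n modn_small //.
by rewrite ltn_predL; lia.
Qed.

Lemma Wa_simple i : Wa (simple_refl i).
Proof.
rewrite /Wa /=; case: eqP => i0; last by rewrite big1 // => k _; rewrite mxE.
under eq_bigr do rewrite mxE; rewrite sumrB.
have last_lt : (d.-1 < d)%N by rewrite ltn_predL; lia.
rewrite (bigD1 i) //= i0 eqxx big1 => [|k /eqP ki]; last first.
  by case: eqP => // k0; case: ki; apply: val_inj; rewrite /= k0 i0.
rewrite (bigD1 (Ordinal last_lt)) //= eqxx big1 => [|k /eqP ki] //.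
by case: eqP => // k0; case: ki; apply: val_inj.
Qed.

Lemma word_prod_Wa (s : seq 'I_d) : Wa (word_prod s).
Proof. by elim: s => [|i s IH] /=; [exact: Wa1 | apply: WaM => //; exact: Wa_simple]. Qed.

Lemma simple_wmul i : wmul (simple_refl i) (simple_refl i) = wone d.
Proof.
have ii : ordz (i%:Z - 1) != ordz i%:Z by apply: ordz_neq; lia.
by apply: aff_inj => n; rewrite aff_mul !aff_simple swpK // aff_one.
Qed.

Lemma swp_shift a b c : ordz a != ordz b ->
  swp (a + c * d%:Z) (b + c * d%:Z) =1 swp a b.
Proof.
move=> ab n; case: (swpP a b n) => [e ->|e -> ba|na nb].
- have -> : a + e * d%:Z = (a + c * d%:Z) + (e - c) * d%:Z by ring.
  by rewrite swpD swpl; ring.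
- have -> : b + e * d%:Z = (b + c * d%:Z) + (e - c) * d%:Z by ring.
  by rewrite swpD swpr ?ordzD //; ring.
by rewrite /swp !ordzD (negbTE na) (negbTE nb).
Qed.

Lemma ordz_neqS a : ordz a != ordz (a + 1).
Proof. by apply: ordz_neq; lia. Qed.

Lemma aff_simpleS a : aff (simple_refl (ordz (a + 1))) =1 swp a (a + 1).
Proof.
move=> n; rewrite aff_simple; set i := ordz _.
have [k [c acE]] := int_encP (a + 1).
have ik : i = k by rewrite /i acE ordz_enc.
have -> : a + 1 = i%:Z + c * d%:Z by rewrite acE /enc ik addrC.
have {1}-> : a = (i%:Z - 1) + c * d%:Z.
  by apply: (addIr 1); rewrite acE /enc ik; ring.
rewrite swp_shift //; rewrite -{2}[i%:Z](subrK 1); exact: ordz_neqS.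
Qed.

Lemma swp_conj w t a b : aff t =1 swp a b ->
  aff (wmul (wmul w t) (winv w)) =1 swp (aff w a) (aff w b).
Proof. by move=> tE n; rewrite aff_mul (aff_swpM _ tE) affVK. Qed.

Lemma simpleE_pred i : aff (simple_refl i) =1 swp (i%:Z - 1) (i%:Z - 1 + 1).
Proof. by move=> n; rewrite subrK aff_simple. Qed.

Lemma reflection_swp t : reflection t ->
  Wa t /\ exists a b, [/\ a < b, ordz a != ordz b & aff t =1 swp a b].
Proof.
move=> [x [i [wx ->]]]; split.
  by apply: WaM; [apply: WaM => //; exact: Wa_simple | exact: WaV].
have sE := swp_conj x (simpleE_pred i).
have nab : ordz (aff x (i%:Z - 1)) != ordz (aff x (i%:Z - 1 + 1)).
  by rewrite aff_ordz ordz_neqS.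
case: (ltgtP (aff x (i%:Z - 1)) (aff x (i%:Z - 1 + 1))) => ab.
- by exists (aff x (i%:Z - 1)), (aff x (i%:Z - 1 + 1)).
- exists (aff x (i%:Z - 1 + 1)), (aff x (i%:Z - 1)); split=> //; first by rewrite eq_sym.
  by move=> n; rewrite sE swpC.
by move: nab; rewrite ab eqxx.
Qed.

(** Induction on [b - a]: conjugation by the simple reflection exchanging [b - 1] and [b] lowers
    [b]. If [a] is congruent to [b - 1] it is raised by 1 as well, but then [b - a > d], so the
    order of the two points is kept. *)
Lemma swp_reflection a b : a < b -> ordz a != ordz b ->
  exists t, reflection t /\ aff t =1 swp a b.
Proof.
have [k] : exists k : nat, b - a < k%:Z by exists `|b - a|.+1%N; lia.
elim: k a b => [|k IH] a b; first by lia.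
move=> bak ab nab; have [ba1|ba1] := eqVneq (b - a) 1.
  have -> : b = a + 1 by lia.
  exists (simple_refl (ordz (a + 1))); split; last exact: aff_simpleS.
  by exists (wone d), (ordz (a + 1)); split; [exact: Wa1|rewrite winv1 w1mul wmul1].
set s := simple_refl (ordz b).
have sE : aff s =1 swp (b - 1) b.
  by move=> n; rewrite /s -{1}[b](subrK 1) aff_simpleS subrK.
have nb1 : ordz (b - 1) != ordz b by rewrite -{2}[b](subrK 1) ordz_neqS.
have sb : aff s b = b - 1 by rewrite sE swpr.
have sa : aff s a = a \/ aff s a = a + 1 /\ 3 <= b - a.
  rewrite sE; case: (swpP (b - 1) b a) => [c aE|c aE _|]; last by left.
    right; split; first by rewrite aE; ring.
    have h : b - a = 1 - c * d%:Z by rewrite aE; ring.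
    have : c <> 0 by move=> c0; move: h ba1; rewrite c0; lia.
    by nia.
  by move: nab; rewrite aE ordzD eqxx.
have [] := IH (aff s a) (aff s b).
- by rewrite sb; lia.
- by rewrite sb; lia.
- by rewrite aff_ordz.
move=> t [[x [i [wx tE]]] tswp].
exists (wmul (wmul s t) (winv s)); split.
  exists (wmul s x), i; split; first by apply: WaM => //; exact: Wa_simple.
  by rewrite tE winvM !wmulA.
have ss : cancel (aff s) (aff s) by move=> n; rewrite !sE swpK.
by move=> n; rewrite (swp_conj _ tswp) !ss.
Qed.

(* The letter of the word at which the order of the images of a and b is reversed
   can be deleted. *)
Lemma exchange (s : seq 'I_d) a b t : a < b -> ordz a != ordz b ->
  aff t =1 swp a b -> aff (word_prod s) b < aff (word_prod s) a ->
  exists s', (size s' < size s)%N /\ word_prod s' = wmul (word_prod s) t.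
Proof.
move=> ab nab tE; elim: s => [|i s IH] /=; first by rewrite !aff_one; lia.
rewrite !aff_mul => lt_si; set w := word_prod s in IH lt_si *.
case: (ltgtP (aff w b) (aff w a)) => [lt_w|lt_w|/eqP]; last first.
- by rewrite aff_eq => /eqP ba; move: nab; rewrite ba eqxx.
- exists s; split=> //; apply: aff_inj => n.
  (* A simple reflection reverses only pairs [i - 1 + c d < i + c d], so [w] conjugates [t] into the
     letter [i], and dropping this letter amounts to multiplying by [t]. *)
  have sw : swp (aff w a) (aff w b) =1 swp (i%:Z - 1) i%:Z.
    have ni : ordz (i%:Z - 1) != ordz i%:Z by rewrite -{2}[i%:Z](subrK 1) ordz_neqS.
    move: lt_si; rewrite !aff_simple.
    case: (swpP (i%:Z - 1) i%:Z (aff w a)) lt_w => [c ->|c -> _|_ _];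
    case: (swpP (i%:Z - 1) i%:Z (aff w b)) => [e ->|e -> _|_ _] lt_w lt_s; try by lia.
    have -> : e = c.
      case: (ltgtP e c) => // ec.
        suff : e * d%:Z + d%:Z <= c * d%:Z by lia.
        by rewrite -{2}[d%:Z]mul1r -mulrDl ler_wpM2r //; lia.
      suff : c * d%:Z + d%:Z <= e * d%:Z by lia.
      by rewrite -{2}[d%:Z]mul1r -mulrDl ler_wpM2r //; lia.
    exact: swp_shift.
  rewrite -wmulA aff_mul (aff_swpM _ tE) sw aff_simple swpK //.
  by rewrite -{2}[i%:Z](subrK 1) ordz_neqS.
have [s' [size_s' s'E]] := IH lt_w; exists (i :: s') => /=.
by rewrite s'E wmulA.
Qed.

(* A termination measure: composing with a swap changes it by twice the product of
   the differences of the positions and of the values. *)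
Definition spread w := \sum_(k < d) (aff w k%:Z - k%:Z) ^+ 2.

(** Each summand depends only on the residue class, so the two affected classes may be represented
    by [a] and [b]. *)
Lemma spread_swp w t a b : aff t =1 swp a b -> ordz a != ordz b ->
  spread (wmul w t) = spread w + (aff w b - aff w a) * (b - a) *+ 2.
Proof.
move=> tE nab.
pose F (x : affW d) n := (aff x n - n) ^+ 2.
have FD x n : F x (ordz n)%:Z = F x n.
  have nE : n = (ordz n)%:Z + (n %/ d%:Z)%Z * d%:Z by rewrite -{1}(enc_ordz n) /enc addrC.
  by rewrite /F [in RHS]nE affD; ring.
rewrite /spread (bigD1 (ordz a)) //= (bigD1 (ordz b)) 1?eq_sym //=.
rewrite [in RHS](bigD1 (ordz a)) //= [in RHS](bigD1 (ordz b)) 1?eq_sym //=.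
rewrite -!/(F _ _%:Z) !FD /F !aff_mul !tE swpl swpr //.
rewrite (eq_bigr (fun k : 'I_d => (aff w k%:Z - k%:Z) ^+ 2)); first by ring.
move=> k /andP[ka kb]; rewrite aff_mul tE /swp !ordz_ord.
by rewrite (negbTE ka) (negbTE kb).
Qed.

Lemma spread_ge0 w : 0 <= spread w.
Proof. by apply: sumr_ge0 => k _; exact: sqr_ge0. Qed.

(** A strictly increasing map commuting with the shift by [d] has no room for a step larger than 1,
    so it is a translation, and degree 0 leaves only the identity. *)
Lemma Wa_no_descent w : Wa w -> (forall n, aff w n < aff w (n + 1)) -> w = wone d.
Proof.
move=> /Wa_sum w0 block_increasing.
have lip n (k : nat) : aff w n + k%:Z <= aff w (n + k%:Z).
  elim: k => [|k IH]; first by rewrite !addr0.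
  have -> : n + k.+1%:Z = n + k%:Z + 1 by lia.
  by have := block_increasing (n + k%:Z); lia.
have step n : aff w (n + 1) = aff w n + 1.
  have h1 : aff w n + 1 <= aff w (n + 1) := lip n 1%N.
  have := lip (n + 1) d.-1.
  have -> : n + 1 + d.-1%:Z = n + 1 * d%:Z by lia.
  by rewrite affD; lia.
have trans (k : nat) : aff w k%:Z = aff w 0 + k%:Z.
  elim: k => [|k IH]; first by rewrite addr0.
  have -> : k.+1%:Z = k%:Z + 1 by lia.
  by rewrite step IH addrA.
have aw0 : aff w 0 = 0.
  move: w0; under eq_bigr do rewrite trans addrK.
  by rewrite sumr_const card_ord; lia.
apply: aff_inj => n; rewrite aff_one.
have [k [c ->]] := int_encP n; rewrite /enc addrC affD trans aw0; ring.
Qed.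

Lemma word_prod_cat (u v : seq 'I_d) :
  word_prod (u ++ v) = wmul (word_prod u) (word_prod v).
Proof. by elim: u => [|i u IHu] /=; rewrite ?w1mul ?IHu ?wmulA. Qed.

(** Sorting by adjacent exchanges: each removal of a descent lowers [spread], which is
    nonnegative. *)
Lemma Wa_word w : Wa w -> exists s, word_prod s = w.
Proof.
have [k] : exists k : nat, spread w < k%:Z by exists `|spread w|.+1%N; lia.
elim: k w => [|k IH] w; first by have := spread_ge0 w; lia.
move=> wk ww; have [block_increasing|] := pselect (forall n, aff w n < aff w (n + 1)).
  by exists [::]; rewrite (Wa_no_descent ww block_increasing).
move=> /existsNP [n /negP]; rewrite -leNgt => wn.
set s := simple_refl (ordz (n + 1)).
have sE : aff s =1 swp n (n + 1) by exact: aff_simpleS.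
have nn : aff w (n + 1) != aff w n by rewrite aff_eq; lia.
have [] := IH (wmul w s).
- by rewrite (spread_swp _ sE) ?ordz_neqS //; lia.
- by apply: WaM => //; exact: Wa_simple.
move=> u uE; exists (u ++ [:: ordz (n + 1)]).
by rewrite word_prod_cat uE /= wmul1 -wmulA simple_wmul wmul1.
Qed.

(** Words exist for the elements of [Wa], so [wlength] is a true minimum there and not the default
    value of [xget]. *)
Lemma wlengthP w : Wa w ->
  exists s, [/\ word_prod s = w, size s = wlength w &
    forall s', word_prod s' = w -> (wlength w <= size s')%N].
Proof.
move=> /Wa_word [s0 s0E].
pose P (n : nat) := `[< exists s : seq 'I_d, word_prod s = w /\ size s = n >].
have exP : exists n : nat, P n by exists (size s0); apply/asboolP; exists s0.
case: (ex_minnP exP) => n /asboolP [s [sE sn]] minn.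
have [] : [set n : nat | (exists s, word_prod s = w /\ size s = n) /\
    forall s, word_prod s = w -> (n <= size s)%N] (wlength w).
  rewrite /wlength; apply: (@xgetPex _ 0%N); exists n; split; first by exists s.
  by move=> s' s'E; apply: minn; apply/asboolP; exists s'.
by move=> [s' [s'E s'n]] h; exists s'.
Qed.

Lemma wlength_swp_lt w t a b : Wa w -> a < b -> ordz a != ordz b ->
  aff t =1 swp a b -> aff w b < aff w a -> (wlength (wmul w t) < wlength w)%N.
Proof.
move=> ww ab nab tE wab; have [s [sE <- _]] := wlengthP ww.
have [|s' [ss' s'E]] := @exchange s a b t ab nab tE; first by rewrite sE.
apply: leq_ltn_trans ss'.
have wt : Wa (wmul w t) by rewrite -sE -s'E; exact: word_prod_Wa.
by have [_ [_ _ ->]] := wlengthP wt; rewrite // s'E sE.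
Qed.

Lemma wlength_swp_gt w t a b : Wa w -> Wa t -> a < b -> ordz a != ordz b ->
  aff t =1 swp a b -> aff w a < aff w b -> (wlength w < wlength (wmul w t))%N.
Proof.
move=> ww wt ab nab tE wab.
have {1}<- : wmul (wmul w t) t = w.
  rewrite -wmulA (_ : wmul t t = wone d) ?wmul1 //.
  by apply: aff_inj => n; rewrite aff_mul !tE swpK // aff_one.
apply: (wlength_swp_lt _ ab nab tE); first exact: WaM.
by rewrite !aff_mul !tE swpl swpr.
Qed.

(** In lattice terms: [w] maps the lattice of the half-line below [m] into that of the half-line
    below [j]. *)
Definition maps_below w (m j : int) := forall n, n < m -> aff w n < j.

(** In a step up, the larger of two values moves to the earlier position. Hence every value [x(n)]
    is at most some value of [y] at a position not after [n]. *)
Lemma bruhat_maps_below x y m j : Wa x -> bruhat x y ->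
  maps_below y m j -> maps_below x m j.
Proof.
move=> wx xy; suff [] : Wa y /\ (maps_below y m j -> maps_below x m j) by [].
elim: xy wx => {x y} [x y [t [rt -> lt_xy]] wx|x //|x y z _ IH1 _ IH2 wx]; last first.
  have [wy h1] := IH1 wx; have [wz h2] := IH2 wy; split=> // h; exact/h1/h2.
have [wt [a [b [ab nab tE]]]] := reflection_swp rt.
split; first exact: WaM.
have xab : aff x a < aff x b.
  case: (ltgtP (aff x a) (aff x b)) => // [ba|/eqP]; last first.
    by rewrite aff_eq => /eqP E; move: nab; rewrite E eqxx.
  by have := wlength_swp_lt wx ab nab tE ba; lia.
move=> h n nm; have := h _ nm; rewrite aff_mul tE.
have := h (aff t n); rewrite !aff_mul !tE swpK //.
case: (swpP a b n) nm => [c ->|c -> _|//] nm; rewrite !affD; first by lia.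
by move=> + _; apply; lia.
Qed.

End AffinePermutations.

(** * Blocks of a face: minimal coset representatives and double cosets *)

Section Blocks.
Variables (d : nat) (d_gt1 : (1 < d)%N) (I : {set 'I_d}) (i0 : 'I_d).
Hypothesis i0I : i0 \in I.
Implicit Types (w x y z h t : affW d) (n m j a b p : int) (i k : 'I_d).

Local Notation ordz := (ordz d_gt1).
Local Notation aff := (aff d_gt1).
Local Notation swp := (swp d_gt1).
Local Notation maps_below := (maps_below d_gt1).

(* The half-lines {m | m < j} with j in J = I + d Z stand for the lattices of a
   face and their multiples; the integers between two consecutive elements of J
   form a block. *)
Definition inJ n := ordz n \in I.

Lemma inJD n c : inJ (n + c * d%:Z) = inJ n.
Proof. by rewrite /inJ ordzD. Qed.

Lemma inJ_floor n : exists j (k : nat),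
  [/\ inJ j, n = j + k%:Z & forall m, j < m -> m <= n -> ~~ inJ m].
Proof.
have ex : exists k : nat, inJ (n - k%:Z).
  have [c cE] : exists c : int, n - (i0 : nat)%:Z - c * d%:Z >= 0.
    exists (- (absz (n - i0%:Z)%R)%:Z).
    have : (absz (n - i0%:Z)%R)%:Z * 1 <= (absz (n - i0%:Z)%R)%:Z * d%:Z.
      by rewrite ler_wpM2l //; lia.
    by lia.
  exists (absz (n - i0%:Z - c * d%:Z)%R); rewrite gez0_abs //.
  by rewrite (_ : n - _ = i0%:Z + c * d%:Z) ?inJD ?/inJ ?ordz_ord //; ring.
case: (ex_minnP ex) => k kJ mink; exists (n - k%:Z), k; split=> //; first by ring.
move=> m jm mn; apply/negP => mJ.
have := mink (absz (n - m)%R); rewrite gez0_abs; last by lia.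
by rewrite (_ : n - (n - m) = m) ?mJ; [lia | ring].
Qed.

Lemma block_lt_d n m : n < m -> (forall j, n < j -> j <= m -> ~~ inJ j) ->
  m - n < d%:Z.
Proof.
move=> nm nJ; rewrite ltNge; apply/negP => dmn.
have [j [k [jJ mE h]]] := inJ_floor m.
have jn : j <= n by rewrite leNgt; apply: contraL jJ => jn; apply: nJ; lia.
have := h (j + 1 * d%:Z); rewrite inJD jJ => H.
by have : false by apply: H; lia.
Qed.

(** The fixer in [Wa] of the vertices [omega i], [i] in [I], expressed by half-lines; see
    [stabP]. *)
Definition stab z := Wa z /\ forall n j, inJ j -> (aff z n < j) = (n < j).

Lemma stab1 : stab (wone d).
Proof. by split=> [|n j _]; [exact: Wa1 | rewrite aff_one]. Qed.
Lemma stabM z z' : stab z -> stab z' -> stab (wmul z z').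
Proof.
move=> [wz hz] [wz' hz']; split=> [|n j jJ]; first exact: WaM.
by rewrite aff_mul hz // hz'.
Qed.
Lemma stabV z : stab z -> stab (winv z).
Proof.
move=> [wz hz]; split=> [|n j jJ]; first exact: (WaV d_gt1).
by rewrite -hz // affVK.
Qed.

Lemma stab_swp n n' t : reflection t -> aff t =1 swp n n' -> n < n' ->
  (forall j, n < j -> j <= n' -> ~~ inJ j) -> stab t.
Proof.
move=> /(reflection_swp d_gt1) [wt _] tE nn' nJ; split=> // m j jJ; rewrite tE.
have aux c : (n' + c * d%:Z < j) = (n + c * d%:Z < j).
  apply/idP/idP => [|lt]; first by lia.
  rewrite ltNge; apply/negP => jn'.
  have := nJ (j - c * d%:Z); rewrite -mulNr inJD jJ => H.
  by have : false by apply: H; lia.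
by case: (swpP d_gt1 n n' m) => [c ->|c -> _|//]; rewrite aux.
Qed.

(** The shape of the elements of minimal length in their cosets modulo [stab] on the right. *)
Definition block_increasing h := forall n n', n < n' ->
  (forall j, n < j -> j <= n' -> ~~ inJ j) -> aff h n < aff h n'.

(** On a block starting at [j], the value at [j] is at least [j] and each step raises the value by
    at least 1. *)
Lemma increasing_ge z : block_increasing z -> (forall n j, inJ j -> (aff z n < j) = (n < j)) ->
  forall n, n <= aff z n.
Proof.
move=> incz hz n; have [j [k [jJ -> nJ]]] := inJ_floor n.
elim: k {n} nJ => [|k IH] nJ; first by rewrite addr0 leNgt hz // ltxx.
have -> : j + k.+1%:Z = j + k%:Z + 1 by lia.
have : aff z (j + k%:Z) < aff z (j + k%:Z + 1).
  by apply: incz => [|m m1 m2]; [lia | apply: nJ; lia].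
suff : j + k%:Z <= aff z (j + k%:Z) by lia.
by apply: IH => m m1 m2; apply: nJ; lia.
Qed.

Lemma increasing_quotient h h' : block_increasing h -> block_increasing h' ->
  (forall m j, inJ j -> (aff (winv h) m < j) = (aff (winv h') m < j)) ->
  let z := wmul (winv h') h in
  block_increasing z /\ forall n j, inJ j -> (aff z n < j) = (n < j).
Proof.
move=> inch inch' hh' z.
have hz n j : inJ j -> (aff z n < j) = (n < j).
  by move=> jJ; rewrite aff_mul -hh' // affK.
split=> // n n' nn' nJ; rewrite ltNge; apply/negP => le_z.
have neq_z : aff z n' != aff z n by rewrite aff_eq; lia.
have : aff h' (aff z n') < aff h' (aff z n).
  apply: inch' => [|j j1 j2]; first by lia.
  apply/negP => jJ; move: j1; rewrite hz //; move: j2; rewrite leNgt hz //; lia.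
rewrite !aff_mul !affVK; have := inch n n' nn' nJ; lia.
Qed.

(** The quotient [h'^-1 h] and its inverse are both increasing on blocks and preserve the
    half-lines, so both are at least the identity. *)
Lemma increasing_unique h h' : block_increasing h -> block_increasing h' ->
  (forall m j, inJ j -> (aff (winv h) m < j) = (aff (winv h') m < j)) -> h = h'.
Proof.
move=> inch inch' hh'.
have [i1 s1] := increasing_quotient inch inch' hh'.
have [i2 s2] := increasing_quotient inch' inch (fun m j jJ => esym (hh' m j jJ)).
have le1 := increasing_ge i1 s1; have le2 := increasing_ge i2 s2.
have zz n : aff (wmul (winv h) h') (aff (wmul (winv h') h) n) = n.
  by rewrite !aff_mul affVK affK.
apply: (@aff_inj d d_gt1) => n.
have zn : aff (wmul (winv h') h) n = n.
  by have := le1 n; have := le2 (aff (wmul (winv h') h) n); rewrite zz; lia.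
by rewrite -{2}zn aff_mul affVK.
Qed.


(* The elements that index strata have degree 1; composing with iota^-1 brings them
   to W_a. *)
Definition iota_length h := wlength (wmul h (winv (iota_w d))).
Definition deg1 h := Wa (wmul h (winv (iota_w d))).

Lemma deg1Ml z h : Wa z -> deg1 h -> deg1 (wmul z h).
Proof. by move=> wz wh; rewrite /deg1 -(wmulA d_gt1); apply: WaM. Qed.

Lemma deg1Mr h z : Wa z -> deg1 h -> deg1 (wmul h z).
Proof.
move=> z0 h0; suff : wdeg (wmul (wmul h z) (winv (iota_w d))) = 0 by [].
have zE : wdeg z = 0 := z0; have := h0 : wdeg _ = 0.
by rewrite !wdegM zE addr0.
Qed.

Lemma aff_iotaV n : aff (winv (iota_w d)) n = n - 1.
Proof. by apply: (can_inj (affK d_gt1 (iota_w d))); rewrite affVK aff_iota subrK. Qed.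

(** Composing with [iota^-1] shifts positions by one, so [t] becomes the exchange of [a + 1] and
    [b + 1], to which the comparison of lengths in [Wa] applies. *)
Lemma iota_length_swp h t a b : deg1 h -> a < b -> ordz a != ordz b -> aff t =1 swp a b ->
  exists t', [/\ reflection t',
    wmul (wmul h t) (winv (iota_w d)) = wmul (wmul h (winv (iota_w d))) t' &
    if aff h a < aff h b then (iota_length h < iota_length (wmul h t))%N
    else (iota_length (wmul h t) < iota_length h)%N].
Proof.
move=> wh ab nab tE; set io := iota_w d.
have [t' [rt' t'E]] : exists t', reflection t' /\ aff t' =1 swp (a + 1) (b + 1).
  apply: swp_reflection; first by lia.
  by rewrite -!(aff_iota d_gt1) aff_ordz.
have nab' : ordz (a + 1) != ordz (b + 1) by rewrite -!(aff_iota d_gt1) aff_ordz.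
have E : wmul (wmul h t) (winv io) = wmul (wmul h (winv io)) t'.
  apply: (@aff_inj d d_gt1) => n; rewrite !aff_mul tE t'E; congr (aff h _).
  by rewrite (aff_swp d_gt1 (winv io)) !aff_iotaV !addrK.
exists t'; split=> //; rewrite /iota_length E.
have [wt' _] := reflection_swp d_gt1 rt'.
have aE : aff (wmul h (winv io)) (a + 1) = aff h a by rewrite aff_mul aff_iotaV addrK.
have bE : aff (wmul h (winv io)) (b + 1) = aff h b by rewrite aff_mul aff_iotaV addrK.
case: ltP => hab.
  by apply: (wlength_swp_gt (a := a + 1) (b := b + 1) wh wt' _ nab' t'E); [lia | rewrite aE bE].
apply: (wlength_swp_lt (a := a + 1) (b := b + 1) wh _ nab' t'E); first by lia.
rewrite aE bE lt_neqAle hab andbT aff_eq; lia.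
Qed.

Definition stab_min h h' := (exists z, stab z /\ h' = wmul h z) /\
  forall z, stab z -> (iota_length h' <= iota_length (wmul h z))%N.

Lemma stab_min_increasing h h' : deg1 h -> stab_min h h' -> block_increasing h'.
Proof.
move=> wh [[z [sz h'E]] minh'] n n' nn' nJ.
have nab : ordz n != ordz n'.
  by apply: ordz_neq; [lia | exact: block_lt_d].
have [t [rt tE]] := swp_reflection nn' nab.
have st := stab_swp rt tE nn' nJ.
have wh' : deg1 h' by rewrite h'E; apply: deg1Mr => //; case: sz.
have [t' [_ _]] := iota_length_swp wh' nn' nab tE.
case: ifP => // _; rewrite h'E -(wmulA d_gt1) => lt.
by have := minh' _ (stabM sz st); rewrite h'E; lia.
Qed.

Lemma ex_stab_min h : deg1 h -> exists h', stab_min h h'.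
Proof.
move=> wh; pose P (n : nat) := `[< exists z, stab z /\ iota_length (wmul h z) = n >].
have exP : exists n : nat, P n.
  by exists (iota_length (wmul h (wone d))); apply/asboolP; exists (wone d); split=> //; exact: stab1.
case: (ex_minnP exP) => n /asboolP [z [sz zE]] minn.
exists (wmul h z); split=> [|z' sz']; first by exists z.
by rewrite zE; apply: minn; apply/asboolP; exists z'.
Qed.

Lemma winvM_lt h z m j : stab z -> inJ j ->
  (aff (winv (wmul h z)) m < j) = (aff (winv h) m < j).
Proof.
move=> /stabV [_ hz] jJ; rewrite (_ : aff (winv (wmul h z)) m = aff (winv z) (aff (winv h) m)).
  exact: hz.
by apply: (can_inj (affK d_gt1 (wmul h z))); rewrite affVK aff_mul !affVK.
Qed.

(** A minimal representative exists and is increasing on blocks; [increasing_unique] leaves no other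
    increasing element in the coset. *)
Lemma increasing_stab_min h h' : deg1 h -> (exists z, stab z /\ h' = wmul h z) -> block_increasing h' -> stab_min h h'.
Proof.
move=> wh [z [sz h'E]] inch'; have [h2 m2] := ex_stab_min wh.
suff -> : h' = h2 by [].
apply: increasing_unique => //; first exact: stab_min_increasing m2.
by case: m2 => [[z2 [sz2 ->]] _] m j jJ; rewrite h'E !winvM_lt.
Qed.

(* p is the position of the vector of h L that is not in L, for the lattice L of
   the half-line below j. *)
Definition adds_point h := forall j, inJ j ->
  exists p, j <= p /\ forall m, (aff (winv h) m < j) = (m < j) || (m == p).

Lemma adds_point_stabl z h : stab z -> adds_point h -> adds_point (wmul z h).
Proof.
move=> sz ah j jJ; have [p [jp hp]] := ah j jJ; exists (aff z p); split.
  by case: sz => _ hz; rewrite leNgt hz // -leNgt.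
move=> m; have -> : aff (winv (wmul z h)) m = aff (winv h) (aff (winv z) m).
  by apply: (can_inj (affK d_gt1 (wmul z h))); rewrite affVK aff_mul !affVK.
rewrite hp; have [_ ->] := stabV sz; rewrite //.
by rewrite -(aff_eq d_gt1 z) affVK.
Qed.

Lemma adds_point_stabr h z : stab z -> adds_point h -> adds_point (wmul h z).
Proof.
by move=> sz ah j jJ; have [p [jp hp]] := ah j jJ; exists p; split=> // m; rewrite winvM_lt.
Qed.

(* Left multiplication by a simple reflection of W_J cannot lengthen the minimal
   representative h of its right coset into another such representative. *)
Definition terminal h := forall n, ~~ inJ (n + 1) ->
  aff (winv h) n < aff (winv h) (n + 1) ->
  forall j, aff (winv h) n < j -> j <= aff (winv h) (n + 1) -> ~~ inJ j.

(** An element of [stab] moves every integer inside its block, hence by less than [d]. *)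
Lemma spread_stab_bounded h : exists c, forall z, stab z -> spread d_gt1 (wmul z h) <= c.
Proof.
exists (\sum_(k < d) (d%:Z + `|aff h k%:Z - k%:Z|) ^+ 2) => z [_ hz].
apply: ler_sum => k _; rewrite aff_mul; set n := aff h k%:Z.
have [j [l [jJ nE nJ]]] := inJ_floor n.
have nd : n < j + 1 * d%:Z.
  rewrite ltNge; apply/negP => le_n; have := nJ (j + 1 * d%:Z); rewrite inJD jJ => H.
  by have : false by apply: H; lia.
have z1 : j <= aff z n by rewrite leNgt hz // -leNgt; lia.
have z2 : aff z n < j + 1 * d%:Z by rewrite hz // inJD.
set D := `|n - k%:Z|; have D0 : 0 <= D by [].
rewrite -(real_normK (num_real _)) ler_sqr ?nnegrE ?addr_ge0 //.
have -> : aff z n - k%:Z = (aff z n - n) + (n - k%:Z) by ring.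
by apply: le_trans (ler_normD _ _) _; rewrite lerD2r; lia.
Qed.


(** Exchanging adjacent values changes the order of no other pair, up to period, and the positions
    [a] and [b] of these two lie in different blocks because of [j]. *)
Lemma increasing_swp_left h n t a b j : block_increasing h -> aff h a = n -> aff h b = n + 1 ->
  aff t =1 swp a b -> a < j -> j <= b -> inJ j -> block_increasing (wmul h t).
Proof.
move=> inch ha hb tE aj jb jJ x y xy nJ; have hxy := inch x y xy nJ.
rewrite !(aff_swpM h tE) ha hb.
case: (swpP d_gt1 n (n + 1) (aff h x)) hxy => [c hx|c hx _|na _];
case: (swpP d_gt1 n (n + 1) (aff h y)) => [e hy|e hy _|_ nb] hxy; try by lia.
- have xE : x = a + c * d%:Z by apply/eqP; rewrite -(aff_eq d_gt1 h) affD ha hx.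
  have yE : y = b + e * d%:Z by apply/eqP; rewrite -(aff_eq d_gt1 h) affD hb hy.
  have [ec|ne] := eqVneq e c.
    have := nJ (j + c * d%:Z); rewrite inJD jJ => H.
    by have : false by apply: H; rewrite ?xE ?yE ?ec; lia.
  have [ce|ec] := lerP (c + 1) e.
    have : (c + 1) * d%:Z <= e * d%:Z by rewrite ler_wpM2r //; lia.
    by rewrite mulrDl mul1r; lia.
  have : (e + 1) * d%:Z <= c * d%:Z by rewrite ler_wpM2r //; lia.
  by rewrite mulrDl mul1r; lia.
- case: (eqVneq (aff h y) (n + 1 + c * d%:Z)) => [E|]; last by lia.
  by rewrite E ordzD eqxx in nb.
- case: (eqVneq (aff h x) (n + e * d%:Z)) => [E|]; last by lia.
  by rewrite E ordzD eqxx in na.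
Qed.

(** While [terminal] fails at some [n], multiply on the left by the exchange of [n] and [n + 1],
    which lies in [stab] as [n + 1] is not in J. The length and [spread] both grow, and [spread] is
    bounded on the orbit, so this stops. *)
Lemma terminal_exists h : deg1 h -> block_increasing h ->
  exists z, [/\ stab z, block_increasing (wmul z h), terminal (wmul z h) & (iota_length h <= iota_length (wmul z h))%N].
Proof.
move=> wh inch; have [c bound] := spread_stab_bounded h.
suff H (k : nat) z : stab z -> block_increasing (wmul z h) -> c - spread d_gt1 (wmul z h) < k%:Z ->
  exists z', [/\ stab z', block_increasing (wmul z' h), terminal (wmul z' h) &
    (iota_length (wmul z h) <= iota_length (wmul z' h))%N].
  have [] := H (absz (c - spread d_gt1 h)%R).+1 (wone d); rewrite ?(w1mul d_gt1) //.
  - exact: stab1.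
  - by lia.
  by move=> z ?; exists z.
elim: k z => [|k IH] z sz incz zk.
  by have := bound z sz; lia.
set f := wmul z h in incz zk *.
have wf : deg1 f by apply: deg1Ml => //; case: sz.
have [tf|] := pselect (terminal f); first by exists z; split.
move=> /existsNP [n] /not_implyP [nJ] /not_implyP [ab] /existsNP [j] /not_implyP [aj].
move=> /not_implyP [jb] /negP; rewrite negbK => jJ.
set a := aff (winv f) n in ab aj; set b := aff (winv f) (n + 1) in ab jb.
have fa : aff f a = n by rewrite affVK.
have fb : aff f b = n + 1 by rewrite affVK.
have nab : ordz a != ordz b by rewrite aff_ordz ordz_neqS.
have [t [rt tE]] := swp_reflection ab nab.
have [s [rs sE]] : exists s, reflection s /\ aff s =1 swp n (n + 1).
  by apply: swp_reflection; [lia | exact: ordz_neqS].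
have ss : stab s.
  apply: (stab_swp rs sE) => [|m m1 m2]; first by lia.
  have mE : m = n + 1 by lia.
  by rewrite mE.
(* Exchanging two values on the left is exchanging their positions on the right. *)
have E : wmul (wmul s z) h = wmul f t.
  apply: (@aff_inj d d_gt1) => m; rewrite -(wmulA d_gt1) aff_mul sE.
  by rewrite (aff_swpM f tE) fa fb.
have [t' [_ _]] := iota_length_swp wf ab nab tE; rewrite fa fb ifT; last by lia.
rewrite -E => lt_ell.
have [||z' [sz' i' t2 le']] := IH (wmul s z) (stabM ss sz).
- by rewrite E; exact: (increasing_swp_left incz fa fb tE aj jb jJ).
- by rewrite E (spread_swp f tE nab) fa fb; lia.
by exists z'; split=> //; lia.
Qed.

(* Encodes the maximal vertices (the set Delta) of the stratum of h inside a face. *)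
Definition Dmax h n := inJ n /\ forall j, inJ j -> j < n -> maps_below h j n.

Lemma DmaxD h n c : Dmax h (n + c * d%:Z) <-> Dmax h n.
Proof.
suff H m e : Dmax h m -> Dmax h (m + e * d%:Z).
  by split=> [/(H _ (- c))|/(H _ c)] //; rewrite (_ : _ + _ = n) //; ring.
move=> [mJ hm]; split=> [|j jJ jm x xj]; first by rewrite inJD.
have := hm (j + (- e) * d%:Z); rewrite inJD => /(_ jJ _ (x + (- e) * d%:Z)).
rewrite affD => H; have : aff h x + (- e) * d%:Z < m; last by lia.
by apply: H; lia.
Qed.

Definition Dset h : {set 'I_d} := [set i : 'I_d | `[< Dmax h (i : nat)%:Z >]].

Lemma DsetP h n : reflect (Dmax h n) (ordz n \in Dset h).
Proof.
rewrite /Dset finset.in_set; apply: (iffP (asboolP _)) => H.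
  rewrite -(enc_ordz d_gt1 n) /enc addrC; exact/DmaxD.
apply/(DmaxD h _ (n %/ d%:Z)%Z); rewrite addrC -/(enc _ _) enc_ordz //.
Qed.

(* The successor map of the set of [n] with [n + 1] in D: the map that sends each
   element of this set to the next one and fixes the other integers. *)
Definition is_succ (D : {set 'I_d}) h := forall n,
  if ordz (n + 1) \in D then
    [/\ n < aff h n, ordz (aff h n + 1) \in D &
      forall m, n < m -> m < aff h n -> ordz (m + 1) \notin D]
  else aff h n = n.

Lemma is_succ_unique (D : {set 'I_d}) h h' : is_succ D h -> is_succ D h' -> h = h'.
Proof.
move=> sh sh'; apply: (@aff_inj d d_gt1) => n.
have := sh n; have := sh' n; case: ifP => // _; last by move=> -> ->.
move=> [n1 d1 l1] [n2 d2 l2].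
case: (ltgtP (aff h n) (aff h' n)) => // lt.
  by have := l1 _ n2 lt; rewrite d2.
by have := l2 _ n1 lt; rewrite d1.
Qed.

(** * Terminal elements are successor maps *)

Section Terminal.
Variable h : affW d.
Hypotheses (ah : adds_point h) (inch : block_increasing h) (th : terminal h).

(** For [j <= m < p] the image of the half-line below [j] contains [p], which excludes [m + 1] from
    D. If [j1] is the last element of J up to [p], then [p] is also the point added at [j1], and
    [terminal] forces [p + 1] into J: otherwise [j1] would separate the preimages of [p] and
    [p + 1]. *)
Lemma terminal_step j : inJ j -> exists p, [/\ j <= p,
  forall m, (aff (winv h) m < j) = (m < j) || (m == p),
  ordz (p + 1) \in Dset h &
  forall m, j <= m -> m < p -> ordz (m + 1) \notin Dset h].
Proof.
move=> jJ; have [p [jp hp]] := ah jJ; exists p; split=> // [|m jm mp]; last first.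
  apply/DsetP => -[_ /(_ j jJ)] H.
  have jm1 : j < m + 1 by lia.
  by have := H jm1 (aff (winv h) p); rewrite affVK hp eqxx orbT => /(_ isT); lia.
have [j1 [k [j1J pE nJ]]] := inJ_floor p.
have jj1 : j <= j1 by rewrite leNgt; apply: contraL jJ => ?; apply: nJ => //; lia.
have [p1 [jp1 hp1]] := ah j1J.
have pp1 : p = p1.
  have := hp1 p; have := hp p; rewrite eqxx orbT => pj.
  rewrite (lt_le_trans pj jj1) => /esym/orP[|/eqP//]; lia.
have pJ : inJ (p + 1).
  apply: contraT => npJ.
  have pj1 : aff (winv h) p < j1 by rewrite hp1 pp1 eqxx orbT.
  have p1j : j1 <= aff (winv h) (p + 1).
    by rewrite leNgt hp1 -pp1; apply/negP => /orP[|/eqP]; lia.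
  by have := th npJ (lt_le_trans pj1 p1j) pj1 p1j; rewrite j1J.
apply/DsetP; split=> // j' j'J j'p x xj'.
have j'1 : j' <= j1 by rewrite leNgt; apply: contraL j'J => ?; apply: nJ => //; lia.
have := hp1 (aff h x); rewrite affK (lt_le_trans xj' j'1) -pp1.
by move=> /esym/orP[|/eqP]; lia.
Qed.

(** Strong induction on the distance to the start [j] of the block. The earlier points of the block
    are fixed and [n] is not the point added at [j], so its preimage is at least [j] and not before
    [n]; a preimage after [n] would, by monotonicity on blocks, send [n] to one of the fixed
    points. *)
Lemma terminal_fix n : ordz (n + 1) \notin Dset h -> aff h n = n.
Proof.
have [j [k [jJ -> nJ]]] := inJ_floor n.
elim/ltn_ind: k {n} nJ => k IH.
have [n nE] : exists n : int, n = j + k%:Z by exists (j + k%:Z).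
rewrite -nE => nJ nD.
have IHn (x : int) : j <= x -> x < n -> aff h x = x.
  move=> jx xn; have xE : x = j + (absz (x - j)%R)%:Z by lia.
  rewrite {1}xE IH -?xE //; try by lia.
    by move=> m m1 m2; apply: nJ => //; lia.
  apply/DsetP => -[xJ _]; move: (nJ (x + 1)); rewrite xJ => H.
  by have : false by apply: H; lia.
have [p [jp hp pD _]] := terminal_step jJ.
have np : n != p by apply: contraNneq nD => ->.
set x := aff (winv h) n; have hx : aff h x = n by rewrite affVK.
have jx : j <= x by rewrite leNgt hp (negbTE np) orbF -leNgt; lia.
case: (ltgtP x n) => [xn|nx|xn]; last by rewrite -{1}xn.
  by have := IHn x jx xn; rewrite hx; lia.
have hn : aff h n < n.
  rewrite -{2}hx; apply: inch => // m m1 m2; apply/negP => mJ.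
  have [q [jq hq _ _]] := terminal_step mJ.
  by have := hq n; rewrite -/x m1 /=; lia.
have jhn : j <= aff h n.
  rewrite leNgt; apply/negP => lt.
  by have := hp (aff h n); rewrite lt affK /=; lia.
by have := IHn _ jhn hn => /eqP; rewrite aff_eq; lia.
Qed.

(** If [n + 1] is in D, then [h n] is either the point added at [n + 1], as wanted, or at most [n].
    In the latter case it lies in the block of [n], where it cannot be a fixed point before [n], nor
    [n] itself, which is the point added at the start of the block. *)
Lemma terminal_is_succ : is_succ (Dset h) h.
Proof.
move=> n; case: ifPn => [nD|]; last exact: terminal_fix.
have nJ1 : inJ (n + 1) by case/DsetP: nD.
have [p [jp hp pD lp]] := terminal_step nJ1.
suff -> : aff h n = p.
  by split=> // [|m m1 m2]; [lia | apply: lp => //; lia].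
have := hp (aff h n); rewrite affK (_ : n < n + 1); last by lia.
move=> /esym/orP[hn|/eqP//].
have [j [k [jJ nE nJ]]] := inJ_floor n.
have [p1 [jp1 hp1 p1D lp1]] := terminal_step jJ.
have p1n : p1 = n.
  case: (ltgtP p1 n) => // h1; last by have := lp1 n _ h1; rewrite nD => H; have : false by apply: H; lia.
  have [p1J _] : Dmax h (p1 + 1) by exact/DsetP.
  by have := nJ (p1 + 1); rewrite p1J => H; have : false by apply: H; lia.
have jhn : j <= aff h n.
  rewrite leNgt; apply/negP => lt.
  by have := hp1 (aff h n); rewrite lt affK /=; lia.
case: (eqVneq (aff h n) n) => hnn.
  by have := hp1 (aff h n); rewrite affK hnn p1n eqxx orbT; lia.
have nD' : ordz (aff h n + 1) \notin Dset h.
  apply/DsetP => -[mJ _]; have := nJ (aff h n + 1); rewrite mJ => H.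
  by have : false by apply: H; lia.
by have := terminal_fix nD' => /eqP; rewrite aff_eq (negbTE hnn).
Qed.

End Terminal.

(** If [m0], [n0], [n1] are consecutive for [h] and [n0 + 1] has class [i], exchanging the positions
    [m0 < n0] sends [m0] to [n1] and fixes [n0]. The values satisfy [n0 < n1], so the length
    increases. *)
Lemma is_succ_remove (D : {set 'I_d}) h i i' : is_succ D h -> deg1 h ->
  i \in D -> i' \in D :\ i ->
  exists h', [/\ is_succ (D :\ i) h', deg1 h' &
    bruhat (wmul h (winv (iota_w d))) (wmul h' (winv (iota_w d)))].
Proof.
move=> sh wh iD; rewrite in_setD1 => /andP[i'i i'D].
pose n0 := (i : nat)%:Z - 1; have n0D : ordz (n0 + 1) \in D by rewrite subrK ordz_ord.
pose m0 := aff (winv h) n0; have hm0 : aff h m0 = n0 by rewrite affVK.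
have := sh m0; rewrite hm0; case: ifPn => [m0D [m0n0 _ l0]|m0D m0E]; last first.
  by move: m0D; rewrite -m0E n0D.
have := sh n0; rewrite n0D; set n1 := aff h n0 => -[n01 n1D l1].
have n0i n : (ordz (n + 1) == i) = (ordz n == ordz n0).
  rewrite -(ordz_ord d_gt1 i) !ordz_eq /n0.
  by rewrite (_ : n + 1 - _ = n - ((i : nat)%:Z - 1)) //; ring.
(* The second class [i'] of D has a translate [q + e d] strictly between [n0 - d] and [n0], so the
   predecessor [m0] cannot be a translate of [n0]. *)
have nab : ordz m0 != ordz n0.
  apply/negP => /ordz_eqP [c m0E].
  pose q := (i' : nat)%:Z - 1 + (n0 %/ d%:Z)%Z * d%:Z.
  have qE e : ordz (q + e * d%:Z + 1) = i'.
    rewrite (_ : _ + 1 = (i' : nat)%:Z + ((n0 %/ d%:Z)%Z + e) * d%:Z) ?ordzD ?ordz_ord //.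
    by rewrite /q; ring.
  have qD e : ordz (q + e * d%:Z + 1) \in D by rewrite qE.
  have qn e : q + e * d%:Z != n0.
    by apply: contraNneq i'i => E; have := n0i (q + e * d%:Z); rewrite qE E eqxx => ->.
  have c0 : c < 0 by rewrite ltNge; apply/negP => c0; have := mulr_ge0 c0 (_ : 0 <= d%:Z); lia.
  have cd : c * d%:Z <= -1 * d%:Z by rewrite ler_wpM2r //; lia.
  have [e [e1 e2]] : exists e, n0 - d%:Z <= q + e * d%:Z /\ q + e * d%:Z < n0.
    exists (((n0 - 1 - q) %/ d%:Z)%Z).
    have dN : d%:Z != 0 by lia.
    have := divz_eq (n0 - 1 - q) d%:Z; have := modz_ge0 (n0 - 1 - q) dN.
    have := ltz_pmod (n0 - 1 - q) (_ : 0 < d%:Z); lia.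
  have ne : q + e * d%:Z != n0 - d%:Z.
    have := qn (e + 1); rewrite mulrDl mul1r; lia.
  have := l0 (q + e * d%:Z); rewrite qD => H.
  by have : false by apply: H; lia.
have [t [rt tE]] := swp_reflection m0n0 nab.
have [wt _] := reflection_swp d_gt1 rt.
exists (wmul h t); split; last first.
- have [t' [rt' E]] := iota_length_swp wh m0n0 nab tE.
  rewrite hm0 -/n1 n01 => lt_ell; apply: rt_step; exists t'; split=> //.
- exact: deg1Mr.
move=> n; rewrite in_setD1 n0i (aff_swpM h tE) hm0 -/n1.
have n1n0 : ordz n1 != ordz n0.
  apply/negP => /ordz_eqP [c n1E]; have : aff h (m0 + c * d%:Z) = aff h n0 by rewrite affD hm0.
  by move/eqP; rewrite aff_eq => /eqP E; move: nab; rewrite -E ordzD eqxx.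
have n1D' : ordz (n1 + 1) \in D :\ i by rewrite in_setD1 n0i n1n0.
have shift m c : (ordz (m + c * d%:Z + 1) \in D :\ i) = (ordz (m + 1) \in D :\ i).
  by rewrite (_ : _ + 1 = m + 1 + c * d%:Z) ?ordzD //; ring.
have hswp : swp n0 n1 (aff h n) = aff h (swp m0 n0 n) by rewrite aff_swp hm0.
rewrite hswp; case: (swpP d_gt1 m0 n0 n) => [c ->|c -> _|nm0 nn0].
- rewrite ordzD nab /= (_ : ordz _ \in D); last first.
    by rewrite (_ : _ + 1 = m0 + 1 + c * d%:Z) ?ordzD //; ring.
  rewrite affD -/n1; split; [by rewrite ltrD2r (lt_trans m0n0) | by rewrite shift | move=> m].
  have [m' mE] : exists m', m = m' + c * d%:Z by exists (m - c * d%:Z); ring.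
  rewrite mE !ltrD2r shift in_setD1 n0i => m1 m2; apply/negP => /andP[m'0 m'D].
  case: (ltgtP m' n0) => m'n; last by move: m'0; rewrite m'n eqxx.
    by have := l0 m' m1 m'n; rewrite m'D.
  by have := l1 m' m'n m2; rewrite m'D.
- by rewrite ordzD eqxx /= affD hm0.
have := sh n; rewrite nn0 /=; case: ifP => // nD [nh hD lh].
split=> // [|m m1 m2]; last by rewrite in_setD1 negb_and lh // orbT.
rewrite in_setD1 hD n0i andbT; apply/negP => /ordz_eqP [c hE].
have : aff h n = aff h (m0 + c * d%:Z) by rewrite affD hm0.
by move/eqP; rewrite aff_eq => /eqP E; move: nm0; rewrite E ordzD eqxx.
Qed.

Lemma is_succ_subset (D D' : {set 'I_d}) h i' : is_succ D h -> deg1 h ->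
  D' \subset D -> i' \in D' ->
  exists h', is_succ D' h' /\
    bruhat (wmul h (winv (iota_w d))) (wmul h' (winv (iota_w d))).
Proof.
have [k] : exists k : nat, (#|D :\: D'| < k)%N by exists #|D :\: D'|.+1.
elim: k D h => // k IH D h Dk sh wh sub i'D'.
have [DD'|] := eqVneq (D :\: D') finset.set0.
  exists h; split; last exact: rt_refl.
  suff -> : D' = D by [].
  by apply/eqP; rewrite finset.eqEsubset sub -finset.setD_eq0 DD' eqxx.
move=> /finset.set0Pn [i]; rewrite finset.in_setD => /andP[iD' iD].
have sub' : D' \subset D :\ i.
  apply/fintype.subsetP => l lD'; rewrite in_setD1 (fintype.subsetP sub) // andbT.
  by apply: contraNneq iD' => <-.
have [h1 [sh1 wh1 b1]] := is_succ_remove sh wh iD (fintype.subsetP sub' _ i'D').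
have [|h2 [sh2 b2]] := IH (D :\ i) h1 _ sh1 wh1 sub' i'D'.
  rewrite finset.setDDl finset.setUC -finset.setDDl; move: Dk; rewrite (cardsD1 i (D :\: D')) finset.in_setD iD' iD.
  by rewrite add1n ltnS.
by exists h2; split=> //; apply: rt_trans b1 b2.
Qed.

(** The counterpart of [dcoset_rep] in the coordinates of the base alcove; see [dcoset_repP]. *)
Definition max_stab_min h y := (exists z, stab z /\ stab_min (wmul z h) y) /\
  forall z y', stab z -> stab_min (wmul z h) y' -> (iota_length y' <= iota_length y)%N.

Lemma Dset_stab z h z' : stab z -> stab z' -> Dset (wmul (wmul z h) z') = Dset h.
Proof.
move=> sz sz'.
suff H z1 h1 z2 n : stab z1 -> stab z2 -> Dmax h1 n -> Dmax (wmul (wmul z1 h1) z2) n.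
  apply/setP => i; rewrite !finset.in_set; apply/asboolP/asboolP => [|]; last exact: H.
  move=> /(H (winv z) _ (winv z') _ (stabV sz) (stabV sz')).
  by rewrite !(wmulA d_gt1) (wmulVw d_gt1) (w1mul d_gt1) (wmulK d_gt1).
move=> [wz1 hz1] [wz2 hz2] [nJ hn]; split=> // j jJ jn x xj.
by rewrite !aff_mul hz1 //; apply: (hn j jJ jn); rewrite hz2.
Qed.

Lemma deg1_stab z h : stab z -> deg1 h -> deg1 (wmul z h).
Proof. by case=> wz _; apply: deg1Ml. Qed.

(** Every coset minimum [y] in the double coset extends to a terminal one that is at least as long.
    This is the successor map of [Dset h], which depends on the double coset only, so that one
    element dominates all coset minima. *)
Lemma terminal_rep h z y : deg1 h -> adds_point h -> stab z -> stab_min (wmul z h) y ->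
  exists y', [/\ is_succ (Dset h) y', (iota_length y <= iota_length y')%N &
    exists z', stab z' /\ stab_min (wmul z' h) y'].
Proof.
move=> wh ah sz m; have incy := stab_min_increasing (deg1_stab sz wh) m.
case: m => [[z2 [sz2 yE]] _].
have wy : deg1 y by rewrite yE; apply: deg1Mr; [case: sz2 | exact: deg1_stab].
have ay : adds_point y by rewrite yE; apply: adds_point_stabr => //; apply: adds_point_stabl.
have [z3 [sz3 inc3 t3 le3]] := terminal_exists wy incy.
have E3 : wmul z3 y = wmul (wmul (wmul z3 z) h) z2 by rewrite yE !(wmulA d_gt1).
exists (wmul z3 y); split=> //.
  have := terminal_is_succ (adds_point_stabl sz3 ay) inc3 t3.
  by rewrite {1}E3 Dset_stab //; exact: stabM.
exists (wmul z3 z); split; first exact: stabM.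
apply: increasing_stab_min => //; first by apply: deg1_stab => //; exact: stabM.
by exists z2.
Qed.

Lemma rep_exists h : deg1 h -> adds_point h ->
  exists y, [/\ max_stab_min h y, is_succ (Dset h) y & deg1 y].
Proof.
move=> wh ah; have [y0 m0] := ex_stab_min wh.
have [|y [sy _ [z [sz my]]]] := terminal_rep (y := y0) wh ah stab1; first by rewrite w1mul.
exists y; split=> //; last first.
  case: my => [[z2 [sz2 ->]] _]; apply: deg1Mr; [by case: sz2 | exact: deg1_stab].
split=> [|z' y' sz' my']; first by exists z.
have [y2 [sy2 le _]] := terminal_rep wh ah sz' my'.
by rewrite (is_succ_unique sy sy2).
Qed.

Lemma Dset_nonempty h : deg1 h -> adds_point h -> exists i, i \in Dset h.
Proof.
move=> wh ah; have [y0 m0] := ex_stab_min wh.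
have incy := stab_min_increasing wh m0; case: m0 => [[z2 [sz2 yE]] _].
have wy : deg1 y0 by rewrite yE; apply: deg1Mr => //; case: sz2.
have ay : adds_point y0 by rewrite yE; apply: adds_point_stabr.
have [z3 [sz3 inc3 t3 le3]] := terminal_exists wy incy.
have i0J : inJ (i0 : nat)%:Z by rewrite /inJ ordz_ord.
have [p [_ _ pD _]] := terminal_step (adds_point_stabl sz3 ay) t3 i0J.
exists (ordz (p + 1)); move: pD; rewrite yE (wmulA d_gt1) Dset_stab //.
Qed.

(** The hypothesis yields the inclusion of [Dset h'] in [Dset h]; deleting the classes of the
    difference one by one is a chain of reflections joining the two representatives. *)
Lemma rep_bruhat h h' : deg1 h -> adds_point h -> deg1 h' -> adds_point h' ->
  (forall j j', inJ j -> inJ j' -> j < j' -> maps_below h' j j' -> maps_below h j j') ->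
  exists y y', [/\ max_stab_min h y, max_stab_min h' y' &
    bruhat (wmul y (winv (iota_w d))) (wmul y' (winv (iota_w d)))].
Proof.
move=> wh ah wh' ah' hh'.
have [y [ry sy wy]] := rep_exists wh ah; have [y' [ry' sy' wy']] := rep_exists wh' ah'.
exists y, y'; split=> //.
have [i' i'D] := Dset_nonempty wh' ah'.
have sub : Dset h' \subset Dset h.
  apply/fintype.subsetP => i; rewrite !finset.in_set => /asboolP [iJ hi].
  by apply/asboolP; split=> // j jJ ji; apply: hh' => //; apply: hi.
have [y2 [sy2 b]] := is_succ_subset sy wy sub i'D.
by rewrite (is_succ_unique sy' sy2).
Qed.

End Blocks.

(** * Exponent vectors as sets of integers *)

Section Levels.
Variables (d : nat) (d_gt1 : (1 < d)%N).
Implicit Types (w x y z h g : affW d) (n m c : int) (b : 'rV[int]_d) (i k : 'I_d).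
Local Notation ordz := (ordz d_gt1).
Local Notation aff := (aff d_gt1).

(* The vectors t^(-m) e_k, seen as integers, that lie in the lattice Lambda b. *)
Definition lev b n := (n %/ d%:Z)%Z <= b 0 (ordz n).

Lemma lev_enc b k m : lev b (enc k m) = (m <= b 0 k).
Proof. by rewrite /lev enc_div ?ordz_enc. Qed.

Lemma lev_act w b n : lev (wact w b) (aff w n) = lev b n.
Proof.
have [k [m ->]] := int_encP d_gt1 n.
by rewrite affE !lev_enc !mxE permK lerD2r.
Qed.

Lemma lev_actV w b n : lev (wact w b) n = lev b (aff (winv w) n).
Proof. by rewrite -{1}(affVK d_gt1 w n) lev_act. Qed.

Lemma lev_leP b b' : (forall k, b 0 k <= b' 0 k) <-> (forall n, lev b n -> lev b' n).
Proof.
split=> [le n|H k]; first by move=> /le_trans; apply.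
by have := H (enc k (b 0 k)); rewrite !lev_enc lexx; apply.
Qed.

(** The lattice of [omega i] is the half-line below [i + d] rather than [i]; periodicity makes this
    offset harmless. *)
Lemma lev_omega i c n : lev (omega i + const_mx c) n = (n < (i : nat)%:Z + (c + 1) * d%:Z).
Proof.
have [k [m ->]] := int_encP d_gt1 n; rewrite lev_enc !mxE /enc.
have ltk := ltn_ord k; have lti := ltn_ord i.
case: (lerP m c) => mc; last first.
  have [mc1|mc1] := eqVneq m (c + 1).
    by rewrite mc1; case: (ltnP k i) => ki; lia.
  have cm : (c + 2) * d%:Z <= m * d%:Z by rewrite ler_wpM2r //; lia.
  move: cm; rewrite !mulrDl; case: (ltnP k i) => ki; lia.
have cm : m * d%:Z <= c * d%:Z by rewrite ler_wpM2r //; lia.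
by rewrite mulrDl mul1r; case: (ltnP k i) => ki; lia.
Qed.

Lemma lev_omega0 i n : lev (omega i) n = (n < (i : nat)%:Z + d%:Z).
Proof.
have -> : omega i = omega i + const_mx 0 by apply/rowP => k; rewrite !mxE addr0.
by rewrite lev_omega add0r mul1r.
Qed.

Lemma lev_delta b k n :
  lev (b + delta_mx 0 k) n = lev b n || (n == enc k (b 0 k + 1)).
Proof.
have [l [m ->]] := int_encP d_gt1 n; rewrite !lev_enc !mxE eqxx /=.
have [->|lk] := eqVneq l k.
  have -> : (enc k m == enc k (b 0 k + 1)) = (m == b 0 k + 1).
    by apply/eqP/eqP => [/(enc_inj d_gt1) []|->].
  by rewrite /=; lia.
have -> : (enc l m == enc k (b 0 k + 1)) = false.
  by apply/eqP => /(enc_inj d_gt1) [/eqP]; rewrite (negbTE lk).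
by rewrite addr0 orbF.
Qed.

Lemma maps_belowD w n m c :
  maps_below d_gt1 w (n + c * d%:Z) (m + c * d%:Z) <-> maps_below d_gt1 w n m.
Proof.
suff H n' m' e : maps_below d_gt1 w n' m' -> maps_below d_gt1 w (n' + e * d%:Z) (m' + e * d%:Z).
  by split=> [/(H _ _ (- c))|/H //]; rewrite mulNr !addrK.
move=> h x xn; have := h (x - e * d%:Z); rewrite -mulNr affD => H.
have : aff w x + - e * d%:Z < m' by apply: H; lia.
by lia.
Qed.

Lemma wact_omega_le w i i' c :
  (forall k, wact w (omega i) 0 k <= omega i' 0 k + c) <->
  maps_below d_gt1 w (i : nat)%:Z ((i' : nat)%:Z + c * d%:Z).
Proof.
rewrite -(maps_belowD w _ _ 1).
have -> : (forall k, wact w (omega i) 0 k <= omega i' 0 k + c) <->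
    (forall k, wact w (omega i) 0 k <= (omega i' + const_mx c) 0 k).
  by split=> H k; have := H k; rewrite !mxE.
rewrite lev_leP; split=> H n.
  rewrite mul1r -lev_omega0 -(lev_act w) => /H.
  by rewrite lev_omega mulrDl !mul1r addrA.
rewrite lev_actV lev_omega0 lev_omega => lt.
by have := H (aff (winv w) n); rewrite affVK mulrDl mul1r addrA; apply.
Qed.

Lemma wact_eqP w b b' : wact w b = b' <-> forall n, lev b (aff (winv w) n) = lev b' n.
Proof.
split=> [<- n|H]; first by rewrite lev_actV.
apply/rowP => k; apply/eqP; rewrite eq_le; apply/andP; split; move: k; apply/lev_leP => n;
by rewrite lev_actV H.
Qed.

Lemma wact_sum w b : \sum_k wact w b 0 k = \sum_k b 0 k + wdeg w.
Proof. by rewrite /wdeg -(perm_act_sum w.1 b) -big_split; apply: eq_bigr => k _; rewrite mxE. Qed.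

Lemma wact_delta w b k : wact w (b + delta_mx 0 k) = wact w b + delta_mx 0 (w.1 k).
Proof.
apply/rowP => i; rewrite !mxE eqxx /= addrAC; congr (_ + _ + (nat_of_bool _)%:R).
by rewrite -(inj_eq (@perm_inj _ w.1)) permKV.
Qed.

Section Face.
Variables (I : {set 'I_d}).
Local Notation inJ := (inJ d_gt1 I).
Local Notation stab := (stab d_gt1 I).

Lemma inJP n : inJ n -> exists i c, i \in I /\ n = (i : nat)%:Z + c * d%:Z.
Proof.
move=> nJ; exists (ordz n), (n %/ d%:Z)%Z; split=> //.
by rewrite -{1}(enc_ordz d_gt1 n) /enc addrC.
Qed.

Lemma stabP z : stab z <-> Wa z /\ forall i, i \in I -> wact z (omega i) = omega i.
Proof.
split=> -[wz hz]; split=> //.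
  move=> i iI; apply/wact_eqP => n; rewrite !lev_omega0.
  have iJ : inJ ((i : nat)%:Z + 1 * d%:Z) by rewrite inJD /inJ ordz_ord.
  by have := hz (aff (winv z) n) _ iJ; rewrite affVK mul1r => <-.
move=> n j /inJP [i [c [iI ->]]].
have /wact_eqP H := hz i iI; have := H (aff z (n + (1 - c) * d%:Z)).
rewrite affK !lev_omega0 affD !mulrDl !mul1r mulNr.
by move=> H'; apply/idP/idP; lia.
Qed.

Definition face w := (fun i => wact w (omega i)) @` [set` I].

Lemma Wfix_face w z : Wfix (face w) z <-> stab (wmul (wmul (winv w) z) w).
Proof.
have deg : Wa z <-> Wa (wmul (wmul (winv w) z) w).
  change (wdeg z = 0 <-> wdeg (wmul (wmul (winv w) z) w) = 0).
  suff -> : wdeg (wmul (wmul (winv w) z) w) = wdeg z by [].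
  by rewrite !wdegM (wdegV d_gt1); ring.
rewrite stabP; split=> -[wz hz]; split; try exact/deg.
  move=> i iI; rewrite !wactM hz; first by rewrite wactVK.
  by exists i.
move=> _ [i iI <-]; have := hz i iI; rewrite !wactM => /(congr1 (wact w)).
by rewrite -{1}(winvK d_gt1 w) wactVK.
Qed.

Lemma delta_step (b b' : 'rV[int]_d) : (forall i, b 0 i <= b' 0 i <= b 0 i + 1) ->
  \sum_i b' 0 i - \sum_i b 0 i = 1 -> exists k, b' = b + delta_mx 0 k.
Proof.
move=> bb'; rewrite -sumrB => sum1.
have [k kE] : exists k, b' 0 k - b 0 k = 1.
  apply: contrapT => /forallNP nk; move: sum1; rewrite big1 // => k _.
  by have := nk k; have := bb' k; lia.
exists k; apply/rowP => i; rewrite !mxE eqxx /=.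
have [->|ik] := eqVneq i k; first by rewrite /= mulr1n; lia.
rewrite addr0; move: sum1; rewrite (bigD1 k) //= kE (bigD1 i) //=.
have : 0 <= \sum_(l < d | (l != k) && (l != i)) (b' 0 l - b 0 l).
  by apply: sumr_ge0 => l _; have := bb' l; lia.
set S := \sum_(l < d | _) _ => S0 sum1.
have {}sum1 : (1 : int) + ((b' 0 i - b 0 i) + S) = 1 := sum1.
by move: S S0 sum1 => S; have := bb' i; lia.
Qed.

Lemma adds_point_face g h :
  (forall b, face g b -> (forall i, b 0 i <= wact h b 0 i <= b 0 i + 1) /\
     \sum_i wact h b 0 i - \sum_i b 0 i = 1) ->
  adds_point d_gt1 I (wmul (wmul (winv g) h) g).
Proof.
move=> hadm j /inJP [i [c [iI ->]]].
have [h1 h2] := hadm _ (ex_intro2 _ _ i iI erefl).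
have [k kE] := delta_step h1 h2.
set h0 := wmul _ _; have [l lE] : exists l, wact h0 (omega i) = omega i + delta_mx 0 l.
  exists (((winv g).1) k); rewrite /h0 !wactM kE.
  by rewrite wact_delta wactVK.
have key n : (aff (winv h0) n < (i : nat)%:Z + d%:Z) =
    (n < (i : nat)%:Z + d%:Z) || (n == enc l (omega i 0 l + 1)).
  by rewrite -!lev_omega0 -lev_delta -lE lev_actV.
(* The half-line of [omega i] ends at [i + d] while [j = i + c d], hence the shift by [c - 1]
   periods. *)
exists (enc l (omega i 0 l + 1) + (c - 1) * d%:Z); split.
  have : ~~ lev (omega i) (enc l (omega i 0 l + 1)) by rewrite lev_enc -ltNge ltrDl.
  by rewrite lev_omega0 -leNgt mulrDl; lia.
move=> m; have := key (m + (1 - c) * d%:Z); rewrite affD.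
have -> : (m + (1 - c) * d%:Z == enc l (omega i 0 l + 1)) =
          (m == enc l (omega i 0 l + 1) + (c - 1) * d%:Z).
  by apply/eqP/eqP => [<-|->]; ring.
rewrite !mulrDl !mulNr !mul1r => H.
transitivity (aff (winv h0) m + (d%:Z - c * d%:Z) < (i : nat)%:Z + d%:Z).
  by apply/idP/idP; lia.
by rewrite H; congr (_ || _); apply/idP/idP; lia.
Qed.

End Face.
End Levels.

(** * Double cosets in the coordinates of the base alcove *)

Section Transport.
Variables (d : nat) (d_gt1 : (1 < d)%N) (I : {set 'I_d}) (i0 : 'I_d).
Hypothesis i0I : i0 \in I.
Variable g : affW d.
Implicit Types (w x y z h : affW d) (n m c j : int) (b : 'rV[int]_d) (i k : 'I_d).
Local Notation stab := (stab d_gt1 I).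
Local Notation io := (iota_w d).
Local Notation inJ := (inJ d_gt1 I).
Local Notation below := (maps_below d_gt1).
Local Notation stab_min := (stab_min d_gt1 I).
Local Notation max_stab_min := (max_stab_min d_gt1 I).

Definition wconj w z := wmul (wmul (winv w) z) w.
(** This is [to_base_alcove g] without its final [iota^-1]; it turns [h iota^-1] into the conjugate
    [g^-1 h g]. *)
Definition base x := wmul (wmul (winv g) x) (wmul io g).

Lemma wconjK w z : wconj w (wmul (wmul w z) (winv w)) = z.
Proof.
by rewrite /wconj -!(wmulA d_gt1) (wmulVw d_gt1) (wmul1 d_gt1) (wmulA d_gt1) (wmulVw d_gt1) (w1mul d_gt1).
Qed.

Lemma base_surj y : base (wmul (wmul g y) (winv (wmul io g))) = y.
Proof.
by rewrite /base -!(wmulA d_gt1) (wmulVw d_gt1) (wmul1 d_gt1) (wmulA d_gt1) (wmulVw d_gt1) (w1mul d_gt1).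
Qed.

Lemma base_inj : injective base.
Proof.
move=> x y /(congr1 (fun u => wmul (wmul g u) (winv (wmul io g)))).
rewrite /base; move: (wmul io g) => v.
by rewrite !(wmulA d_gt1) !(wmulK d_gt1) (wmulV d_gt1) !(w1mul d_gt1).
Qed.

Lemma to_base_alcoveE x : to_base_alcove g x = wmul (base x) (winv io).
Proof. by rewrite /to_base_alcove /base !(wmulA d_gt1). Qed.

Lemma base_mulr x z : base (wmul x z) = wmul (base x) (wconj (wmul io g) z).
Proof.
by rewrite /base /wconj; move: (wmul io g) => v; rewrite !(wmulA d_gt1) (wmulK d_gt1).
Qed.

Lemma base_mull x z : base (wmul z x) = wmul (wconj g z) (base x).
Proof.
by rewrite /base /wconj; move: (wmul io g) => v; rewrite !(wmulA d_gt1) (wmulK d_gt1).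
Qed.

Lemma base_iotaV h : base (wmul h (winv io)) = wconj g h.
Proof.
by rewrite /base /wconj !(wmulA d_gt1) (wmulVK d_gt1).
Qed.

Lemma coset_minP x y :
  coset_min (to_base_alcove g) (WF g I) x y <-> stab_min (base x) (base y).
Proof.
have FP z : WF g I z <-> stab (wconj (wmul io g) z) by exact: (Wfix_face d_gt1 I (wmul io g)).
rewrite /coset_min /stab_min /iota_length; split=> -[[z [hz yE]] hmin]; split.
- by exists (wconj (wmul io g) z); split; [exact/FP | rewrite yE base_mulr].
- move=> z' sz'; have := hmin (wmul (wmul (wmul io g) z') (winv (wmul io g))).
  by rewrite !to_base_alcoveE base_mulr FP wconjK; apply.
- exists (wmul (wmul (wmul io g) z) (winv (wmul io g))); split.
    by apply/FP; rewrite wconjK.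
  by apply: base_inj; rewrite base_mulr wconjK.
- move=> z' /FP sz'; have := hmin _ sz'.
  by rewrite !to_base_alcoveE base_mulr.
Qed.

Lemma dcoset_repP x y :
  dcoset_rep (to_base_alcove g) (Wfix (face I g)) (WF g I) x y <-> max_stab_min (base x) (base y).
Proof.
have JP z : Wfix (face I g) z <-> stab (wconj g z) by exact: Wfix_face.
rewrite /dcoset_rep /max_stab_min /iota_length; split=> -[[z [sz my]] hmax]; split.
- by exists (wconj g z); split; [exact/JP | rewrite -base_mull; exact/coset_minP].
- move=> z' y' sz' my'.
  have := hmax (wmul (wmul g z') (winv g)) (wmul (wmul g y') (winv (wmul io g))).
  rewrite JP coset_minP base_mull !wconjK base_surj !to_base_alcoveE base_surj.
  exact.
- exists (wmul (wmul g z) (winv g)); split; first by apply/JP; rewrite wconjK.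
  by apply/coset_minP; rewrite base_mull wconjK.
move=> z' y' /JP sz' /coset_minP; rewrite base_mull => my'.
by rewrite !to_base_alcoveE; apply: hmax sz' my'.
Qed.

Lemma wact_le_conj w b b' c :
  (forall k, wact (winv w) b 0 k <= b' 0 k + c) <-> (forall k, b 0 k <= wact w b' 0 k + c).
Proof.
split=> H k.
  have := H ((w.1^-1)%g k); rewrite !mxE /= !invgK permKV; lia.
have := H (w.1 k); rewrite !mxE /= !invgK permK; lia.
Qed.

Definition wle h b b' c := forall k, wact h b 0 k <= b' 0 k + c.

Lemma wle_below h i i' c : wle h (wact g (omega i)) (wact g (omega i')) c <->
  below (wconj g h) (i : nat)%:Z ((i' : nat)%:Z + c * d%:Z).
Proof. by rewrite -wact_omega_le /wconj !wactM wact_le_conj. Qed.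

Lemma deg1_conj h b : \sum_k wact h b 0 k - \sum_k b 0 k = 1 -> deg1 (wconj g h).
Proof.
rewrite wact_sum // addrAC subrr add0r => deg1.
change (wdeg (wmul (wconj g h) (winv io)) = 0).
rewrite /wconj !wdegM !(wdegV d_gt1) deg1.
suff -> : wdeg io = 1 by ring.
rewrite /wdeg; have d0 : (0 < d)%N by lia.
rewrite (bigD1 (Ordinal d0)) //= mxE /= big1 // => k /eqP k0; rewrite mxE.
by case: eqP => // kE; case: k0; apply: val_inj.
Qed.

Lemma below_stab z h z' j j' : stab z -> stab z' -> inJ j -> inJ j' ->
  below (wmul (wmul z h) z') j j' <-> below h j j'.
Proof.
move=> [wz hz] [wz' hz'] jJ j'J; split=> H n nj.
  have := H (aff d_gt1 (winv z') n); rewrite !aff_mul affVK hz //; apply.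
  by rewrite -hz' // affVK.
by rewrite !aff_mul hz //; apply: H; rewrite hz'.
Qed.

Definition adm_at h b := (forall i, b 0 i <= wact h b 0 i <= b 0 i + 1) /\
  \sum_i wact h b 0 i - \sum_i b 0 i = 1.

Lemma face_point : face I g (wact g (omega i0)).
Proof. by exists i0. Qed.

(** Inclusions of half-lines ending in J do not change under multiplication by [stab] on either
    side, so they may be tested on the representatives of the double cosets. *)
Lemma dcoset_le_face h h' :
  (forall b, face I g b -> adm_at h b) -> (forall b, face I g b -> adm_at h' b) ->
  dcoset_le (to_base_alcove g) (Wfix (face I g)) (WF g I)
    (wmul h (winv io)) (wmul h' (winv io)) <->
  (forall b b' c, face I g b -> face I g b' -> wle h' b b' c -> wle h b b' c).
Proof.
move=> ah ah'; have wh := deg1_conj (ah _ face_point).2.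
have wh' := deg1_conj (ah' _ face_point).2.
split.
  move=> [y [y' [/dcoset_repP ry /dcoset_repP ry']]].
  rewrite !to_base_alcoveE !base_iotaV in ry ry' * => br b b' c [i iI <-] [i' i'I <-].
  have stabform u v : max_stab_min u v -> exists z z', [/\ stab z, stab z' & v = wmul (wmul z u) z'].
    by move=> [[z [sz [[z' [sz' ->]] _]]] _]; exists z, z'.
  have [z1 [z2 [sz1 sz2 yE]]] := stabform _ _ ry.
  have [z3 [z4 [sz3 sz4 y'E]]] := stabform _ _ ry'.
  have wy : Wa (wmul (base y) (winv io)).
    rewrite yE; apply: deg1Mr => //; first by case: sz2.
    by apply: deg1Ml => //; case: sz1.
  have iJ : inJ (i : nat)%:Z by rewrite /inJ ordz_ord.
  have i'J : inJ ((i' : nat)%:Z + c * d%:Z) by rewrite inJD /inJ ordz_ord.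
  (* [iota^-1] lowers positions by 1, so the source half-line ends at [i + 1] instead of [i]. *)
  have shift u : below (wmul u (winv io)) ((i : nat)%:Z + 1) ((i' : nat)%:Z + c * d%:Z) <->
      below u (i : nat)%:Z ((i' : nat)%:Z + c * d%:Z).
    split=> H n ni.
      have := H (n + 1); rewrite aff_mul aff_iotaV addrK; apply; lia.
    by rewrite aff_mul aff_iotaV; apply: H; lia.
  rewrite !wle_below -(below_stab (wconj g h) sz1 sz2 iJ i'J) -yE.
  rewrite -(below_stab (wconj g h') sz3 sz4 iJ i'J) -y'E -!shift.
  exact: bruhat_maps_below wy br.
move=> hh'.
have [|||||y [y' [ry ry' br]]] := @rep_bruhat d d_gt1 I i0 i0I (wconj g h) (wconj g h').
- exact: wh.
- exact: adds_point_face.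
- exact: wh'.
- exact: adds_point_face.
- move=> j j' /inJP [i [c [iI ->]]] /inJP [i' [c' [i'I ->]]] _.
  have -> : (i' : nat)%:Z + c' * d%:Z = (i' : nat)%:Z + (c' - c) * d%:Z + c * d%:Z by ring.
  rewrite !maps_belowD -!wle_below.
  by apply: hh'; [exists i | exists i'].
exists (wmul (wmul g y) (winv (wmul io g))), (wmul (wmul g y') (winv (wmul io g))).
by split; rewrite ?dcoset_repP ?to_base_alcoveE ?base_surj ?base_iotaV.
Qed.

End Transport.

(** * Fractions, valuations and lattices over a discrete valuation ring *)

Section Fractions.
Variables (R : idomainType) (pi : R).
Local Notation K := {fraction R}.
Local Notation inK := (@FracField.tofrac R).
Local Notation p n := (inK pi ^ n).

Local Open Scope quotient_scope.

Lemma fraction_eq (x : K) : exists a b : R, b != 0 /\ x = inK a / inK b.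
Proof.
elim/quotW: x => x; exists (frac x).1, (frac x).2; split; first exact: denom_ratioP.
have b0 : inK (frac x).2 != 0 by rewrite tofrac_eq0 denom_ratioP.
apply: (mulIf b0); rewrite divfK //.
rewrite /GRing.mul /= !piE /FracField.mulf; apply/eqmodP; rewrite /= FracField.equivfE.
rewrite !numden_Ratio ?oner_eq0 ?mulf_neq0 ?denom_ratioP ?oner_neq0 //.
by rewrite !mulr1 mulrC.
Qed.

Local Close Scope quotient_scope.

Definition integral (x : K) : Prop := exists r, x = inK r.

Lemma integral0 : integral 0. Proof. by exists 0; rewrite tofrac0. Qed.
Lemma integral1 : integral 1. Proof. by exists 1; rewrite tofrac1. Qed.
Lemma integralD x y : integral x -> integral y -> integral (x + y).
Proof. by move=> [r ->] [s ->]; exists (r + s); rewrite tofracD. Qed.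
Lemma integralM x y : integral x -> integral y -> integral (x * y).
Proof. by move=> [r ->] [s ->]; exists (r * s); rewrite tofracM. Qed.
Lemma integral_sum (J : finType) (F : J -> K) :
  (forall j, integral (F j)) -> integral (\sum_j F j).
Proof. by move=> h; apply: big_ind => //; [exact: integral0 | exact: integralD]. Qed.

Hypothesis pi0 : pi != 0.
Hypothesis pi_nonunit : pi \isn't a GRing.unit.

Lemma unif_neq0 : inK pi != 0. Proof. by rewrite tofrac_eq0. Qed.
Lemma unifX_neq0 n : p n != 0. Proof. exact: expfz_neq0 unif_neq0. Qed.
Lemma unifXD n m : p (n + m) = p n * p m. Proof. exact: expfzDr unif_neq0. Qed.

Lemma integral_unifX n : integral (p n) <-> 0 <= n.
Proof.
case: n => n; first by split=> // _; exists (pi ^+ n); rewrite tofracXn.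
split=> // -[r]; rewrite NegzE => E; have : inK (pi ^+ n.+1 * r) = 1.
  by rewrite tofracM tofracXn -E -[_ ^+ _]/(p n.+1) -unifXD subrr.
move=> /eqP; rewrite -tofrac1 tofrac_eq exprS -mulrA => /eqP u.
by case/negP: pi_nonunit; apply/unitrPr; exists (pi ^+ n * r).
Qed.

Lemma lat_mem d (B : 'M[K]_d) x : B \in unitmx ->
  lat B x <-> forall j, integral ((x *m invmx B) 0 j).
Proof.
move=> uB; split=> [[y ->] j|/choice [y yE]].
  by rewrite mulmxK // mxE; exists (y 0 j).
exists (\row_j y j); rewrite (_ : map_mx _ _ = x *m invmx B) ?mulmxKV //.
by apply/rowP => j; rewrite yE [LHS]mxE mxE.
Qed.

Lemma scale_setP d (c : K) (L : set 'rV[K]_d) x : c != 0 ->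
  scale_set c L x <-> L (c^-1 *: x).
Proof.
move=> c0; split=> [[y Ly <-]|h]; first by rewrite scalerA mulVf // scale1r.
by exists (c^-1 *: x) => //; rewrite scalerA divff // scale1r.
Qed.

Lemma scale_subP d (A B : 'M[K]_d) n : A \in unitmx -> B \in unitmx ->
  (forall x, lat A x -> lat B (p n *: x)) <->
  (forall i j, integral (p n * (A *m invmx B) i j)).
Proof.
move=> uA uB; split=> [h i j|h _ [y ->]].
  have /h : lat A (row i A) by exists (delta_mx 0 i); rewrite map_delta_mx -rowE.
  move=> /(lat_mem _ uB)/(_ j); congr integral.
  by rewrite -scalemxAl mxE -row_mul mxE.
apply/lat_mem => // j; rewrite -scalemxAl -mulmxA mxE [_ 0 j]mxE mulr_sumr.
apply: integral_sum => i; rewrite mxE mulrCA; apply: integralM; last exact: h.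
by exists (y 0 i).
Qed.

Lemma latD d (B : 'M[K]_d) x y : lat B x -> lat B y -> lat B (x + y).
Proof. by move=> [a ->] [b ->]; exists (a + b); rewrite map_mxD mulmxDl. Qed.

Lemma latZ d (B : 'M[K]_d) c x : integral c -> lat B x -> lat B (c *: x).
Proof. by move=> [r ->] [a ->]; exists (r *: a); rewrite map_mxZ scalemxAl. Qed.

End Fractions.

Lemma int_least (P : int -> Prop) (lo hi : int) : P hi -> (forall m, P m -> lo <= m) ->
  exists m, P m /\ forall m', P m' -> m <= m'.
Proof.
move=> Phi Plo; pose Q (j : nat) := `[< P (lo + j%:Z) >].
have exQ : exists j, Q j.
  exists `|hi - lo|%N; apply/asboolP.
  by have := Plo _ Phi => lohi; rewrite (_ : lo + _ = hi) //; lia.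
case: (ex_minnP exQ) => j /asboolP Pj minj; exists (lo + j%:Z); split=> // m Pm.
have lom := Plo _ Pm; have := minj `|m - lo|%N.
suff -> : Q `|m - lo|%N by lia.
by apply/asboolP; rewrite (_ : lo + _ = m) //; lia.
Qed.

Section Valuation.
Variables (R : idomainType) (pi : R).
Local Notation K := {fraction R}.
Local Notation inK := (@FracField.tofrac R).
Local Notation p n := (inK pi ^ n).
Hypothesis dvr : is_dvr_uniformizer pi.

Let pi0 : pi != 0. Proof. by case: dvr. Qed.
Let pi_nonunit : pi \isn't a GRing.unit. Proof. by case: dvr. Qed.

Lemma valuation_decomp (x : K) : x != 0 ->
  exists n (u : R), u \is a GRing.unit /\ x = inK u * p n.
Proof.
have [a [b [b0 ->]]] := fraction_eq x; rewrite mulf_eq0 negb_or tofrac_eq0 => /andP[a0 _].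
have [_ _ dec] := dvr.
have [n [u [uu ->]]] := dec _ a0; have [m [v [uv ->]]] := dec _ b0.
exists (n%:Z - m%:Z), (u * v^-1); split; first by rewrite unitrM unitrV uu uv.
have v0 : inK v != 0 by rewrite tofrac_eq0; apply: contraTneq uv => ->; rewrite unitr0.
have -> : inK (u * v^-1) = inK u / inK v.
  by apply: (mulIf v0); rewrite divfK // -tofracM mulrVK.
rewrite unifXD // !tofracM !tofracXn invfM -exprnN -!exprnP.
by rewrite mulrACA.
Qed.

Lemma integral_large (J : finType) (F : J -> K) :
  exists n, forall m j, n <= m -> integral (p m * F j).
Proof.
have bound (x : K) : exists n, forall m, n <= m -> integral (p m * x).
  have [->|/valuation_decomp [n [u [uu ->]]]] := eqVneq x 0.
    by exists 0 => m _; rewrite mulr0; exact: integral0.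
  exists (- n) => m nm; rewrite mulrCA -unifXD //; apply: integralM; first by exists u.
  by apply/integral_unifX => //; lia.
have /choice [N hN] j := bound (F j).
exists (\sum_j `|N j|) => m j le; apply: hN; apply: le_trans le.
rewrite (bigD1 j) //= (le_trans (ler_norm _)) // lerDl.
by apply: sumr_ge0 => i _; exact: normr_ge0.
Qed.

Lemma integral_small (x : K) : x != 0 -> exists n, forall m, integral (p m * x) -> n <= m.
Proof.
move=> /valuation_decomp [n [u [uu ->]]]; exists (- n) => m.
rewrite mulrCA -unifXD // => h.
suff : integral (p (m + n)) by move/integral_unifX; lia.
have [r rE] := h; exists (u^-1 * r); rewrite tofracM -rE mulrA -tofracM.
by rewrite mulVr // tofrac1 mul1r.
Qed.

End Valuation.

(** * Convex families of lattices, from abstract properties of scaling and reduction *)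

Section LatticeConfiguration.
Variables (V : finType) (X : Type) (E : zmodType) (sc : int -> X -> X).
Variables (L : V -> X -> Prop) (n : V -> V -> int) (rd : V -> X -> E) (f : V -> V -> E -> E).
Hypothesis scD : forall a b x, sc a (sc b x) = sc (a + b) x.
Hypothesis sc0 : forall x, sc 0 x = x.
Hypothesis scL : forall a v x, 0 <= a -> L v x -> L v (sc a x).
Hypothesis nP : forall u v m, (forall x, L u x -> L v (sc m x)) <-> n u v <= m.
Hypothesis n_refl : forall u, n u u = 0.
Hypothesis L_inj : forall u v a, (forall x, L v x <-> L u (sc a x)) -> u = v.
Hypothesis rd_lift : forall v c, exists x, L v x /\ rd v x = c.
Hypothesis rd_eq0 : forall v x, L v x -> rd v x = 0 <-> L v (sc (-1) x).
Hypothesis f_rd : forall u v x, L u x -> f u v (rd u x) = rd v (sc (n u v) x).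
Hypothesis meet : forall u v m, exists w s, forall x,
  (L u x /\ L v (sc (- m) x)) <-> L w (sc (- s) x).

Lemma lat_sub u v x : L u x -> L v (sc (n u v) x).
Proof. by move: x; apply/nP. Qed.

Lemma dist_tri u v w : n u w <= n u v + n v w.
Proof. by apply/nP => x Lx; rewrite addrC -scD; apply/lat_sub/lat_sub. Qed.

Lemma dist_pos u v : u != v -> 0 < n u v + n v u.
Proof.
move=> uv; rewrite ltNge; apply/negP => le0; case/eqP: uv.
apply: (@L_inj _ _ (- n u v)) => x; split=> [Lx|Lx].
  rewrite (_ : - n u v = - (n u v + n v u) + n v u); last by lia.
  by rewrite -scD; apply: scL; [lia | exact: lat_sub].
by rewrite -[x]sc0 -[0](subrr (n u v)) -scD; exact: lat_sub.
Qed.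

Lemma lat_map_refl u x : f u u x = x.
Proof. by have [y [Ly <-]] := rd_lift u x; rewrite f_rd // n_refl sc0. Qed.

(** The composite is multiplication by [pi^(n u v + n v w)]. Any excess of this exponent over
    [n u w] is a factor [pi], which kills the reduction. *)
Lemma lat_map_comp u v w x : f v w (f u v x) = if n u w == n u v + n v w then f u w x else 0.
Proof.
have [y [Ly <-]] := rd_lift u x; have Lvy := lat_sub v Ly.
rewrite !f_rd // scD addrC; case: ifP => [/eqP <-//|/eqP ne].
have h m : n u w <= m -> L w (sc m y) by move=> /nP; apply.
have tri := dist_tri u v w; apply/rd_eq0; first exact: h.
by rewrite scD; apply: h; lia.
Qed.

(** If [pi^(n v u) y] lies in [pi L_u], then [pi^(n v u - 1) y] lies in [L_u], and multiplication by
    [pi^(n u v)] returns [y] because the exponents cancel. *)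
Lemma lat_map_exact u v x : n u v + n v u = 1 -> f v u x = 0 -> exists y, x = f u v y.
Proof.
move=> E1; have [y [Ly <-]] := rd_lift v x; rewrite f_rd // => /(rd_eq0 (lat_sub _ Ly)).
rewrite scD => Lz; exists (rd u (sc (-1 + n v u) y)); rewrite f_rd // scD.
by rewrite (_ : _ + _ = 0) ?sc0 //; lia.
Qed.

Lemma lat_map_neq0 u v : exists x, f u v x != 0.
Proof.
apply: contrapT => H; have trans0 x : f u v x = 0.
  by apply/eqP/negPn/negP => fx; apply: H; exists x.
suff : n u v <= n u v - 1 by lia.
apply/nP => x Lx; have := trans0 (rd u x); rewrite f_rd //.
by move=> /(rd_eq0 (lat_sub _ Lx)); rewrite scD addrC.
Qed.

Lemma adjacent_dist u v s t : u != v ->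
  (forall x, L u (sc (- (s + 1)) x) -> L v (sc (- t) x)) ->
  (forall x, L v (sc (- t) x) -> L u (sc (- s) x)) -> n u v + n v u = 1.
Proof.
move=> uv h1 h2.
have : n u v <= s + 1 - t.
  apply/nP => x Lx; have := h1 (sc (s + 1) x).
  by rewrite !scD addNr sc0 addrC; apply.
have : n v u <= t - s.
  apply/nP => x Lx; have := h2 (sc t x).
  by rewrite !scD addNr sc0 addrC; apply.
by have := dist_pos uv; lia.
Qed.

(* w is the class of the largest lattice pi^(-m) L_v meet L_u different from L_u. *)
Lemma convex_neighbour u v : u != v ->
  exists w, [/\ w != u, n u w + n w u = 1 & n v u = n v w + n w u].
Proof.
(* The exponent [1 - n u v] is the smallest [m] for which [pi^m L_v] does not contain [L_u]. *)
move=> uv; have [w [s hX]] := meet u v (1 - n u v).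
have pos := dist_pos uv.
have h1 : n w u <= s.
  apply/nP => x Lx; have [] := (hX (sc s x)).2 => //.
  by rewrite scD addNr sc0.
have h2 : n u w <= 1 - s.
  apply/nP => x Lx; rewrite addrC -scD; apply/hX; split.
    exact: scL.
  by rewrite scD; move: x Lx; apply/nP; lia.
have h3 : n v w <= n v u - s.
  apply/nP => x Lx; rewrite addrC -scD; apply/hX; split; first exact: lat_sub.
  rewrite scD; apply: scL => //; lia.
have wu : w != u.
  apply/eqP => wu; move: h1 h2 h3; rewrite wu n_refl => h1 h2 h3.
  have s0 : s = 0 by lia.
  suff : n u v <= n u v - 1 by lia.
  apply/nP => x Lx; have Lw : L w (sc (- s) x) by rewrite s0 oppr0 sc0 wu.
  by have [_] := (hX x).2 Lw; rewrite opprB.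
exists w; split=> //; have := dist_pos wu; have := dist_tri v w u; lia.
Qed.

(** The meet is [pi^s L_u] with [s >= 1]. Hence if [y] is in [L_v] and [pi^(j + 1 + m) y] is in
    [L_u], the latter is already in [pi L_u], and one factor [pi] cancels; descend to [j = 0]. *)
Lemma meet_left u v m s : (forall x, (L u x /\ L v (sc (- m) x)) <-> L u (sc (- s) x)) ->
  - n u v < m -> n v u <= m.
Proof.
move=> hX lt_m; have s1 : 1 <= s.
  suff : n u v <= s - m by lia.
  apply/nP => x Lx; have [] := (hX (sc s x)).2.
    by rewrite scD addNr sc0.
  by rewrite scD [- m + s]addrC.
have step (j : nat) y : L v y -> L u (sc (j%:Z + m) y) -> L u (sc m y).
  elim: j => [|j IH] Ly; first by rewrite add0r.
  move=> h; apply: IH => //.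
  have /hX : L u (sc (j.+1%:Z + m) y) /\ L v (sc (- m) (sc (j.+1%:Z + m) y)).
    split=> //; rewrite scD; apply: scL => //; lia.
  rewrite scD => h'.
  rewrite (_ : j%:Z + m = (s - 1) + (- s + (j.+1%:Z + m))); last by lia.
  by rewrite -scD; apply: scL => //; lia.
apply/nP => y Ly; apply: (step `|n v u - m|%N) => //.
move: y Ly; apply/nP; lia.
Qed.

(* Otherwise some class [L_u] meet pi^m [L_v] differs from both vertices, and the
   generator at this class lifts to an element of pi L_w. *)
Lemma delta_adjacent (eps : V -> E) u v : (forall w, eps w != 0) -> u != v ->
  (forall w, w != u -> f w u (eps w) = 0) -> (forall w, w != v -> f w v (eps w) = 0) ->
  n u v + n v u = 1.
Proof.
move=> eps0 uv hu hv; have pos := dist_pos uv.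
apply/eqP; rewrite eq_le; apply/andP; split; last by lia.
rewrite leNgt; apply/negP => gt1.
(* For this [m], and distance at least 2, neither of [L_u] and [pi^m L_v] contains the other. *)
have [m mE] : exists m, m = n v u - 1 by exists (n v u - 1).
have lt_m : - n u v < m by lia.
have [w [s hX]] := meet u v m.
have [wu|wu] := eqVneq w u.
  by rewrite wu in hX; have := meet_left hX lt_m; lia.
have [wv|wv] := eqVneq w v.
  rewrite wv in hX; have := @meet_left v u (- m) (s - m).
  suff H : forall x, (L v x /\ L u (sc (- - m) x)) <-> L v (sc (- (s - m)) x).
    move=> /(_ H) H'; have : n u v <= - m by apply: H'; lia.
    by lia.
  move=> x; have := hX (sc m x); rewrite opprK !scD addNr sc0.
  by rewrite opprB [- s + m]addrC => <-; split=> -[].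
have [x [Lx xE]] := rd_lift w (eps w).
(* As [f_(w,z)] kills the class of [x], one factor [pi] less suffices to bring [x] into [L_z]. *)
have key z q : w != z -> f w z (eps w) = 0 -> n w z <= q -> L z (sc (q - 1) x).
  move=> wz; rewrite -xE f_rd // => /(rd_eq0 (lat_sub _ Lx)) Lz le.
  rewrite (_ : q - 1 = (q - n w z) + (-1 + n w z)); last by lia.
  rewrite -scD; apply: scL; first by lia.
  by move: Lz; rewrite scD.
have n1 : n w u <= s.
  apply/nP => y Ly; have [] := (hX (sc s y)).2 => //.
  by rewrite scD addNr sc0.
have n2 : n w v <= s - m.
  apply/nP => y Ly; have [] := (hX (sc s y)).2.
    by rewrite scD addNr sc0.
  by rewrite scD addrC.
have /hX : L u (sc (s - 1) x) /\ L v (sc (- m) (sc (s - 1) x)).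
  split; first exact: key wu (hu _ wu) n1.
  rewrite scD (_ : - m + (s - 1) = s - m - 1); last by lia.
  exact: key wv (hv _ wv) n2.
rewrite scD (_ : - s + (s - 1) = -1); last by lia.
by move=> /(rd_eq0 Lx); rewrite xE => /eqP; rewrite (negbTE (eps0 w)).
Qed.

End LatticeConfiguration.

(** * The multiplication maps of a convex lattice configuration *)

Section Configuration.
Variables (R : idomainType) (pi : R) (k : fieldType) (red : {rmorphism R -> k}).
Variables (d : nat) (V : finType) (B : V -> 'M[{fraction R}]_d).
Local Notation K := {fraction R}.
Local Notation inK := (@FracField.tofrac R).
Local Notation p n := (inK pi ^ n).
Local Notation L v := (lat (B v)).
Local Notation n := (nmin pi B).
Local Notation f := (fmap pi red B).
Hypothesis dvr : is_dvr_uniformizer pi.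
Hypothesis resid : is_residue_map pi red.
Hypothesis d_gt0 : (0 < d)%N.
Hypothesis cvx : convex_config B.

Let pi0 : pi != 0. Proof. by case: dvr. Qed.
Let pi_nonunit : pi \isn't a GRing.unit. Proof. by case: dvr. Qed.
Let uB v : B v \in unitmx. Proof. by case: cvx. Qed.

(** The minimum defining [nmin] exists: the entries of the transition matrix become integral after a
    large power of [pi], and a nonzero entry bounds the exponents from below. *)
Lemma nminP u v m : (forall x, L u x -> L v (p m *: x)) <-> n u v <= m.
Proof.
have setE q : scale_set (p q) (L u) `<=` L v <-> forall x, L u x -> L v (p q *: x).
  by split=> [h x Lx|h _ [x Lx <-]]; [apply: h; exists x | exact: h].
suff [h1 h2] : (forall x, L u x -> L v (p (n u v) *: x)) /\
    forall q, (forall x, L u x -> L v (p q *: x)) -> n u v <= q.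
  split=> [/h2//|le x Lx]; have -> : m = (m - n u v) + n u v by lia.
  rewrite unifXD // -scalerA; apply: latZ; last exact: h1.
  by apply/integral_unifX => //; lia.
pose P q := scale_set (p q) (L u) `<=` L v.
have PE q : P q <-> forall i j, integral (p q * (B u *m invmx (B v)) i j).
  by rewrite /P setE; exact: scale_subP.
have [hi Phi] : exists q, P q.
  have [N hN] := integral_large dvr (fun ij : 'I_d * 'I_d => (B u *m invmx (B v)) ij.1 ij.2).
  by exists N; apply/PE => i j; have := hN N (i, j) (lexx _).
have [lo Plo] : exists lo, forall q, P q -> lo <= q.
  have [i [j ij]] : exists i j, (B u *m invmx (B v)) i j != 0.
    apply: contrapT => H; have : B u *m invmx (B v) = 0.
      apply/matrixP => i j; rewrite [RHS]mxE; apply/eqP/negPn/negP => ij.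
      by apply: H; exists i, j.
    move=> /(congr1 (fun A => A *m B v)); rewrite mulmxKV // mul0mx => B0.
    have := uB u; rewrite B0 unitmxE => /unitrP [x [_]].
    rewrite -[\det 0]/(\det (0 : 'M_d)) -(@scale0r K _ 1%:M) detZ expr0n.
    by rewrite gtn_eqF //= mul0r mul0r => /eqP; rewrite eq_sym oner_eq0.
  have [N hN] := integral_small dvr ij; exists N => q /PE/(_ i j); exact: hN.
have [m' [Pm' minm']] := int_least Phi Plo.
have [h1 h2] : [set q : int | P q /\ forall q', P q' -> q <= q'] (n u v).
  by apply: (@xgetPex _ 0); exists m'.
by split; [exact/setE | move=> q /setE; exact: h2].
Qed.

Lemma nmin_sub u v x : L u x -> L v (p (n u v) *: x).
Proof. by move: x; apply/nminP. Qed.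

Lemma nmin_refl u : n u u = 0.
Proof.
apply/eqP; rewrite eq_le; apply/andP; split.
  by apply/nminP => x; rewrite expr0z scale1r.
have H : forall x, L u x -> L u (p (n u u) *: x) by move=> x; exact: nmin_sub.
have := (scale_subP pi (n u u) (uB u) (uB u)).1 H (Ordinal d_gt0) (Ordinal d_gt0).
by rewrite mulmxV // mxE eqxx mulr1 => /(integral_unifX pi0 pi_nonunit).
Qed.

Lemma unif_scaleD a b (x : 'rV[K]_d) : p a *: (p b *: x) = p (a + b) *: x.
Proof. by rewrite scalerA -unifXD. Qed.

Lemma unif_scale0 (x : 'rV[K]_d) : p 0 *: x = x.
Proof. by rewrite expr0z scale1r. Qed.

Lemma lat_unif a v x : 0 <= a -> L v x -> L v (p a *: x).
Proof. by move=> a0; apply: latZ; apply/integral_unifX. Qed.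

Lemma fmap_red u v x : L u x ->
  f u v (reduction red (B u) x) = reduction red (B v) (p (n u v) *: x).
Proof. by move=> Lx; apply: fmap_reduction => // _ [y Ly <-]; exact: nmin_sub. Qed.

Lemma red_lift v (c : 'rV[k]_d) : exists x, L v x /\ reduction red (B v) x = c.
Proof. by have [x Lx xc] := reduction_surj c resid (uB v); exists x. Qed.

Lemma red_eq0 v x : L v x -> reduction red (B v) x = 0 <-> L v (p (-1) *: x).
Proof.
by move=> Lx; rewrite (reduction_eq0 resid (uB v) Lx) scale_setP ?unif_neq0.
Qed.

(* A lattice is stable under units, so that only the valuation of the homothety
   factor matters. *)
Lemma homotheticP v X : homothetic (L v) X -> exists s, forall x, X x <-> L v (p (- s) *: x).
Proof.
move=> [c [c0 ->]]; have [s [e [ue cE]]] := valuation_decomp dvr c0; exists s => x.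
have e0 : inK e != 0 by rewrite tofrac_eq0; apply: contraTneq ue => ->; rewrite unitr0.
rewrite scale_setP // cE invfM -scalerA invr_expz.
split=> [h|h].
  have := latZ (c := inK e) (ex_intro _ e erefl) h.
  by rewrite [inK e *: _]scalerA divff // scale1r.
by apply: latZ => //; exists (e^-1); apply: (mulfI e0); rewrite divff // -tofracM mulrV ?tofrac1.
Qed.

Lemma homothetic_shift v s : homothetic (L v) (scale_set (p s) (L v)).
Proof. by exists (p s); split=> //; exact: unifX_neq0. Qed.

Lemma scale_unifP v s x : scale_set (p s) (L v) x <-> L v (p (- s) *: x).
Proof. by rewrite scale_setP ?unifX_neq0 // invr_expz. Qed.

Lemma convex_meet u v m : exists w s, forall x,
  (L u x /\ L v (p (- m) *: x)) <-> L w (p (- s) *: x).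
Proof.
have [_ _ _ meet] := cvx.
have [w hw] := meet u v _ _ (homothetic_shift u 0) (homothetic_shift v m).
have [s hs] := homotheticP hw; exists w, s => x.
by rewrite -hs /setI /= !scale_unifP oppr0 expr0z scale1r.
Qed.

Lemma lat_homothetic_eq u v a : (forall x, L v x <-> L u (p a *: x)) -> u = v.
Proof.
move=> h; have [_ _ inj _] := cvx; apply: inj; exists (p (- a)).
split; first exact: unifX_neq0.
by apply/seteqP; split=> x; [move=> /h | move=> H; apply/h; move: H]; rewrite scale_unifP opprK.
Qed.

Let fK u v x := f u v x.
Let scK a (x : 'rV[K]_d) : 'rV[K]_d := p a *: x.
Let LK v : 'rV[K]_d -> Prop := L v.
Let rdK v : 'rV[K]_d -> 'rV[k]_d := reduction red (B v).

Lemma nmin_tri u v w : n u w <= n u v + n v w.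
Proof. exact: (dist_tri (sc := scK) (L := LK) unif_scaleD nminP). Qed.

Lemma nmin_pos u v : u != v -> 0 < n u v + n v u.
Proof. exact: (dist_pos (sc := scK) (L := LK) unif_scaleD unif_scale0 lat_unif nminP lat_homothetic_eq). Qed.

Lemma fmap_refl u x : f u u x = x.
Proof.
exact: (lat_map_refl (sc := scK) (L := LK) (rd := rdK) (f := fK) unif_scale0 nmin_refl red_lift fmap_red).
Qed.

Lemma fmap_comp u v w x :
  f v w (f u v x) = if n u w == n u v + n v w then f u w x else 0.
Proof.
exact: (lat_map_comp (sc := scK) (L := LK) (rd := rdK) (f := fK) unif_scaleD nminP red_lift red_eq0 fmap_red).
Qed.

Lemma fmap_exact u v x : n u v + n v u = 1 -> f v u x = 0 -> exists y, x = f u v y.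
Proof.
exact: (lat_map_exact (sc := scK) (L := LK) (rd := rdK) (f := fK) unif_scaleD unif_scale0 nminP red_lift red_eq0 fmap_red).
Qed.

Lemma fmap_neq0 u v : exists x, f u v x != 0.
Proof.
exact: (lat_map_neq0 (sc := scK) (L := LK) (rd := rdK) (f := fK) unif_scaleD nminP red_eq0 fmap_red).
Qed.

Lemma nmin_neighbour u v : u != v ->
  exists w, [/\ w != u, n u w + n w u = 1 & n v u = n v w + n w u].
Proof.
exact: (convex_neighbour (sc := scK) (L := LK) unif_scaleD unif_scale0 lat_unif nminP nmin_refl
          lat_homothetic_eq convex_meet).
Qed.

Lemma nmin_delta (eps : V -> 'rV[k]_d) u v : (forall w, eps w != 0) -> u != v ->
  (forall w, w != u -> f w u (eps w) = 0) -> (forall w, w != v -> f w v (eps w) = 0) ->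
  n u v + n v u = 1.
Proof.
exact: (delta_adjacent (sc := scK) (L := LK) (rd := rdK) (f := fK) unif_scaleD unif_scale0 lat_unif nminP
          lat_homothetic_eq red_lift red_eq0 fmap_red convex_meet).
Qed.

Lemma adjacentP u v : adjacent pi B u v <-> u != v /\ n u v + n v u = 1.
Proof.
split=> [[/eqP uv [L1 [L2 [h1 h2 h3 h4]]]]|[uv E]].
  split=> //; have [s hs] := homotheticP h1; have [t ht] := homotheticP h2.
  apply: (adjacent_dist (sc := scK) (L := LK) unif_scaleD unif_scale0 lat_unif nminP lat_homothetic_eq
            (s := s) (t := t) uv) => x.
    move=> h; apply/ht/h3; exists (p (-1) *: x); last first.
      by rewrite -[X in X *: _]expr1z unif_scaleD subrr unif_scale0.
    by apply/hs; rewrite unif_scaleD -opprD.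
  by move=> /ht/h4/hs.
split; first exact/eqP.
exists (scale_set (p 0) (L u)), (scale_set (p (n v u)) (L v)).
split; [exact: homothetic_shift | exact: homothetic_shift | |].
- move=> _ [x /scale_unifP + <-]; rewrite oppr0 unif_scale0 => Lx; apply/scale_unifP.
  rewrite -[X in _ *: (X *: _)]expr1z unif_scaleD.
  by move: x Lx; apply/nminP; lia.
- by move=> _ [x Lx <-]; apply/scale_unifP; rewrite oppr0 unif_scale0; exact: nmin_sub.
Qed.

End Configuration.

(** * Sub-representations of dimension 1 and their maximal vertices *)

Section QuiverRepresentations.
Variables (k : fieldType) (E : lmodType k) (V : finType).
Variables (n : V -> V -> int) (f : V -> V -> E -> E).
Hypothesis n_refl : forall u, n u u = 0.
Hypothesis n_tri : forall u v w, n u w <= n u v + n v w.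
Hypothesis n_pos : forall u v, u != v -> 0 < n u v + n v u.
Hypothesis f_lin : forall u v a x y, f u v (a *: x + y) = a *: f u v x + f u v y.
Hypothesis f_refl : forall u x, f u u x = x.
Hypothesis f_comp : forall u v w x,
  f v w (f u v x) = if n u w == n u v + n v w then f u w x else 0.
Hypothesis f_exact : forall u v x, n u v + n v u = 1 -> f v u x = 0 -> exists y, x = f u v y.
Implicit Types (eps : V -> E) (u v w : V) (A D : {set V}).

Lemma trans0 u v : f u v 0 = 0.
Proof.
have := f_lin u v 1 0 0; rewrite !scale1r addr0 => E1.
by apply: (addrI (f u v 0)); rewrite addr0 -E1.
Qed.

Lemma transZ u v a x : f u v (a *: x) = a *: f u v x.
Proof. by have := f_lin u v a x 0; rewrite !addr0 trans0 addr0. Qed.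

Lemma transD u v x y : f u v (x + y) = f u v x + f u v y.
Proof. by have := f_lin u v 1 x y; rewrite !scale1r. Qed.

Lemma f_additive u v w x : n u w = n u v + n v w -> f v w (f u v x) = f u w x.
Proof. by move=> E1; rewrite f_comp E1 eqxx. Qed.

(* A sub-representation of dimension 1 is encoded by generators of its lines. *)
Definition subrep eps := (forall v, eps v != 0) /\
  forall u v, exists c, f u v (eps u) = c *: eps v.

Definition rel eps u v := f u v (eps u) != 0.

Definition delta eps := [set u | [forall (w | w != u), ~~ rel eps w u]]%SET.

Lemma deltaP eps u : reflect (forall w, w != u -> f w u (eps w) = 0) (u \in delta eps).
Proof.
rewrite finset.inE; apply: (iffP forall_inP) => H w wu; first by have /negPn/eqP := H w wu.
by rewrite /rel H // eqxx.
Qed.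

Section SubrepOrder.
Variable eps : V -> E.
Hypothesis sub : subrep eps.

Lemma rel_refl u : rel eps u u.
Proof. by rewrite /rel f_refl; case: sub. Qed.

Lemma rel_trans u v w : rel eps u v -> rel eps v w -> rel eps u w /\ n u w = n u v + n v w.
Proof.
rewrite /rel => uv vw; have [_ /(_ u v) [c cE]] := sub.
have c0 : c != 0 by apply: contraNneq uv => c0; rewrite cE c0 scale0r.
have : f v w (f u v (eps u)) != 0 by rewrite cE transZ scaler_eq0 negb_or c0.
by rewrite f_comp; case: ifP => [/eqP//|_]; rewrite eqxx.
Qed.

Lemma rel_anti u v : rel eps u v -> rel eps v u -> u = v.
Proof.
move=> uv vu; have [_] := rel_trans uv vu; rewrite n_refl => E1.
by apply/eqP/negPn/negP => /n_pos; rewrite -E1 ltxx.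
Qed.

(** Among the vertices of [A] below [v], one with the fewest predecessors in [A] has none but
    itself. *)
Lemma rel_minimal A v : v \in A -> exists u,
  [/\ u \in A, rel eps u v & forall w, w \in A -> w != u -> f w u (eps w) = 0].
Proof.
move=> vA; pose P u := (u \in A) && rel eps u v.
have Pv : P v by rewrite /P vA rel_refl.
pose m u := #|[set w in A | rel eps w u]%SET|.
case: (arg_minnP m Pv) => u /andP[uA uv] minu; exists u; split=> // w wA wu.
apply/eqP/negPn/negP => h; have wv := (rel_trans h uv).1.
have Pw : P w by rewrite /P wA wv.
have := minu w Pw; rewrite leqNgt => /negP; apply; apply: proper_card.
apply/properP; split.
  apply/fintype.subsetP => x; rewrite !finset.inE => /andP[-> xw] /=.
  exact: (rel_trans xw h).1.
exists u; rewrite !finset.inE uA ?rel_refl //=.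
by apply: contra wu => /(rel_anti h) ->.
Qed.

Lemma delta_below v : exists u, u \in delta eps /\ rel eps u v.
Proof.
have [u [_ uv umin]] := rel_minimal (finset.in_setT v).
by exists u; split=> //; apply/deltaP => w; exact: umin.
Qed.

End SubrepOrder.

(* When the lattices L_u, u in D, generate a chain, the largest member of this
   chain inside L_w is homothetic to L_u iff [retr D u w]. *)
Definition chain D := forall u v, u \in D -> v \in D -> u != v -> n u v + n v u = 1.
Definition retr D u w := (u \in D) && [forall (x | x \in D), n x w == n x u + n u w].

Lemma retrP D u w :
  reflect (u \in D /\ forall x, x \in D -> n x w = n x u + n u w) (retr D u w).
Proof.
by apply: (iffP andP) => -[uD h]; split=> //; [move=> x /(forall_inP h)/eqP | apply/forall_inP => x /h ->].
Qed.

Lemma retr_unique D u u' w : retr D u w -> retr D u' w -> u = u'.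
Proof.
move=> /retrP[uD h] /retrP[u'D h']; apply/eqP/negPn/negP => /n_pos.
have := h _ u'D; have := h' _ uD; lia.
Qed.

Lemma retr_id D u : u \in D -> retr D u u.
Proof. by move=> uD; apply/retrP; split=> // x _; rewrite n_refl addr0. Qed.

Lemma retr_sub D D' u u' w : D' \subset D -> retr D u w -> retr D' u' u -> retr D' u' w.
Proof.
move=> sD /retrP[uD h] /retrP[u'D h']; apply/retrP; split=> // x xD'.
have := h x (fintype.subsetP sD _ xD'); have := h u' (fintype.subsetP sD _ u'D).
have := h' x xD'; lia.
Qed.

(** The defects of the two triangle inequalities are nonnegative and add up to [n x y + n y x = 1],
    so one of them is 0. *)
Lemma chain_total D x y w : chain D -> x \in D -> y \in D ->
  n x w = n x y + n y w \/ n y w = n y x + n x w.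
Proof.
move=> ch xD yD; have [->|xy] := eqVneq x y; first by left; rewrite n_refl add0r.
have := ch x y xD yD xy; have := n_tri x y w; have := n_tri y x w.
by case: (lerP (n y x) (n y w - n x w)) => h *; [right|left]; lia.
Qed.

(** Choose [u] with the largest number of [x] in [D] whose exponent to [w] is additive through [u].
    An [x] not counted would, by [chain_total], have a larger count itself. *)
Lemma retr_exists D u0 w : chain D -> u0 \in D -> exists u, retr D u w.
Proof.
move=> ch u0D; pose m u := #|[set x in D | n x w == n x u + n u w]%SET|.
case: (arg_maxnP m u0D) => u uD maxu; exists u; apply/retrP; split=> // x xD.
case: (chain_total w ch xD uD) => // h.
apply/eqP/negPn/negP => nh; have : (m x <= m u)%N by exact: maxu.
rewrite leqNgt => /negP; apply.
apply: proper_card; apply/properP; split.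
  apply/fintype.subsetP => y; rewrite !finset.inE => /andP[-> /eqP yu] /=.
  by apply/eqP; have := n_tri y u x; have := n_tri y x w; lia.
by exists x; rewrite !finset.inE xD /= ?n_refl ?add0r ?eqxx.
Qed.

(** The relation [rel] as recovered from the maximal vertices alone; see [rel_linked]. *)
Definition linked D v w := [exists u, [&& retr D u v, retr D u w & n u w == n u v + n v w]].

Section Structure.
Variable eps : V -> E.
Hypothesis sub : subrep eps.
Hypothesis ch : chain (delta eps).
Local Notation D := (delta eps).

(** If the exponent were additive through another maximal [x], the map from [u] to [w] would factor
    through [f_(u,x)], which kills the generator at [u]. *)
Lemma rel_retr u w : u \in D -> rel eps u w -> retr D u w.
Proof.
move=> uD uw; apply/retrP; split=> // x xD.
have [->|xu] := eqVneq x u; first by rewrite n_refl add0r.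
case: (chain_total w ch xD uD) => // h.
move: uw; rewrite /rel -(f_additive _ h) (_ : f u x _ = 0) ?trans0 ?eqxx //.
by move/deltaP: xD; apply; rewrite eq_sym.
Qed.

Lemma retr_rel u w : retr D u w -> rel eps u w.
Proof.
move=> ruw; have [u' [u'D u'w]] := delta_below sub w.
by rewrite (retr_unique ruw (rel_retr u'D u'w)).
Qed.

Lemma retr_delta w : exists u, retr D u w.
Proof. by have [u [uD uw]] := delta_below sub w; exists u; apply: rel_retr. Qed.

Lemma rel_linked v w : rel eps v w = linked D v w.
Proof.
apply/idP/existsP => [vw|[u /and3P[uv uw /eqP E1]]].
  have [u [uD uv]] := delta_below sub v; have [uw E1] := rel_trans sub uv vw.
  by exists u; rewrite !rel_retr // E1 eqxx.
have := retr_rel uw; rewrite /rel -(f_additive _ E1).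
by have [_ /(_ u v) [c ->]] := sub; rewrite transZ scaler_eq0 negb_or => /andP[].
Qed.

End Structure.

(** Replacing [u] by its own retraction onto [D'] keeps both retractions and the additivity. *)
Lemma linked_sub D D' v w : D' \subset D -> (forall u, exists u', retr D' u' u) ->
  linked D v w -> linked D' v w.
Proof.
move=> sD ex /existsP[u /and3P[uv uw /eqP E1]]; have [u' u'u] := ex u.
apply/existsP; exists u'; rewrite !(retr_sub sD _ u'u) //=.
have /retrP[u'D _] := u'u; move/retrP: uv => [uD h]; move/retrP: uw => [_ h'].
have := h u' (fintype.subsetP sD _ u'D); have := h' u' (fintype.subsetP sD _ u'D).
by move=> -> ->; rewrite E1 addrA.
Qed.

Lemma rel_of_delta eps eps' : subrep eps -> subrep eps' ->
  chain (delta eps) -> chain (delta eps') ->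
  (forall u v, rel eps u v -> rel eps' u v) <-> delta eps' \subset delta eps.
Proof.
move=> s s' c c'; split=> [h|sD u v].
  apply/fintype.subsetP => u /deltaP H; apply/deltaP => w /H E1.
  by apply/eqP/negPn/negP => /h; rewrite /rel E1 eqxx.
rewrite !rel_linked //; apply: linked_sub => //; exact: retr_delta.
Qed.

Definition normal D eps := forall v w, f v w (eps v) = if linked D v w then eps w else 0.

(** Replace each generator by the image of the generator at the maximal vertex from which its line
    comes. *)
Lemma normal_exists eps : subrep eps -> chain (delta eps) ->
  exists c : V -> k, (forall v, c v != 0) /\ normal (delta eps) (fun v => c v *: eps v).
Proof.
move=> s ch; have /choice [r rE] := retr_delta s ch.
have /choice [c cE] v : exists c, f (r v) v (eps (r v)) = c *: eps v by case: s => _; apply.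
have c0 v : c v != 0.
  by apply: contraNneq (retr_rel s ch (rE v)) => c0; rewrite cE c0 scale0r.
exists c; split=> // v w; case: ifP => [/existsP[u /and3P[uv uw /eqP E1]]|/negbT].
  have Ev := retr_unique (rE v) uv; have Ew := retr_unique (rE w) uw.
  by rewrite -!cE Ev Ew f_additive.
by rewrite -rel_linked // negbK transZ => /eqP ->; rewrite scaler0.
Qed.

Lemma linked_retr D u w : retr D u w -> linked D u w.
Proof.
move=> uw; have /andP[uD _] := uw; apply/existsP; exists u.
by rewrite retr_id // uw n_refl add0r eqxx.
Qed.

(* Moving the generator at u = r_{D \ v}(v) towards a preimage of the generator
   at v deletes v from Delta. *)
Lemma delta_curve eps v u0 : subrep eps -> chain (delta eps) ->
  normal (delta eps) eps -> v \in delta eps -> u0 \in delta eps :\ v ->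
  exists eta : V -> E, forall t, t != 0 -> (forall w, eps w + t *: eta w != 0) ->
    subrep (fun w => eps w + t *: eta w) /\
    delta (fun w => eps w + t *: eta w) = delta eps :\ v.
Proof.
move=> s ch nrm vD u0D; set D := delta eps in ch nrm vD u0D *.
have ch1 : chain (D :\ v).
  by move=> x y; rewrite !in_setD1 => /andP[_ xD] /andP[_ yD]; exact: ch.
have [u ruv] := retr_exists v ch1 u0D.
have /retrP[] := ruv; rewrite in_setD1 => /andP[uv uD] hu.
have nuv : n u v + n v u = 1 by exact: ch.
have [|e eE] := f_exact nuv (_ : f v u (eps v) = 0).
  by move/deltaP: uD; apply; rewrite eq_sym.
(* The deformation at [u] is propagated to the vertices that receive their line from [u]; the other
   lines stay fixed. *)
pose eta w := if retr D u w then f u w e else 0.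
exists eta => t t0; pose ep w := eps w + t *: eta w.
rewrite -/ep => ep0.
have epN w : ~~ retr D u w -> ep w = eps w.
  by move=> /negbTE h; rewrite /ep /eta h scaler0 addr0.
have epU w : retr D u w -> ep w = f u w (eps u + t *: e).
  by move=> h; rewrite /ep /eta h transD transZ nrm linked_retr.
have fuv : f u v (eps u + t *: e) = t *: eps v.
  rewrite transD transZ -eE (_ : f u v (eps u) = 0) ?add0r //.
  by move/deltaP: vD; apply.
have fux x : x \in D -> x != u -> x != v -> f u x (eps u + t *: e) = 0.
  move=> xD xu xv; rewrite transD transZ (_ : f u x (eps u) = 0) ?add0r; last first.
    by move/deltaP: xD; apply; rewrite eq_sym.
  (* Since [v] retracts to [u], it lies between [u] and [x] in the chain, and
     [f_(u,x) e = f_(v,x) eps_v = 0]. *)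
  have h : n u x = n u v + n v x.
    have xD1 : x \in D :\ v by rewrite in_setD1 xv.
    have ux : u != x by rewrite eq_sym.
    have vx : v != x by rewrite eq_sym.
    move: (hu x xD1) (ch u x uD xD ux) (ch v x vD xD vx).
    move: (n x v) (n x u) (n u v) (n u x) (n v x); clear; lia.
  rewrite -(f_additive _ h) -eE (_ : f v x _ = 0) ?scaler0 //.
  by move/deltaP: xD; apply; rewrite eq_sym.
have key w : exists c, f u w (eps u + t *: e) = c *: ep w.
  have [x rx] := retr_delta s ch w; have /retrP[xD hx] := rx.
  have [xu|xu] := eqVneq x u; first by exists 1; rewrite scale1r epU // -xu.
  have nru : ~~ retr D u w by apply: contra xu => /(retr_unique rx) ->.
  rewrite (epN _ nru) -(f_additive _ (hx u uD)).
  have [xv|xv] := eqVneq x v; last by exists 0; rewrite fux // trans0 scale0r.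
  by exists t; rewrite xv fuv transZ nrm linked_retr // -xv.
have old w w' : ~~ retr D u w -> f w w' (ep w) = if linked D w w' then ep w' else 0.
  move=> nru; rewrite epN // nrm; case: ifP => // /existsP[x /and3P[xw xw' _]].
  rewrite epN //; apply: contra nru => ruw'.
  by rewrite (retr_unique ruw' xw').
have new w w' : retr D u w ->
    f w w' (ep w) = if n u w' == n u w + n w w' then f u w' (eps u + t *: e) else 0.
  by move=> ru; rewrite epU // f_comp.
split.
  split=> // w w'; case: (boolP (retr D u w)) => ru; last first.
    by rewrite old //; case: ifP => _; [exists 1; rewrite scale1r | exists 0; rewrite scale0r].
  by rewrite new //; case: ifP => _; [exact: key | exists 0; rewrite scale0r].
apply/setP => x; rewrite in_setD1; apply/deltaP/andP => [H|[xv xD] w wx]; last first.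
  case: (boolP (retr D u w)) => ru; last first.
    by rewrite epN //; move/deltaP: xD; apply.
  rewrite new //; case: ifP => // /eqP E1; have [xu|xu] := eqVneq x u; last exact: fux.
  by move: E1 (n_pos wx); rewrite xu n_refl addrC => <-; rewrite ltxx.
have xD : x \in D.
  apply/negPn/negP => nxD; have [y ry] := retr_delta s ch x.
  have yx : y != x by apply: contraNneq nxD => <-; case/retrP: ry.
  have := H y yx; case: (boolP (retr D u y)) => ru.
    have yu : u = y by apply: (retr_unique ru); apply: retr_id; case/retrP: ry.
    rewrite new // yu n_refl add0r eqxx -yu -epU ?yu //.
    by move/eqP; rewrite (negbTE (ep0 x)).
  by rewrite old // linked_retr // => /eqP; rewrite (negbTE (ep0 x)).
split=> //; apply/eqP => xv; have ux : u != x by rewrite xv.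
have := H u ux; rewrite new ?retr_id // n_refl add0r eqxx xv fuv => /eqP.
by rewrite scaler_eq0 (negbTE t0) /=; case: s => /(_ v)/negbTE ->.
Qed.

End QuiverRepresentations.

(** * Polynomial curves in Zariski closed sets *)

Section ZariskiCurves.

(** The polynomial [p + 1] takes only the value 1, so it has no root and is constant. *)
Lemma closed_poly_eq0 (k : closedFieldType) (p : {poly k}) : (forall t, p.[t] = 0) -> p = 0.
Proof.
move=> p0; have : size (p + 1) == 1%N.
  by apply/negPn/closed_rootP => -[t]; rewrite rootE hornerD p0 hornerC add0r oner_eq0.
move=> /size_poly1P [c _ pE]; have {pE} pE : p = (c - 1)%:P.
  by rewrite polyCB -pE; ring.
by have := p0 0; rewrite pE hornerC => ->.
Qed.

Lemma meval_line (k : closedFieldType) N (p : {mpoly k[N]}) (a b : 'I_N -> k) :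
  exists q : {poly k}, forall t, q.[t] = p.@[fun i => a i + t * b i].
Proof.
exists (mmap polyC (fun i => (a i)%:P + 'X * (b i)%:P) p) => t.
rewrite mevalE /mmap horner_sum; apply: eq_bigr => m _.
rewrite hornerCM /mmap1 horner_prod; congr (_ * _); apply: eq_bigr => i _.
by rewrite horner_exp !hornerE.
Qed.

(* Along the curve each equation of Z is a polynomial in t with infinitely many
   zeros. *)
Lemma closed_curve (k : closedFieldType) d (V : finType)
  (Z : set (V -> {vspace 'rV[k]_d})) (U : V -> {vspace 'rV[k]_d}) (c y : V -> 'rV[k]_d) :
  zariski_closed Z -> (forall w, U w = <[c w]>%VS) -> (forall w, c w != 0) ->
  (forall t, t != 0 -> (forall w, c w + t *: y w != 0) ->
    Z (fun w => <[c w + t *: y w]>%VS)) -> Z U.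
Proof.
move=> [P [_ ZE]] UE c0 curve.
have linesU : lines U by move=> v; rewrite UE dim_vline c0.
rewrite ZE; split=> // p Pp eps epsE.
have eps0 w : eps w != 0 by have := linesU w; rewrite epsE dim_vline; case: eqP.
have /choice [a aE] w : exists a, eps w = a *: c w.
  by apply/vlineP; rewrite -UE epsE memv_line.
have a0 w : a w != 0 by apply: contraNneq (eps0 w) => a0; rewrite aE a0 scale0r.
have /choice [j cj] w : exists j, c w 0 j != 0.
  by apply: contrapT => H; case/eqP: (c0 w); apply/rowP => j; rewrite mxE; apply/eqP/negPn/negP => h; apply: H; exists j.
have [q qE] := meval_line p (fun i => eps (enum_val i).1 0 (enum_val i).2)
  (fun i => a (enum_val i).1 * y (enum_val i).1 0 (enum_val i).2).
(* A nonzero value of [b w] at [t] certifies that the vector at [w] is nonzero. *)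
pose b w : {poly k} := (c w 0 (j w))%:P + 'X * (y w 0 (j w))%:P.
have bE w t : (b w).[t] = c w 0 (j w) + t * y w 0 (j w) by rewrite !hornerE.
have b0 w : b w != 0.
  by apply: contraNneq (cj w) => b0; have := bE w 0; rewrite b0 horner0 mul0r addr0 => <-.
(* The factors ['X] and [b w] absorb the parameters at which the curve is not known to lie in
   [Z]. *)
have : q * 'X * \prod_w b w = 0.
  apply: closed_poly_eq0 => t; rewrite !hornerM hornerX horner_prod.
  have [->|t0] := eqVneq t 0; first by rewrite mulr0 mul0r.
  have [bt|/forallPn [w /negPn/eqP bw]] := boolP [forall w, (b w).[t] != 0]; last first.
    by rewrite (bigD1 w) //= bw mul0r mulr0.
  rewrite qE (_ : p.@[_] = 0) ?mul0r //.
  have ct0 w : c w + t *: y w != 0.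
    have := forallP bt w; apply: contra => /eqP E; rewrite bE.
    by have /rowP/(_ (j w)) := E; rewrite !mxE => ->.
  have := curve t t0 ct0; rewrite ZE => -[_ /(_ p Pp)].
  move=> /(_ (fun w => a w *: (c w + t *: y w))) H; rewrite -[RHS]H; last first.
    move=> w; apply/eqP; rewrite eqEsubv -!memvE; apply/andP; split; last first.
      by apply: rpredZ; exact: memv_line.
    by apply/vlineP; exists (a w)^-1; rewrite scalerA mulVf // scale1r.
  apply: meval_eq => i; rewrite !mxE aE mxE; ring.
move/eqP; rewrite !mulf_eq0 polyX_eq0 orbF => /orP[/eqP q0|]; last first.
  by move=> /eqP E0; have /prodf_neq0 : forall w, true -> b w != 0 by []; rewrite E0 eqxx.
have := qE 0; rewrite q0 horner0 => E0; rewrite [RHS]E0.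
by apply: meval_eq => i; rewrite mul0r addr0.
Qed.

End ZariskiCurves.

(** * Strata of the quiver Grassmannian and their closures *)

Section QuiverGrassmannian.
Variables (R : idomainType) (pi : R) (k : closedFieldType) (red : {rmorphism R -> k}).
Variables (d : nat) (V : finType) (B : V -> 'M[{fraction R}]_d).
Hypothesis dvr : is_dvr_uniformizer pi.
Hypothesis resid : is_residue_map pi red.
Hypothesis d_gt0 : (0 < d)%N.
Hypothesis cvx : convex_config B.
Local Notation n := (nmin pi B).
Local Notation f := (fmap pi red B).
Implicit Types (u v w : V) (U : V -> {vspace 'rV[k]_d}) (eps : V -> 'rV[k]_d).

Local Opaque nmin fmap.

Definition fap u v (x : 'rV[k]_d) : 'rV[k]_d := f u v x.

Lemma fap_lin u v a x y : fap u v (a *: x + y) = a *: fap u v x + fap u v y.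
Proof. by rewrite /fap linearP. Qed.

Let n_refl := nmin_refl dvr d_gt0 cvx.
Let n_tri := nmin_tri dvr d_gt0 cvx.
Let n_pos := nmin_pos dvr d_gt0 cvx.
Lemma fap_refl u x : fap u u x = x.
Proof. exact: fmap_refl. Qed.
Lemma fap_comp u v w x :
  fap v w (fap u v x) = if n u w == n u v + n v w then fap u w x else 0.
Proof. exact: fmap_comp. Qed.
Lemma fap_exact u v x : n u v + n v u = 1 -> fap v u x = 0 -> exists y, x = fap u v y.
Proof. exact: fmap_exact. Qed.
Lemma fap_neq0 u v : exists x, fap u v x != 0.
Proof. exact: fmap_neq0. Qed.

Fixpoint path_dist u (p : seq V) : int := if p is w :: p' then n u w + path_dist w p' else 0.

Lemma path_dist_ge u p : n u (last u p) <= path_dist u p.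
Proof.
elim: p u => [|w p IH] u /=; first by rewrite n_refl.
by apply: le_trans (n_tri u w (last w p)) _; rewrite lerD2l.
Qed.

Lemma fpath_eq u p x :
  fpath pi red B u p x = if path_dist u p == n u (last u p) then fap u (last u p) x else 0.
Proof.
elim: p u x => [|w p IH] u x /=; first by rewrite id_lfunE n_refl eqxx fap_refl.
rewrite comp_lfunE IH -/(fap u w x).
have := path_dist_ge w p; have := n_tri u w (last w p); set l := last w p => tri ge.
case: (eqVneq (path_dist w p) (n w l)) => [->|ne].
  by rewrite fap_comp eq_sym.
have -> : (n u w + path_dist w p == n u l) = false by move/eqP: ne => ne; apply/eqP; lia.
by [].
Qed.

(** As [f_(u,v)] is nonzero, a path with this composite has additive exponents, and its first
    intermediate vertex serves as [w]. *)
Lemma not_arrow u v : u != v -> ~ arrow pi red B u v ->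
  exists w, [/\ w != u, w != v & n u v = n u w + n w v].
Proof.
move=> uv /not_andP[//|/contrapT [p [pp lp sp fE]]].
have [x fx] := fap_neq0 u v.
have := fpath_eq u p x; rewrite fE lp -/(fap u v x).
case: eqP => [E|_ E]; last by rewrite E eqxx in fx.
case: p pp lp sp E {fE} => // w [//|w' p] /= /and3P[uw ww' _] lp _ E _.
have g1 := path_dist_ge w' p; have t1 := n_tri w w' (last w' p); rewrite lp in g1 t1.
have t2 := n_tri u w v; exists w; split; first by rewrite eq_sym.
  apply/eqP => wv; have := n_pos ww'; rewrite wv in E ww' t1 *; rewrite n_refl in t1; lia.
lia.
Qed.

(* The induction is on the number of vertices x with n u v = n u x + n x v. *)
Lemma arrow_ind (P : V -> V -> Prop) :
  (forall u, P u u) -> (forall u v, arrow pi red B u v -> P u v) ->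
  (forall u w v, n u v = n u w + n w v -> P u w -> P w v -> P u v) -> forall u v, P u v.
Proof.
move=> Prefl Parr Pcomp.
pose bt u v := [pred x | n u x + n x v == n u v].
have H (m : nat) u v : (#|bt u v| < m)%N -> P u v.
  elim: m u v => // m IH u v lt_m.
  have [->|uv] := eqVneq u v; first exact: Prefl.
  have [/Parr//|/(not_arrow uv) [w [wu wv E]]] := pselect (arrow pi red B u v).
  have pos1 := n_pos wu; have pos2 := n_pos wv.
  apply: (Pcomp u w v E); apply: IH; apply: leq_trans (proper_card _) _; try exact: lt_m.
    apply/properP; split.
      apply/fintype.subsetP => x.
      change (n u x + n x w == n u w -> n u x + n x v == n u v) => /eqP h; apply/eqP.
      by have := n_tri x w v; have := n_tri u x v; move: h E; clear; lia.
    exists v; first by change (n u v + n v v == n u v); rewrite n_refl addr0.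
    change (n u v + n v w != n u w); apply/eqP; move: E pos2; clear; lia.
  apply/properP; split.
    apply/fintype.subsetP => x.
    change (n w x + n x v == n w v -> n u x + n x v == n u v) => /eqP h; apply/eqP.
    by have := n_tri u w x; have := n_tri u x v; move: h E; clear; lia.
  exists u; first by change (n u u + n u v == n u v); rewrite n_refl add0r.
  change (n w u + n u v != n w v); apply/eqP; move: E pos1; clear; lia.
by move=> u v; apply: (H #|bt u v|.+1).
Qed.

Lemma line_gen (W : {vspace 'rV[k]_d}) : \dim W = 1%N -> exists2 e, e != 0 & W = <[e]>%VS.
Proof.
move=> dW; have e0 : vpick W != 0 by rewrite vpick0 -dimv_eq0 dW.
exists (vpick W) => //; apply/esym/eqP; rewrite eqEdim -memvE memv_pick dim_vline e0 dW.
by [].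
Qed.

Definition gens U eps := forall v, U v = <[eps v]>%VS.

Lemma fap_line U eps u v : gens U eps -> (f u v @: U u)%VS = <[fap u v (eps u)]>%VS.
Proof. by move=> /(_ u) ->; rewrite limg_line. Qed.

Lemma Gr_subrep U : Gr pi red B U <-> exists eps, gens U eps /\ subrep fap eps.
Proof.
split=> [[lU aU]|[eps [gU [eps0 sU]]]]; last first.
  split=> [v|u v _]; first by rewrite gU dim_vline eps0.
  rewrite (fap_line _ _ gU) gU -memvE; exact/vlineP.
have /choice [eps epsE] v : exists e, U v = <[e]>%VS /\ e != 0.
  by have [e e0 eE] := line_gen (lU v); exists e.
have gU : gens U eps by move=> v; case: (epsE v).
exists eps; split=> //; split=> [v|u v]; first by case: (epsE v).
move: u v; apply: arrow_ind => [u|u v auv|u w v E [c cE] [c' c'E]].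
- by exists 1; rewrite scale1r fap_refl.
- by apply/vlineP; rewrite memvE -(fap_line _ _ gU) -gU; exact: aU.
exists (c * c'); rewrite -(f_additive fap_comp _ E) cE (transZ fap_lin) c'E scalerA.
by [].
Qed.

Lemma Delta_delta U eps : gens U eps -> forall u, Delta pi red B U u <-> u \in delta fap eps.
Proof.
move=> gU u; split=> [H|/deltaP H v vu].
  apply/deltaP => w wu; have := H w wu; rewrite (fap_line _ _ gU) => /eqP.
  by rewrite -dimv_eq0 dim_vline eqb0 negbK => /eqP.
by rewrite (fap_line _ _ gU) H //; apply/eqP; rewrite -dimv_eq0 dim_vline eqxx.
Qed.

Lemma rankvE U eps u v : gens U eps -> rankv pi red B U u v = rel fap eps u v.
Proof. by move=> gU; rewrite /rankv (fap_line _ _ gU) dim_vline. Qed.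

Lemma rank_leP U U' eps eps' : gens U eps -> gens U' eps' ->
  rank_le pi red B U U' <-> forall u v, rel fap eps u v -> rel fap eps' u v.
Proof.
move=> gU gU'; split=> H u v; have := H u v; rewrite (rankvE _ _ gU) (rankvE _ _ gU').
  by case: (rel fap eps u v); case: (rel fap eps' u v).
by case: (rel fap eps u v) => //; case: (rel fap eps' u v) => // /(_ isT).
Qed.

Lemma delta_chain eps : subrep fap eps -> chain n (delta fap eps).
Proof.
move=> [eps0 _] u v /deltaP hu /deltaP hv uv.
exact: (nmin_delta (eps := eps) dvr resid d_gt0 cvx).
Qed.

Lemma rank_le_Delta U U' : Gr pi red B U -> Gr pi red B U' ->
  rank_le pi red B U U' <-> Delta pi red B U' `<=` Delta pi red B U.
Proof.
move=> /Gr_subrep [eps [gU sU]] /Gr_subrep [eps' [gU' sU']].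
rewrite (rank_leP gU gU').
rewrite (rel_of_delta n_refl n_tri n_pos fap_lin fap_refl fap_comp sU sU'
  (delta_chain sU) (delta_chain sU')).
split=> [sub u|sub].
  rewrite (Delta_delta gU) (Delta_delta gU'); exact: (fintype.subsetP sub).
by apply/fintype.subsetP => u /(Delta_delta gU')/sub/(Delta_delta gU).
Qed.

Lemma isorep_rank U U' : Gr pi red B U -> Gr pi red B U' -> isorep pi red B U U' ->
  rank_le pi red B U U' /\ rank_le pi red B U' U.
Proof.
move=> /Gr_subrep [eps [gU sU]] /Gr_subrep [eps' [gU' sU']] [g [gE gA]].
have gall u v x : x \in U u -> g v (fap u v x) = fap u v (g u x).
  move: x; move: u v; apply: arrow_ind => [u x|u v auv x|u w v E H1 H2 x xU].
  - by rewrite !fap_refl.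
  - exact: gA.
  rewrite -!(f_additive fap_comp _ E) -H1 // H2 //.
  move: xU; rewrite gU => /vlineP [c ->]; rewrite (transZ fap_lin).
  by have [_ /(_ u w) [c' ->]] := sU; rewrite gU !rpredZ // memv_line.
have gline u : exists c, c != 0 /\ g u (eps u) = c *: eps' u.
  have [gU1 inj] := gE u; have : g u (eps u) \in U' u.
    by rewrite -gU1; apply: memv_img; rewrite gU memv_line.
  rewrite gU' => /vlineP [c cE]; exists c; split=> //.
  apply: contraTneq (proj1 sU u) => c0; rewrite negbK; apply/eqP/inj.
  - by rewrite gU memv_line.
  - by rewrite mem0v.
  by rewrite cE c0 scale0r linear0.
suff H u v : rel fap eps u v = rel fap eps' u v.
  by split; apply/(rank_leP gU gU') || apply/(rank_leP gU' gU); move=> u v; rewrite H.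
have [c [c0 cE]] := gline u.
have epsU : eps u \in U u by rewrite gU memv_line.
have fU : fap u v (eps u) \in U v.
  by have [_ /(_ u v) [c' ->]] := sU; rewrite gU rpredZ // memv_line.
have E : g v (fap u v (eps u)) = c *: fap u v (eps' u).
  by rewrite gall // cE (transZ fap_lin).
rewrite /rel; congr negb; apply/eqP/eqP => E0.
  move: E; rewrite E0 linear0 => /esym/eqP; rewrite scaler_eq0 (negbTE c0) /=.
  by move/eqP.
have [_ inj] := gE v; apply: inj => //; first exact: mem0v.
by rewrite E E0 scaler0 linear0.
Qed.

Lemma line_scale (a : k) (x : 'rV[k]_d) : a != 0 -> <[a *: x]>%VS = <[x]>%VS.
Proof.
move=> a0; apply/eqP; rewrite eqEsubv -!memvE rpredZ ?memv_line //=.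
by apply/vlineP; exists a^-1; rewrite scalerA mulVf // scale1r.
Qed.

(** Between normalized generators the assignment [e v] to [e' v] commutes with all maps, since
    [linked] depends on [Delta] only. *)
Lemma isorep_of_Delta U U' : Gr pi red B U -> Gr pi red B U' ->
  Delta pi red B U = Delta pi red B U' -> isorep pi red B U U'.
Proof.
move=> /Gr_subrep [eps [gU sU]] /Gr_subrep [eps' [gU' sU']] eqD.
have dE : delta fap eps = delta fap eps'.
  apply/setP => u; apply/idP/idP => [/(Delta_delta gU)|/(Delta_delta gU')].
    by rewrite eqD => /(Delta_delta gU').
  by rewrite -eqD => /(Delta_delta gU).
have [c [c0 nrm]] := normal_exists n_refl n_tri n_pos fap_lin fap_refl fap_comp sU (delta_chain sU).
have [c' [c'0 nrm']] := normal_exists n_refl n_tri n_pos fap_lin fap_refl fap_comp sU' (delta_chain sU').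
set e := fun v => _ in nrm; set e' := fun v => _ in nrm'.
have eN v : e v != 0 by rewrite /e scaler_eq0 negb_or c0 /=; exact: (proj1 sU).
have e'N v : e' v != 0 by rewrite /e' scaler_eq0 negb_or c'0 /=; exact: (proj1 sU').
have ge v : U v = <[e v]>%VS by rewrite gU line_scale.
have ge' v : U' v = <[e' v]>%VS by rewrite gU' line_scale.
clearbody e e'.
have /choice [j ej] v : exists j, e v 0 j != 0.
  apply: contrapT => H; case/eqP: (eN v); apply/rowP => j; rewrite [RHS]mxE.
  by apply/eqP/negPn/negP => h; apply: H; exists j.
(* A rank-one matrix that reads the coordinate [j v], nonzero at [e v], and sends [e v] to
   [e' v]. *)
pose G v : 'M[k]_d := (e v 0 (j v))^-1 *: (delta_mx (j v) 0 *m e' v).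
have GE v : linfun (mulmxr (G v)) (e v) = e' v.
  rewrite lfunE /= /G -scalemxAr mulmxA -colE (_ : col (j v) (e v) = (e v 0 (j v))%:M).
    by rewrite mul_scalar_mx scalerA mulVf // scale1r.
  by apply/matrixP => a b; rewrite !ord1 !mxE eqxx mulr1n.
have GZ v a : linfun (mulmxr (G v)) (a *: e v) = a *: e' v by rewrite linearZ /= GE.
exists (fun v => linfun (mulmxr (G v))); split=> [v|u v _ x].
  split; first by rewrite ge limg_line GE ge'.
  move=> x y; rewrite ge => /vlineP [a ->] /vlineP [b ->]; rewrite !GZ.
  move/eqP; rewrite -subr_eq0 -scalerBl scaler_eq0 (negbTE (e'N v)) orbF subr_eq0.
  by move/eqP ->.
rewrite ge => /vlineP [a ->]; rewrite -!/(fap u v _) GZ !(transZ fap_lin) nrm nrm' dE.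
by case: ifP => _; rewrite ?GZ // !scaler0 linear0.
Qed.

Lemma gens_subrep U eps : Gr pi red B U -> gens U eps -> subrep fap eps.
Proof.
move=> grU gU; have [e [ge [e0 se]]] := (Gr_subrep U).1 grU.
split=> [v|u v]; first by have [/(_ v)] := grU; rewrite gU dim_vline; case: eqP.
apply/vlineP; rewrite memvE -gU -(fap_line _ _ gU) (fap_line _ _ ge) ge -memvE.
exact/vlineP.
Qed.

Lemma delta_gens U eps eps' : gens U eps -> gens U eps' -> delta fap eps = delta fap eps'.
Proof.
move=> g g'; apply/setP => u; apply/idP/idP => H.
  by apply/(Delta_delta g')/(Delta_delta g).
by apply/(Delta_delta g)/(Delta_delta g').
Qed.

(** Induction on the number of vertices of [Delta U] outside [D]: [delta_curve] deletes one, and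
    [closed_curve] carries membership in [Z] back to the limit. *)
Lemma closed_of_Delta Z (D : {set V}) v0 U : zariski_closed Z -> v0 \in D ->
  (forall U', Gr pi red B U' -> Delta pi red B U' = [set` D] -> Z U') ->
  Gr pi red B U -> [set` D] `<=` Delta pi red B U -> Z U.
Proof.
move=> cZ v0D hZ grU subD; have [eps [gU sU]] := (Gr_subrep U).1 grU.
have [m lt_m] : exists m, (#|delta fap eps :\: D| < m)%N by exists #|delta fap eps :\: D|.+1.
elim: m U eps grU subD gU sU lt_m => // m IH U eps grU subD gU sU lt_m.
have subDe : D \subset delta fap eps.
  by apply/fintype.subsetP => u uD; apply/(Delta_delta gU); exact: subD.
have [DD|] := eqVneq (delta fap eps :\: D) finset.set0.
  apply: hZ => //; apply/seteqP; split=> // u /(Delta_delta gU) ue /=.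
  have : delta fap eps \subset D by rewrite -finset.setD_eq0 DD.
  by move=> /fintype.subsetP; apply.
move=> /finset.set0Pn [v]; rewrite finset.in_setD => /andP[vD ve].
have [c [c0 nrm]] := normal_exists n_refl n_tri n_pos fap_lin fap_refl fap_comp sU (delta_chain sU).
set e := fun v => _ in nrm.
have ge : gens U e by move=> w; rewrite gU line_scale.
clearbody e; have se := gens_subrep grU ge.
rewrite (delta_gens gU ge) in nrm subDe ve lt_m.
have v0e : v0 \in delta fap e :\ v.
  by rewrite in_setD1 (fintype.subsetP subDe) // andbT; apply: contraNneq vD => <-.
have [eta etaP] := delta_curve n_refl n_tri n_pos fap_lin fap_refl fap_comp fap_exact
  se (delta_chain se) nrm ve v0e.
apply: (closed_curve (y := eta) cZ ge (proj1 se)) => t t0 ne0.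
have [st dt] := etaP t t0 ne0; set e' := fun w => _ in st dt.
have gt : gens (fun w => <[e w + t *: eta w]>%VS) e' by [].
apply: (IH _ e') => //.
- by apply/Gr_subrep; exists e'.
- move=> u uD; apply/(Delta_delta gt); rewrite dt in_setD1 (fintype.subsetP subDe) // andbT.
  by apply: contraNneq vD => <-.
rewrite dt finset.setDDl finset.setUC -finset.setDDl; move: lt_m.
by rewrite (cardsD1 v (delta fap e :\: D)) finset.in_setD vD ve add1n ltnS.
Qed.

Lemma rank_closed u v :
  zariski_closed [set U : V -> {vspace 'rV[k]_d} | lines U /\ rankv pi red B U u v = 0%N].
Proof.
pose A i j := fap u v (delta_mx 0 i) 0 j.
pose P (j : 'I_d) : {mpoly k[#|{: V * 'I_d}|]} :=
  \sum_(i < d) A i j *: 'X_(enum_rank (u, i)).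
have PE j (x : V -> 'rV[k]_d) :
    (P j).@[fun i => x (enum_val i).1 0 (enum_val i).2] = fap u v (x u) 0 j.
  rewrite /P raddf_sum /= [in RHS](matrix_sum_delta (x u)) big_ord1.
  rewrite /fap linear_sum summxE; apply: eq_bigr => i _.
  by rewrite mevalZ mevalXU enum_rankK /= linearZ !mxE mulrC.
exists [set p | exists j, p = P j]; split.
  move=> _ [j ->]; exists (fun w => (w == u) : nat) => m.
  rewrite mcoeff_msupp /P raddf_sum /= => mP w.
  have [i mE] : exists i : 'I_d, m = U_(enum_rank (u, i))%MM.
    apply: contrapT => H; case/eqP: mP; rewrite big1 // => i _.
    rewrite mcoeffZ mcoeffX; case: eqP => [E|_]; last by rewrite mulr0.
    by case: H; exists i.
  rewrite mE; under eq_bigr do rewrite mnm1E (inj_eq enum_rank_inj) xpair_eqE.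
  have [_|_] := eqVneq w u; last by rewrite big1.
  by rewrite (bigD1 i) //= eqxx big1 // => l li; rewrite eq_sym (negbTE li).
apply/seteqP; split=> U [lU H]; split=> //.
  move=> _ [j ->] eps gU; rewrite PE; move: H; rewrite (rankvE _ _ gU) /rel.
  by case: eqP => // -> _; rewrite mxE.
have /choice [eps gU] w : exists e, U w = <[e]>%VS by have [e _ ->] := line_gen (lU w); exists e.
rewrite (rankvE _ _ gU) /rel (_ : fap u v (eps u) = 0) ?eqxx //.
apply/rowP => j; rewrite mxE -PE; apply: H gU; by exists j.
Qed.

(** Ranks are 0 or 1, so only the vanishing of a rank, a closed condition, has to pass to the
    closure. *)
Lemma rank_le_of_closure S U U' :
  (forall W, S W -> Gr pi red B W /\ rank_le pi red B W U') ->
  Gr_closure pi red B S U -> rank_le pi red B U U'.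
Proof.
move=> hS [grU clU] u v; case E : (rankv pi red B U' u v) => [|m].
  have [|_ ->//] := clU _ (rank_closed u v) => W /hS [[lW _] /(_ u v)].
  by rewrite E leqn0 => /eqP.
have [eps [g _]] := (Gr_subrep U).1 grU; rewrite (rankvE _ _ g).
by case: (rel _ _ _ _).
Qed.

Lemma stratum_self U : Gr pi red B U -> stratum pi red B U U.
Proof. by move=> gU; split=> //; exact: isorep_of_Delta. Qed.

(** Stated for every [S] containing the points with the same [Delta] as [U'], so as to serve both
    quiver and Bruhat strata. *)
Lemma closure_of_rank_le S U U' : Gr pi red B U -> Gr pi red B U' ->
  rank_le pi red B U U' ->
  (forall W, Gr pi red B W -> Delta pi red B W = Delta pi red B U' -> S W) ->
  Gr_closure pi red B S U.
Proof.
move=> grU grU' le hS; split=> // Z cZ SZ.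
have [eps [g s]] := (Gr_subrep U').1 grU'.
have [v _] : exists v : V, True.
  by have [c _ _ _] := cvx; have /card_gt0P [v _] := c; exists v.
have [v0 [v0D _]] := delta_below n_refl n_pos fap_lin fap_refl fap_comp s v.
have DE : Delta pi red B U' = [set` delta fap eps].
  by apply/seteqP; split=> u /(Delta_delta g).
apply: (closed_of_Delta cZ v0D _ grU); rewrite -DE; last exact/(rank_le_Delta grU grU').
by move=> W grW DW; apply/SZ/hS.
Qed.

Lemma stratum_closure U U' : Gr pi red B U -> Gr pi red B U' ->
  stratum pi red B U `<=` Gr_closure pi red B (stratum pi red B U') <->
  rank_le pi red B U U'.
Proof.
move=> grU grU'; split=> [/(_ U (stratum_self grU))|le W [grW iW]].
  apply: rank_le_of_closure => W [grW iW]; split=> //.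
  by have [] := isorep_rank grU' grW iW.
have [_ WU] := isorep_rank grU grW iW.
apply: (closure_of_rank_le grW grU') => [u v|W' grW' DW']; first exact: leq_trans (WU u v) (le u v).
by split=> //; apply: isorep_of_Delta.
Qed.

End QuiverGrassmannian.

(** * Comparison of rank vectors on maximal simplices *)

Section Localization.
Variables (R : idomainType) (pi : R) (k : closedFieldType) (red : {rmorphism R -> k}).
Variables (d : nat) (V : finType) (B : V -> 'M[{fraction R}]_d).
Hypothesis dvr : is_dvr_uniformizer pi.
Hypothesis resid : is_residue_map pi red.
Hypothesis d_gt0 : (0 < d)%N.
Hypothesis cvx : convex_config B.
Local Notation n := (nmin pi B).
Local Notation fap := (fap pi red B).

Local Opaque nmin fmap.

Lemma max_simplex_exists (sigma : {set V}) : simplex pi B sigma ->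
  exists tau, max_simplex pi B tau /\ sigma \subset tau.
Proof.
move=> ss; pose Q (t : {set V}) := `[< simplex pi B t >] && (sigma \subset t).
have Qs : Q sigma by rewrite /Q fintype.subxx andbT; apply/asboolP.
case: (arg_maxnP (fun t : {set V} => #|t|) Qs) => tau /andP[/asboolP st sub] maxt.
exists tau; split=> //; split=> // t stt sub'; apply/eqP; rewrite eq_sym eqEcard sub' /=.
by apply: maxt; rewrite /Q (fintype.subset_trans sub sub') andbT; apply/asboolP.
Qed.

Lemma simplex_pair u w : adjacent pi B u w -> adjacent pi B w u -> simplex pi B [set u; w]%SET.
Proof.
move=> uw wu; split; first by apply/card_gt0P; exists u; rewrite !finset.inE eqxx.
by move=> x y; rewrite !finset.inE => /orP[]/eqP -> /orP[]/eqP ->; rewrite ?eqxx.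
Qed.

(* By convexity a non-maximal vertex already receives a nonzero map from an
   adjacent vertex. *)
Lemma rank_le_local U U' : Gr pi red B U -> Gr pi red B U' ->
  (forall tau, max_simplex pi B tau -> forall u v, u \in tau -> v \in tau ->
     rankv pi red B U' u v = 0%N -> rankv pi red B U u v = 0%N) ->
  rank_le pi red B U U'.
Proof.
move=> grU grU' loc; apply/(rank_le_Delta dvr resid d_gt0 cvx grU grU') => u.
have [eps [g s]] := (Gr_subrep dvr resid d_gt0 cvx U).1 grU.
have [eps' [g' s']] := (Gr_subrep dvr resid d_gt0 cvx U').1 grU'.
move=> /(Delta_delta pi red B g' _)/deltaP hu; apply/(Delta_delta pi red B g _)/deltaP => v vu.
apply/eqP/negPn/negP => nz; have uv : u != v by rewrite eq_sym.
have [w [wu E1 E2]] := nmin_neighbour dvr d_gt0 cvx uv.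
have wrel : rel fap eps w u.
  move: nz; rewrite -(f_additive (fap_comp dvr resid d_gt0 cvx) _ E2).
  have [_ /(_ v w) [c ->]] := s; rewrite (transZ (fap_lin pi red B)) scaler_eq0 negb_or.
  by case/andP.
have uw : adjacent pi B u w.
  by apply/(adjacentP dvr d_gt0 cvx); rewrite eq_sym.
have wu' : adjacent pi B w u.
  by apply/(adjacentP dvr d_gt0 cvx); rewrite addrC.
have [tau [mt sub]] := max_simplex_exists (simplex_pair uw wu').
have := loc tau mt w u; rewrite (rankvE pi red B _ _ g) (rankvE pi red B _ _ g') wrel.
rewrite /rel hu // eqxx => H; have : 1%N = 0%N by apply: H => //; apply: (fintype.subsetP sub); rewrite !finset.inE eqxx ?orbT.
by [].
Qed.

End Localization.

(** * Multiplication maps in an apartment *)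

Section Apartment.
Variables (R : idomainType) (pi : R) (k : fieldType) (red : {rmorphism R -> k}).
Hypothesis pi0 : pi != 0.
Hypothesis pi_nonunit : pi \isn't a GRing.unit.
Hypothesis red_pi : red pi = 0.
Variables (d : nat) (e : 'M[{fraction R}]_d).
Hypothesis ue : e \in unitmx.
Local Notation K := {fraction R}.
Local Notation inK := (@FracField.tofrac R).
Local Notation p n := (inK pi ^ n).
Local Notation bas b := (apt_basis pi e b).

Lemma apt_basisE (b : 'rV[int]_d) : bas b = diag_mx (\row_i p (- b 0 i)) *m e.
Proof. by apply/matrixP => i j; rewrite mul_diag_mx !mxE. Qed.

Lemma apt_unit b : bas b \in unitmx.
Proof.
rewrite apt_basisE unitmx_mul ue andbT unitmxE det_diag unitfE.
by apply/prodf_neq0 => i _; rewrite mxE unifX_neq0.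
Qed.

Lemma apt_quotient b b' :
  bas b *m invmx (bas b') = diag_mx (\row_i p (b' 0 i - b 0 i)).
Proof.
apply: (can_inj (mulmxK (apt_unit b'))); rewrite mulmxKV ?apt_unit //.
rewrite !apt_basisE mulmxA mulmx_diag; congr (diag_mx _ *m e).
by apply/rowP => i; rewrite !mxE -unifXD // addrAC subrr add0r.
Qed.

Lemma apt_subP b b' m : (forall x, lat (bas b) x -> lat (bas b') (p m *: x)) <->
  (forall i, b 0 i <= b' 0 i + m).
Proof.
rewrite (scale_subP pi m (apt_unit b) (apt_unit b')) apt_quotient; split=> H i.
  have := H i i; rewrite !mxE eqxx mulr1n -unifXD // => /(integral_unifX pi0 pi_nonunit).
  by rewrite addrA subr_ge0 addrC.
move=> j; rewrite !mxE; case: eqP => [_|_]; last by rewrite mulr0n mulr0; exact: integral0.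
by rewrite mulr1n -unifXD //; apply/integral_unifX; rewrite // addrA subr_ge0 addrC.
Qed.

Lemma res_unifX m : 0 <= m -> res red (p m) = (m == 0)%:R.
Proof.
case: m => // m _; rewrite -exprnP -tofracXn res_tofrac rmorphXn /= red_pi.
by rewrite expr0n.
Qed.

Variables (V : finType) (a : V -> 'rV[int]_d).
Local Notation B := (apt_config pi e a).

(* The formula does not involve R; it allows to compare R with k[[t]]. *)
Definition apt_dist u v : int :=
  xget 0 [set n : int | (forall i, a u 0 i <= a v 0 i + n) /\
    forall m : int, (forall i, a u 0 i <= a v 0 i + m) -> n <= m].

Lemma nmin_apt u v : nmin pi B u v = apt_dist u v.
Proof.
rewrite /nmin /apt_dist; congr xget.
have H (m : int) : (scale_set (p m) (lat (B u)) `<=` lat (B v)) <->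
    (forall i, a u 0 i <= a v 0 i + m).
  rewrite -apt_subP; split=> [h x Lx|h _ [x Lx <-]]; last exact: h.
  by apply: h; exists x.
apply/seteqP; split=> m /= [h1 h2]; (split; first exact/H); by move=> m' /H; exact: h2.
Qed.

Lemma apt_distP (j0 : 'I_d) u v m : (forall i, a u 0 i <= a v 0 i + m) <-> apt_dist u v <= m.
Proof.
have [hi Phi] : exists m, forall i, a u 0 i <= a v 0 i + m.
  exists (\sum_i `|a u 0 i - a v 0 i|) => i.
  have : a u 0 i - a v 0 i <= \sum_i `|a u 0 i - a v 0 i|.
    rewrite (bigD1 i) //= (le_trans (ler_norm _)) // lerDl.
    by apply: sumr_ge0 => l _; exact: normr_ge0.
  by rewrite lerBlDl.
have Plo m' : (forall i, a u 0 i <= a v 0 i + m') -> a u 0 j0 - a v 0 j0 <= m'.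
  by move=> /(_ j0); rewrite lerBlDl.
have [m0 [P0 min0]] := int_least Phi Plo.
have [h1 h2] : [set n : int | (forall i, a u 0 i <= a v 0 i + n) /\
    forall m : int, (forall i, a u 0 i <= a v 0 i + m) -> n <= m] (apt_dist u v).
  by apply: (@xgetPex _ 0); exists m0.
split=> [/h2//|le i]; apply: le_trans (h1 i) _; by rewrite lerD2l.
Qed.

(** The transition matrix is diagonal with nonnegative powers of [pi], and only exponent 0 survives
    reduction. *)
Lemma fmap_apt u v x i : fmap pi red B u v x 0 i =
  if a u 0 i == a v 0 i + apt_dist u v then x 0 i else 0.
Proof.
have j0 : 'I_d := i.
have le := (apt_distP j0 u v _).2 (lexx (apt_dist u v)).
rewrite lfunE /= nmin_apt apt_quotient mxE (bigD1 i) //= big1 ?addr0 => [|j ji].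
  rewrite !mxE eqxx mulr1n -unifXD // res_unifX.
    rewrite addrA subr_eq0 addrC eq_sym; case: eqP => _; rewrite ?mulr1 ?mulr0 //.
  by rewrite addrA subr_ge0 addrC.
rewrite !mxE (negbTE ji) mulr0n mulr0.
have -> : res red (0 : K) = 0 by rewrite -(tofrac0 R) res_tofrac rmorph0.
by rewrite mulr0.
Qed.

End Apartment.

(** * The ring [k[[t]]] and its residue map *)

Section Series.
Variable k : fieldType.

Fact fps_red_zmod : zmod_morphism (@fps_red k). Proof. by []. Qed.
HB.instance Definition _ := GRing.isZmodMorphism.Build (fps k) k (@fps_red k) fps_red_zmod.
Fact fps_red_monoid : monoid_morphism (@fps_red k).
Proof.
split=> // x y; rewrite /fps_red.
transitivity (\sum_(i < 1) x i * y (0 - i)%N); first by [].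
by rewrite big_ord1.
Qed.
HB.instance Definition _ := GRing.isMonoidMorphism.Build (fps k) k (@fps_red k) fps_red_monoid.

Definition fps_const (c : k) : fps k := fun n => if n is 0%N then c else 0.
Fact fps_const_zmod : zmod_morphism fps_const.
Proof.
move=> x y; apply/funext => -[|n] //.
by change (0 = 0 - 0 :> k); rewrite subrr.
Qed.
HB.instance Definition _ := GRing.isZmodMorphism.Build k (fps k) fps_const fps_const_zmod.
Fact fps_const_monoid : monoid_morphism fps_const.
Proof.
split=> [|x y]; apply/funext => -[|n] //.
  transitivity (\sum_(i < 1) fps_const x i * fps_const y (0 - i)%N); last by [].
  by rewrite big_ord1.
transitivity (\sum_(i < n.+2) fps_const x i * fps_const y (n.+1 - i)%N); last by [].
rewrite big1 // => i _; case: i => [[|i] lti] /=; first by rewrite mulr0.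
by rewrite mul0r.
Qed.
HB.instance Definition _ := GRing.isMonoidMorphism.Build k (fps k) fps_const fps_const_monoid.

Lemma fps_mulXE (y : fps k) n : (fps_X k * y) n = if n is m.+1 then y m else 0.
Proof.
transitivity (\sum_(i < n.+1) fps_X k i * y (n - i)%N); first by [].
case: n => [|n]; first by rewrite big_ord1 /fps_X mul0r.
rewrite big_ord_recl big_ord_recl /fps_X /= mul0r add0r mul1r big1 ?addr0 //.
  by rewrite /bump /= subn1.
by move=> i _; rewrite mul0r.
Qed.

Lemma fps_red_residue : is_residue_map (fps_X k) (@fps_red k).
Proof.
split=> [c|x]; first by exists (fps_const c).
split=> [x0|[y ->]]; last by rewrite /fps_red fps_mulXE.
by exists (fun n => x n.+1); apply/funext => n; rewrite fps_mulXE; case: n.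
Qed.

Lemma fps_redX : fps_red (fps_X k) = 0. Proof. by []. Qed.

Lemma fps_X_neq0 : fps_X k != 0.
Proof.
by apply/eqP => /(congr1 (fun f : fps k => f 1%N)) /eqP; rewrite oner_eq0.
Qed.

Lemma fps_X_nonunit : fps_X k \isn't a GRing.unit.
Proof.
apply/negP => /unitrPr [y /(congr1 (@fps_red k))].
by rewrite rmorphM rmorph1 [X in X * _]fps_redX mul0r => /eqP; rewrite eq_sym oner_eq0.
Qed.

End Series.

(** * Lattices in [k((t))^d] *)

Section SeriesLattices.
Variables (k : fieldType) (d : nat).
Local Notation K := {fraction fps k}.
Local Notation inK := (@FracField.tofrac (fps k)).
Local Notation t n := (inK (fps_X k) ^ n).
Local Notation Lam b := (@Lambda k d b).
Local Notation redL b := (reduction (@fps_red k) (Lambda_basis k b)).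
Implicit Types (b : 'rV[int]_d) (x y z : 'rV[K]_d).

Let X0 := fps_X_neq0 k.
Let Xu := fps_X_nonunit k.

Lemma Lambda_unit b : Lambda_basis k b \in unitmx.
Proof. exact: (apt_unit X0 (unitmx1 _ _)). Qed.

Lemma Lambda_coord b x : x *m invmx (Lambda_basis k b) = \row_i (t (b 0 i) * x 0 i).
Proof.
apply: (can_inj (mulmxK (Lambda_unit b))); rewrite mulmxKV ?Lambda_unit //.
rewrite /Lambda_basis apt_basisE mulmx1; apply/rowP => j; rewrite mul_mx_diag !mxE.
by rewrite mulrAC -unifXD // subrr mul1r.
Qed.

Lemma LambdaP b x : Lam b x <-> forall i, integral (t (b 0 i) * x 0 i).
Proof.
rewrite /Lambda (lat_mem _ (Lambda_unit b)) Lambda_coord.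
by split=> H i; have := H i; rewrite mxE.
Qed.

Lemma redLE b x i : redL b x 0 i = res (@fps_red k) (t (b 0 i) * x 0 i).
Proof. by rewrite /reduction Lambda_coord !mxE. Qed.

Lemma LambdaD b x y : Lam b x -> Lam b y -> Lam b (x + y).
Proof. exact: latD. Qed.

Lemma LambdaZ b c x : integral c -> Lam b x -> Lam b (c *: x).
Proof. exact: latZ. Qed.

Lemma redL_eq0 b x : Lam b x -> redL b x = 0 <-> Lam b (t (-1) *: x).
Proof.
move=> Lx; rewrite (reduction_eq0 (fps_red_residue k) (Lambda_unit b) Lx).
by rewrite scale_setP // unif_neq0.
Qed.

Lemma redL_lift b c : exists x, Lam b x /\ redL b x = c.
Proof.
by have [x Lx xc] := reduction_surj c (fps_red_residue k) (Lambda_unit b); exists x.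
Qed.

Lemma redL_scale b (s : fps k) x : Lam b x ->
  redL b (inK s *: x) = fps_red s *: redL b x.
Proof.
move=> /LambdaP Lx; apply/rowP => i; rewrite [RHS]mxE !redLE mxE.
by have [r rE] := Lx i; rewrite mulrCA rE -tofracM !res_tofrac rmorphM.
Qed.

Lemma redLD b x y : Lam b x -> Lam b y -> redL b (x + y) = redL b x + redL b y.
Proof.
move=> /LambdaP Lx /LambdaP Ly; apply/rowP => i; rewrite [RHS]mxE !redLE mxE.
have [r rE] := Lx i; have [s sE] := Ly i.
by rewrite mulrDr rE sE -tofracD !res_tofrac rmorphD.
Qed.

Lemma lat_preim_line b z x : Lam b z ->
  lat_preim (@fps_red k) (Lambda_basis k b) <[redL b z]>%VS x <->
  exists (s : fps k) y, Lam b y /\ x = inK s *: z + t 1 *: y.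
Proof.
move=> Lz; have int_t : integral (t 1) by apply/integral_unifX.
split=> [[Lx /vlineP [c cE]]|[s [y [Ly ->]]]]; last first.
  have Lsz : Lam b (inK s *: z) by apply: LambdaZ => //; exists s.
  have Lty : Lam b (t 1 *: y) by exact: LambdaZ.
  have e0 : redL b (t 1 *: y) = 0.
    by apply/redL_eq0 => //; rewrite scalerA -unifXD // addNr scale1r.
  split; first exact: LambdaD.
  by rewrite redLD // (redL_scale s Lz) e0 addr0 rpredZ // memv_line.
exists (fps_const c), (t (-1) *: (x - inK (fps_const c) *: z)).
have Lcz : Lam b (- (inK (fps_const c)) *: z).
  by apply: LambdaZ => //; exists (- fps_const c); rewrite tofracN.
split; last by rewrite scalerA -unifXD // subrr scale1r addrC subrK.
rewrite -scaleNr; apply/redL_eq0; first exact: LambdaD.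
rewrite redLD // cE -tofracN redL_scale // rmorphN scaleNr subrr //.
Qed.

Definition unit_vec b (i : 'I_d) : 'rV[K]_d := t (- b 0 i) *: delta_mx 0 i.

Lemma unit_vecE b i j : unit_vec b i 0 j = if j == i then t (- b 0 i) else 0.
Proof. by rewrite !mxE eqxx /=; case: eqP; rewrite ?mulr1 ?mulr0. Qed.

Lemma unit_vecP b i : Lam b (unit_vec b i).
Proof.
apply/LambdaP => j; rewrite unit_vecE; case: eqP => [->|_].
  by rewrite -unifXD // subrr expr0z; exact: integral1.
by rewrite mulr0; exact: integral0.
Qed.

Lemma Lambda_le b b' x : (forall i, b 0 i <= b' 0 i) -> Lam b x -> Lam b' x.
Proof.
move=> le /LambdaP Lx; apply/LambdaP => i; rewrite -(subrK (b 0 i) (b' 0 i)) unifXD // -mulrA.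
by apply: integralM => //; apply/integral_unifX; rewrite ?subr_ge0.
Qed.

Lemma unit_vec_delta b i : unit_vec (b + delta_mx 0 i) i = t (-1) *: unit_vec b i.
Proof.
rewrite /unit_vec scalerA -unifXD //; congr (t _ *: _).
by rewrite !mxE !eqxx /= mulr1n; ring.
Qed.

Lemma Lambda_delta b i x : Lam (b + delta_mx 0 i) x <->
  exists (s : fps k) y, Lam b y /\ x = inK s *: (t (-1) *: unit_vec b i) + y.
Proof.
rewrite -unit_vec_delta; set b' := b + delta_mx 0 i.
have le j : b 0 j <= b' 0 j by rewrite !mxE lerDl; case: (_ && _).
split=> [/LambdaP H|[s [y [Ly ->]]]]; last first.
  apply: LambdaD; last exact: Lambda_le Ly.
  by apply: LambdaZ; [exists s | exact: unit_vecP].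
have [s sE] := H i; exists s, (x - inK s *: unit_vec b' i); split; last by rewrite addrC subrK.
have ux j : (x - inK s *: unit_vec b' i) 0 j = if j == i then 0 else x 0 j.
  have -> : (x - inK s *: unit_vec b' i) 0 j = x 0 j - inK s * unit_vec b' i 0 j.
    by rewrite !mxE.
  rewrite unit_vecE; case: eqP => [->|_]; last by rewrite mulr0 subr0.
  by rewrite -sE mulrAC -unifXD // subrr mul1r subrr.
apply/LambdaP => j; rewrite ux; have := H j; case: (eqVneq j i) => [_ _|ji].
  by rewrite mulr0; exact: integral0.
by rewrite /b' !mxE (negbTE ji) andbF addr0.
Qed.

End SeriesLattices.

(** Sylvester's determinant identity, from two triangular factorizations of one block matrix. *)
Lemma det_1D_mulmxC (F : comUnitRingType) m n (A : 'M[F]_(m, n)) (C : 'M[F]_(n, m)) :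
  \det (1%:M + A *m C) = \det (1%:M + C *m A).
Proof.
have E1 : block_mx 1%:M A (- C) 1%:M =
    block_mx 1%:M A 0 1%:M *m block_mx (1%:M + A *m C) 0 (- C) 1%:M.
  rewrite mulmx_block !(mul1mx, mul0mx, mulmx1, mulmx0, add0r).
  by rewrite mulmxN addrK.
have E2 : block_mx 1%:M A (- C) 1%:M =
    block_mx 1%:M 0 (- C) 1%:M *m block_mx 1%:M A 0 (1%:M + C *m A).
  rewrite mulmx_block !(mul1mx, mul0mx, mulmx1, mulmx0, addr0) mulNmx.
  by rewrite [1%:M + _]addrC addKr.
have := congr1 determinant E1; rewrite E2 !det_mulmx !det_lblock !det_ublock !det1.
by rewrite !mul1r !mulr1.
Qed.

Lemma mulr_shuffle (F : comPzRingType) (x y z c : F) : x * (y * (c * z)) = c * (x * z * y).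
Proof. ring. Qed.

Lemma mulr_shuffle2 (F : comPzRingType) (x x' y q q' z : F) :
  x * x' = q * q' -> x * (y * (z * x')) = q * y * (z * q').
Proof. by move=> E; transitivity ((x * x') * (y * z)); [ring | rewrite E; ring]. Qed.

Lemma scale_comb (F : fieldType) m (c s : F) (z y : 'rV[F]_m) (g : 'M[F]_m) :
  c *: (s *: (z *m g)) + y *m g = (s *: (c *: z) + y) *m g.
Proof. by rewrite mulmxDl -!scalemxAl !scalerA mulrC. Qed.

(** * Parahoric orbits and an explicit group element *)

Section Orbits.
Variables (k : fieldType) (d : nat) (V : finType) (a : V -> 'rV[int]_d).
Hypothesis j0 : 'I_d.
Local Notation K := {fraction fps k}.
Local Notation inK := (@FracField.tofrac (fps k)).
Local Notation t n := (inK (fps_X k) ^ n).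
Local Notation Lam b := (@Lambda k d b).
Local Notation redL b := (reduction (@fps_red k) (Lambda_basis k b)).
Local Notation n := (apt_dist a).
Let X0 := fps_X_neq0 k.
Let Xu := fps_X_nonunit k.

(** The map [f_(u,v)] in apartment coordinates, a formula common to [R] and [k[[t]]]. *)
Definition mask u v (x : 'rV[k]_d) : 'rV[k]_d :=
  \row_i (if a u 0 i == a v 0 i + n u v then x 0 i else 0).

Lemma apt_dist_le u v i : a u 0 i <= a v 0 i + n u v.
Proof. by move: i; apply/(apt_distP a j0). Qed.

Lemma Lambda_dist u v x : Lam (a u) x -> Lam (a v) (t (n u v) *: x).
Proof.
move=> /LambdaP Lx; apply/LambdaP => i; rewrite mxE mulrA -unifXD //.
rewrite (_ : a v 0 i + n u v = (a v 0 i + n u v - a u 0 i) + a u 0 i); last by ring.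
rewrite unifXD // -mulrA; apply: integralM => //; apply/integral_unifX => //.
by rewrite subr_ge0 apt_dist_le.
Qed.

Lemma mask_red u v x : Lam (a u) x ->
  mask u v (redL (a u) x) = redL (a v) (t (n u v) *: x).
Proof.
move=> /LambdaP Lx; apply/rowP => i.
have [r rE] := Lx i; have le := apt_dist_le u v i.
have Eu : redL (a u) x 0 i = fps_red r.
  by apply: etrans (redLE _ _ _) _; rewrite rE res_tofrac.
have Ev : redL (a v) (t (n u v) *: x) 0 i =
    res (@fps_red k) (t (a v 0 i + n u v - a u 0 i) * inK r).
  apply: etrans (redLE _ _ _) _; congr res.
  by rewrite -rE mxE !mulrA -!unifXD // subrK.
apply: etrans _ (esym Ev); apply: etrans (mxE _ _ _ _) _; move: Eu.
move: (redL (a u) x 0 i) => q ->; rewrite eq_sym -subr_eq0.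
have : 0 <= a v 0 i + n u v - a u 0 i by rewrite subr_ge0.
case: (a v 0 i + n u v - a u 0 i) => // m _.
rewrite -exprnP -tofracXn -tofracM res_tofrac rmorphM rmorphXn.
case: m => [|m]; first by rewrite expr0 mul1r.
by rewrite exprS [X in X * _ * _](fps_redX k) !mul0r.
Qed.

(** Vanishing of [f_(u,v)] on [W] means that [t^(n u v)] maps the lattice [t^-1] times the preimage
    of [W] into [Lam (a v)]; since [g] preserves [Lam (a v)], it can be removed. *)
Lemma orbit_rank u v (W : {vspace 'rV[k]_d}) b (g : 'M[K]_d) : g \in unitmx ->
  translate (Lam (a v)) g = Lam (a v) ->
  scale_set (inK (fps_X k))^-1 (lat_preim (@fps_red k) (Lambda_basis k (a u)) W)
    = translate (Lam b) g ->
  (forall x, x \in W -> mask u v x = 0) <-> (forall i, b 0 i <= a v 0 i + n u v).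
Proof.
move=> ug gv gu.
have inj x : Lam (a v) (x *m g) <-> Lam (a v) x.
  split=> [|Lx]; last by rewrite -gv; exists x.
  by rewrite -{1}gv => -[y Ly /(can_inj (mulmxK ug)) <-].
rewrite -(apt_subP X0 Xu (unitmx1 _ _) b (a v) (n u v)); split=> H.
  move=> z Lz; apply/inj; rewrite -scalemxAl.
  have : translate (Lam b) g (z *m g) by exists z.
  rewrite -gu => -[y [Ly yW] <-].
  have := H _ yW; rewrite mask_red // => /redL_eq0 => /(_ (Lambda_dist v Ly)).
  by rewrite scalerA -unifXD // addrC unifXD // -scalerA.
move=> x xW; have [y [Ly yx]] := redL_lift (a u) x.
have : translate (Lam b) g ((inK (fps_X k))^-1 *: y).
  by rewrite -gu; exists y => //; split=> //; rewrite yx.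
move=> [z Lz zE]; rewrite -yx mask_red //; apply/redL_eq0; first exact: Lambda_dist.
rewrite scalerA mulrC -scalerA -[t (-1) *: y]zE scalemxAl; apply/inj.
exact: H.
Qed.


Section Construction.
(** Here [kk v] is the coordinate in which an admissible [h] raises [a v], and [eps] generates lines
    with the same rank pattern as the coordinate lines of [kk]. *)
Variables (tau : {set V}) (kk : V -> 'I_d) (eps : V -> 'rV[k]_d).
Hypothesis n_adj : forall u v, u \in tau -> v \in tau -> u != v -> n u v + n v u = 1.
Hypothesis n_refl : forall u, n u u = 0.
Hypothesis eps_sub : forall u v, u \in tau -> v \in tau -> exists c, mask u v (eps u) = c *: eps v.
Hypothesis kk_mask : forall u v, u \in tau -> v \in tau ->
  (mask u v (eps u) == 0) = (a u 0 (kk u) != a v 0 (kk u) + n u v).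
Hypothesis kk_eq : forall u v, u \in tau -> v \in tau ->
  a u 0 (kk u) = a v 0 (kk u) + n u v -> kk v = kk u.
Hypothesis source : forall v, v \in tau -> exists u,
  [/\ u \in tau, mask u v (eps u) != 0 & forall w, w \in tau -> w != u -> mask w u (eps w) = 0].

Lemma two_values u v i : u \in tau -> v \in tau -> a v 0 i + n u v - 1 <= a u 0 i.
Proof.
move=> ut vt; have [->|uv] := eqVneq u v; first by rewrite n_refl; lia.
by have := n_adj ut vt uv; have := apt_dist_le v u i; lia.
Qed.

Lemma mask_coord u v x i : mask u v x = 0 -> a u 0 i = a v 0 i + n u v -> x 0 i = 0.
Proof. by move=> /rowP /(_ i); rewrite !mxE => + E; rewrite E eqxx. Qed.

(* The coordinates i and j lie in the same block of the partition defined by the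
   chain of lattices L_w, w in tau. *)
Definition same_block u i j := forall w, w \in tau -> a u 0 i - a w 0 i = a u 0 j - a w 0 j.

(** Among the sets [A v] of coordinates surviving [f_(u,v)], the smallest one containing [kk u] lies
    in all others containing it. There [f_(u,v)] does not kill [eps u], which gives [c]; and if
    [kk u] is not in [A w], then [f_(u,w)] kills [eps u], so [c] is not in [A w] either. *)
Lemma block_coord u : u \in tau -> exists c, eps u 0 c != 0 /\ same_block u c (kk u).
Proof.
move=> ut; pose A v := [set i : 'I_d | a u 0 i == a v 0 i + n u v]%SET.
have AE v i : (i \in A v) = (a u 0 i == a v 0 i + n u v) by rewrite finset.inE.
pose T v := (v \in tau) && (kk u \in A v).
have Tu : T u by rewrite /T ut AE n_refl addr0 eqxx.
case: (arg_minnP (fun v => #|A v|) Tu) => v /andP[vt kv] minv.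
have sub w : T w -> A v \subset A w.
  move=> Tw; have /andP[wt kw] := Tw.
  case: (lerP (n v w) (n u w - n u v)) => le.
    have sub' : A w \subset A v.
      apply/fintype.subsetP => i; rewrite !AE => /eqP h; apply/eqP.
      by have := apt_dist_le v w i; have := apt_dist_le u v i; move: h le; clear; lia.
    by have /eqP -> : A w == A v by rewrite eqEcard sub' minv.
  apply/fintype.subsetP => i; rewrite !AE => /eqP h; apply/eqP.
  by have := two_values i vt wt; have := apt_dist_le u w i; move: h le; clear; lia.
have : mask u v (eps u) != 0 by rewrite kk_mask // negbK -AE.
move=> nz; have [c mc] : exists c, mask u v (eps u) 0 c != 0.
  apply: contrapT => H; case/eqP: nz; apply/rowP => c; rewrite [RHS]mxE.
  by apply/eqP/negPn/negP => h; apply: H; exists c.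
move: mc; rewrite mxE; case: ifP => [/eqP cv ec|_]; last by rewrite eqxx.
exists c; split=> // w wt; have cA : c \in A v by rewrite AE cv.
case: (boolP (kk u \in A w)) => kw.
  have Tw : T w by rewrite /T wt.
  have := fintype.subsetP (sub w Tw) c cA; move: kw; rewrite !AE => /eqP -> /eqP ->.
  by rewrite [LHS]addrC [RHS]addrC !addKr.
have mw : mask u w (eps u) = 0 by apply/eqP; rewrite kk_mask // -AE.
have cw : a u 0 c != a w 0 c + n u w by apply: contraNneq ec => /(mask_coord mw) ->.
have h1 := two_values c ut wt; have h2 := two_values (kk u) ut wt.
have h3 := apt_dist_le u w c; have h4 := apt_dist_le u w (kk u).
move: kw cw; rewrite AE => /eqP kw /eqP cw; move: kw cw h1 h2 h3 h4; clear; lia.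
Qed.

(** The form [mu] takes the value 1 on both the basis vector of [kk u] and [c * eps u], so it kills
    their difference; this is the origin of [H Phi = 0] below. If the coordinate of [eps u] at
    [kk u] vanishes, a second coordinate of the block is added. *)
Lemma functional u : u \in tau -> exists c (mu : 'rV[k]_d),
  [/\ c != 0, mu 0 (kk u) = 1, \sum_i c * eps u 0 i * mu 0 i = 1 &
      forall i, mu 0 i != 0 -> same_block u i (kk u)].
Proof.
move=> ut; have [c0 [ec0 blk]] := block_coord ut.
have [ek|ek] := eqVneq (eps u 0 (kk u)) 0; last first.
  exists (eps u 0 (kk u))^-1, (delta_mx 0 (kk u)); split.
  - by rewrite invr_eq0.
  - by rewrite mxE !eqxx.
  - rewrite (bigD1 (kk u)) //= big1 => [|i ik]; first by rewrite mxE !eqxx mulr1 mulVf // addr0.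
    by rewrite mxE (negbTE ik) andbF mulr0.
  by move=> i; rewrite mxE eqxx /=; case: (eqVneq i (kk u)) => [-> _ w|_]; rewrite ?eqxx.
have c0k : c0 != kk u by apply: contraNneq ec0 => ->; rewrite ek.
exists 1, (delta_mx 0 (kk u) + (eps u 0 c0)^-1 *: delta_mx 0 c0); split.
- exact: oner_neq0.
- by rewrite !mxE !eqxx eq_sym (negbTE c0k) mulr0 addr0.
- rewrite (bigD1 c0) //= big1 => [|i ic].
    by rewrite !mxE !eqxx (negbTE c0k) add0r mulr1 mul1r mulfV // addr0.
  rewrite !mxE (negbTE ic) andbF mulr0 addr0 mul1r.
  by case: (eqVneq i (kk u)) => [->|_]; rewrite ?ek ?mul0r // andbF mulr0.
move=> i; rewrite !mxE eqxx /=; case: (eqVneq i (kk u)) => [-> _ w //|_].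
case: (eqVneq i c0) => [-> _ //|_]; by rewrite mulr0 addr0 eqxx.
Qed.


(** The maximal vertices relative to [tau]; they need not be maximal in the whole configuration. *)
Definition sources := [set u in tau | [forall (w | w \in tau), (w != u) ==> (mask w u (eps w) == 0)]]%SET.

Lemma sourcesP u : reflect (u \in tau /\ forall w, w \in tau -> w != u -> mask w u (eps w) = 0)
  (u \in sources).
Proof.
rewrite finset.inE; apply: (iffP andP) => -[ut H]; split=> //.
  by move=> w wt wu; have /forall_inP/(_ w wt)/implyP/(_ wu)/eqP := H.
by apply/forall_inP => w wt; apply/implyP => wu; rewrite H.
Qed.

(** The coordinate [kk w] dies under [f_(w,u)], so by adjacency its block survives under [f_(u,w)].
    As [f_(u,w)] kills [eps u], the latter has no coordinate in this block. *)
Lemma sources_disjoint u w i : u \in sources -> w \in sources -> u != w ->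
  same_block w i (kk w) -> eps u 0 i = 0 /\ i != kk u.
Proof.
move=> /sourcesP[ut hu] /sourcesP[wt hw] uw blk.
have wu : w != u by rewrite eq_sym.
have mu := hu w wt wu; have mw := hw u ut uw.
have k1 : a w 0 (kk w) != a u 0 (kk w) + n w u by rewrite -kk_mask // mu.
have k2 : a u 0 (kk u) != a w 0 (kk u) + n u w by rewrite -kk_mask // mw.
have E : a u 0 i = a w 0 i + n u w.
  have h1 := two_values (kk w) wt ut; have h2 := apt_dist_le w u (kk w).
  have h3 := blk u ut; have h4 := n_adj ut wt uw.
  by move/eqP: k1 => k1; move: k1 h1 h2 h3 h4; clear; lia.
split; first exact: mask_coord mw E.
by apply: contraNneq k2 => <-; rewrite E.
Qed.

(* The matrix 1 + Phi H, with H Phi = 0, sends the basis vector e_(kk u) to a lift of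
   the generator at u, for every source u, and preserves the lattices of tau. *)
Lemma orbit_exists (W : V -> {vspace 'rV[k]_d}) :
  (forall v, W v = <[eps v]>%VS) -> (forall v, eps v != 0) ->
  exists g : 'M[K]_d, \det g = 1 /\ forall v, v \in tau ->
    translate (Lam (a v)) g = Lam (a v) /\
    scale_set (inK (fps_X k))^-1 (lat_preim (@fps_red k) (Lambda_basis k (a v)) (W v))
      = translate (Lam (a v + delta_mx 0 (kk v))) g.
Proof.
move=> WE eps0.
pose C (x : k) := inK (fps_const x).
have CB x y : C (x - y) = C x - C y by rewrite /C rmorphB tofracB.
have CM x y : C (x * y) = C x * C y by rewrite /C rmorphM tofracM.
have C0 : C 0 = 0 by rewrite /C rmorph0 tofrac0.
have C1 : C 1 = 1 by rewrite /C rmorph1 tofrac1.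
have Csum (F : 'I_d -> k) : C (\sum_i F i) = \sum_i C (F i) by rewrite /C !rmorph_sum.
have Cint x : integral (C x) by exists (fps_const x).
have /choice [cm cmP] u : exists cm : k * 'rV[k]_d, u \in tau ->
    [/\ cm.1 != 0, cm.2 0 (kk u) = 1, \sum_i cm.1 * eps u 0 i * cm.2 0 i = 1 &
      forall i, cm.2 0 i != 0 -> same_block u i (kk u)].
  case: (boolP (u \in tau)) => ut; last by exists (0, 0).
  by have [c [mu H]] := functional ut; exists (c, mu).
pose mu u := (cm u).2; pose en u i := (cm u).1 * eps u 0 i.
pose eta u i := en u i - (i == kk u)%:R.
have dP u : u \in sources -> u \in tau by case/sourcesP.
have mu_k u : u \in sources -> mu u 0 (kk u) = 1 by move=> /dP/cmP [].
have mu_blk u i : u \in sources -> mu u 0 i != 0 -> same_block u i (kk u).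
  by move=> /dP/cmP [_ _ _]; apply.
have mu_eta u w i : u \in sources -> w \in sources -> u != w -> mu w 0 i != 0 -> eta u i = 0.
  move=> uD wD uw /(mu_blk _ _ wD) blk; have [e0 ik] := sources_disjoint uD wD uw blk.
  by rewrite /eta /en e0 mulr0 (negbTE ik) subrr.
have eta_blk u w i : u \in sources -> w \in tau -> eta u i != 0 ->
    a u 0 i - a w 0 i <= a u 0 (kk u) - a w 0 (kk u).
  move=> uD wt; have ut := dP u uD; case: (eqVneq i (kk u)) => [->//|ik].
  rewrite /eta (negbTE ik) subr0 => en0.
  have h1 := apt_dist_le u w i; have h2 := two_values (kk u) ut wt.
  case: (eqVneq (a u 0 (kk u)) (a w 0 (kk u) + n u w)) => kA.
    by move: h1 kA; clear; lia.
  have /eqP mw : mask u w (eps u) == 0 by rewrite kk_mask.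
  have iA : a u 0 i != a w 0 i + n u w.
    by apply: contraNneq en0 => /(mask_coord mw) e0; rewrite /en e0 mulr0.
  by move/eqP: iA => iA; move: iA h1 h2; clear; lia.
pose m := #|V|.
(* Columns of [Phi] are the forms [mu u], rows of [H] the differences [eta u], in the basis of
   [Lam (a u)]; vertices that are not sources contribute zero. *)
pose Phi : 'M[K]_(d, m) := \matrix_(i, j)
  (if enum_val j \in sources then C (mu (enum_val j) 0 i) * t (a (enum_val j) 0 i) else 0).
pose H : 'M[K]_(m, d) := \matrix_(j, i)
  (if enum_val j \in sources then C (eta (enum_val j) i) * t (- a (enum_val j) 0 i) else 0).
have HPhi : H *m Phi = 0.
  apply/matrixP => j j'; rewrite !mxE.
  case: (boolP (enum_val j \in sources)) => uD; last first.
    by rewrite big1 // => i _; rewrite !mxE (negbTE uD) mul0r.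
  case: (boolP (enum_val j' \in sources)) => wD; last first.
    by rewrite big1 // => i _; rewrite !mxE (negbTE wD) mulr0.
  have [E|uw] := eqVneq (enum_val j) (enum_val j'); last first.
    rewrite big1 // => i _; rewrite !mxE uD wD.
    have [->|/(mu_eta _ _ _ uD wD uw) ->] := eqVneq (mu (enum_val j') 0 i) 0.
      by rewrite C0 mul0r mulr0.
    by rewrite C0 !mul0r.
  set u := enum_val j in uD E *.
  transitivity (\sum_i C (eta u i * mu u 0 i)).
    apply: eq_bigr => i _; rewrite !mxE -E -/u uD CM mulrACA -unifXD // addNr expr0z.
    by rewrite mulr1.
  rewrite -Csum (_ : \sum_i _ = 0) //; under eq_bigr do rewrite mulrBl.
  have [_ h1 h2 _] := cmP u (dP u uD); rewrite sumrB h2.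
  rewrite (bigD1 (kk u)) //= big1 => [|i ik]; last by rewrite (negbTE ik) mul0r.
  by rewrite eqxx mul1r addr0 h1 subrr.
(* As [H Phi = 0], the square of [N] is zero, [1 - N] inverts [g], and
   [det g = det (1 + H Phi) = 1]. *)
pose N := Phi *m H.
have NN : N *m N = 0 by rewrite /N mulmxA -(mulmxA Phi) HPhi mulmx0 mul0mx.
pose g := 1%:M + N; pose g' := 1%:M - N.
have g'g : g' *m g = 1%:M.
  by rewrite /g /g' mulmxBl mul1mx mulmxDr mulmx1 NN addr0 addrK.
have detg : \det g = 1 by rewrite /g /N det_1D_mulmxC HPhi addr0 det1.
(* On the support of [mu u] the exponents of [a w] and [a u] differ by a constant [q], and on that
   of [eta u] by at least [q]. *)
have Nlat w x : w \in tau -> Lam (a w) x -> Lam (a w) (x *m N).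
  move=> wt /LambdaP Lx; apply/LambdaP => i'.
  rewrite /N mulmxA mxE mulr_sumr; apply: integral_sum => j.
  rewrite [H j i']mxE; case: (boolP (enum_val j \in sources)) => uD; last first.
    by rewrite !mulr0; exact: integral0.
  set u := enum_val j in uD *; have ut := dP u uD.
  have int1 : integral (t (a w 0 (kk u) - a u 0 (kk u)) * (x *m Phi) 0 j).
    rewrite mxE mulr_sumr; apply: integral_sum => i; rewrite [Phi i j]mxE -/u uD.
    have [->|m0] := eqVneq (mu u 0 i) 0; first by rewrite C0 mul0r !mulr0; exact: integral0.
    have blk := mu_blk u i uD m0 w wt.
    have -> : a w 0 (kk u) - a u 0 (kk u) = a w 0 i - a u 0 i by move: blk; clear; lia.
    have -> : t (a w 0 i - a u 0 i) * (x 0 i * (C (mu u 0 i) * t (a u 0 i))) =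
        C (mu u 0 i) * (t (a w 0 i) * x 0 i).
      have TD : t (a w 0 i) = t (a w 0 i - a u 0 i) * t (a u 0 i) by rewrite -unifXD // subrK.
      by rewrite [X in _ = _ * (X * _)]TD; exact: mulr_shuffle.
    exact: integralM.
  have [->|e0] := eqVneq (eta u i') 0; first by rewrite C0 mul0r !mulr0; exact: integral0.
  have le := eta_blk u w i' uD wt e0.
  set q := a w 0 (kk u) - a u 0 (kk u) in int1.
  have -> : t (a w 0 i') * ((x *m Phi) 0 j * (C (eta u i') * t (- a u 0 i'))) =
      (t q * (x *m Phi) 0 j) * (C (eta u i') * t (a w 0 i' - a u 0 i' - q)).
    apply: mulr_shuffle2.
    by rewrite -!unifXD //; congr (t _); clear; lia.
  apply: integralM => //; apply: integralM => //; apply/integral_unifX => //.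
  by rewrite /q; move: le; clear; lia.
have transl w : w \in tau -> translate (Lam (a w)) g = Lam (a w).
  move=> wt; apply/seteqP; split=> [_ [x Lx <-]|x Lx].
    by rewrite /g mulmxDr mulmx1; apply: LambdaD => //; exact: Nlat.
  exists (x *m g'); last by rewrite -mulmxA g'g mulmx1.
  rewrite /g' mulmxBr mulmx1; apply: LambdaD => //; rewrite -scaleN1r; apply: LambdaZ.
    by exists (- 1); rewrite tofracN tofrac1.
  exact: Nlat.
pose te u : 'rV[K]_d := \row_i (C (en u i) * t (- a u 0 i)).
have te_coord u i : t (a u 0 i) * te u 0 i = C (en u i).
  by rewrite mxE mulrCA -unifXD // subrr expr0z mulr1.
have te_lat u : Lam (a u) (te u) by apply/LambdaP => i; rewrite te_coord.
have te_red u : redL (a u) (te u) = (cm u).1 *: eps u.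
  apply/rowP => i; apply: etrans (redLE _ _ _) _.
  by rewrite te_coord /C res_tofrac [RHS]mxE.
have unit_g u : u \in sources -> unit_vec k (a u) (kk u) *m g = te u.
  move=> uD; set z := unit_vec _ _ _.
  have zi i : z 0 i = if i == kk u then t (- a u 0 (kk u)) else 0 by rewrite unit_vecE.
  have zPhi j : (z *m Phi) 0 j = (enum_val j == u)%:R.
    rewrite mxE (bigD1 (kk u)) //= big1 => [|i ik]; last by rewrite zi (negbTE ik) mul0r.
    rewrite zi eqxx addr0 mxE; case: (eqVneq (enum_val j) u) => [->|ju].
      by rewrite uD mu_k // C1 mul1r -unifXD // addNr.
    case: ifP => wD; last by rewrite mulr0.
    have [->|m0] := eqVneq (mu (enum_val j) 0 (kk u)) 0; first by rewrite C0 mul0r mulr0.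
    have uj : u != enum_val j by rewrite eq_sym.
    have [_] := sources_disjoint uD wD uj (mu_blk _ _ wD m0).
    by rewrite eqxx.
  apply/rowP => i; rewrite /g mulmxDr mulmx1 /N mulmxA [LHS]mxE zi [te u 0 i]mxE.
  have -> : (z *m Phi *m H) 0 i = C (eta u i) * t (- a u 0 i).
    rewrite mxE (bigD1 (enum_rank u)) //= big1 => [|j ju].
      by rewrite zPhi [H _ _]mxE enum_rankK eqxx uD mul1r addr0.
    rewrite zPhi (_ : (enum_val j == u) = false) ?mul0r //.
    by apply/negbTE; apply: contraNneq ju => <-; rewrite enum_valK.
  rewrite /eta; case: eqP => [->|_]; last by rewrite subr0 add0r.
  by rewrite CB C1 mulrBl mul1r addrC subrK.
exists g; split=> // v vt; split; first exact: transl.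
have [u [ut uv usrc]] := source vt.
have uD : u \in sources by apply/sourcesP.
have uA : a u 0 (kk u) = a v 0 (kk u) + n u v.
  by apply/eqP; move: uv; rewrite kk_mask // negbK.
have kuv := kk_eq ut vt uA.
(* The basis vector at [v] is a multiple of the one at its source [u], so the images at the sources
   determine all others. *)
have zv : unit_vec k (a v) (kk v) = t (n u v) *: unit_vec k (a u) (kk u).
  rewrite kuv /unit_vec scalerA -unifXD //; congr (t _ *: _).
  by move: uA; clear; lia.
set z := unit_vec k (a v) (kk v) in zv *.
have zg : z *m g = t (n u v) *: te u by rewrite zv -scalemxAl unit_g.
have zgL : Lam (a v) (z *m g) by rewrite zg; apply: Lambda_dist.
have cu0 : (cm u).1 != 0 by have [] := cmP u ut.
have redz : <[redL (a v) (z *m g)]>%VS = W v.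
  have [c cE] := eps_sub ut vt.
  have c0 : c != 0 by apply: contraNneq uv => c0; rewrite cE c0 scale0r.
  have -> : redL (a v) (z *m g) = ((cm u).1 * c) *: eps v.
    rewrite zg -(mask_red v (te_lat u)) te_red -scalerA -cE.
    by apply/rowP => i; rewrite !mxE; case: ifP => // _; rewrite mulr0.
  have cc : (cm u).1 * c != 0 by rewrite mulf_neq0.
  rewrite WE; apply/eqP; rewrite eqEsubv -!memvE rpredZ ?memv_line //=.
  by apply/vlineP; exists ((cm u).1 * c)^-1; rewrite scalerA mulVf // scale1r.
have tt x : t (-1) *: (t 1 *: x) = x :> 'rV[K]_d by rewrite scalerA -unifXD // addNr scale1r.
have XE : (inK (fps_X k))^-1 = t (-1) by [].
apply/seteqP; split=> [_ [x + <-]|_ [x + <-]].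
  rewrite -redz => /(lat_preim_line _ zgL) [s [y [Ly ->]]].
  have [y' Ly' yE] : translate (Lam (a v)) g y by rewrite transl.
  exists (inK s *: (t (-1) *: z) + y'); first by apply/Lambda_delta; exists s, y'.
  by rewrite XE scalerDr tt -yE; exact/esym/scale_comb.
move=> /Lambda_delta [s [y [Ly ->]]].
exists (inK s *: (z *m g) + t 1 *: (y *m g)).
  rewrite -redz; apply/(lat_preim_line _ zgL); exists s, (y *m g); split=> //.
  by rewrite -(transl v vt); exists y.
by rewrite XE scalerDr tt; exact: scale_comb.
Qed.

End Construction.
End Orbits.

(** * Bruhat strata, ranks and the generalized Bruhat order *)

Section BruhatStrata.
Variables (R : idomainType) (pi : R) (k : closedFieldType) (red : {rmorphism R -> k}).
Variables (d : nat) (V : finType) (e : 'M[{fraction R}]_d) (a : V -> 'rV[int]_d).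
Hypothesis dvr : is_dvr_uniformizer pi.
Hypothesis resid : is_residue_map pi red.
Hypothesis d_gt1 : (2 <= d)%N.
Hypothesis ue : e \in unitmx.
Local Notation B := (apt_config pi e a).
Hypothesis cvx : convex_config B.
Implicit Types (u v : V) (tau : {set V}) (h : {set V} -> affW d).
Implicit Types (U M : V -> {vspace 'rV[k]_d}).

Let pi0 : pi != 0. Proof. by case: dvr. Qed.
Let pi_nonunit : pi \isn't a GRing.unit. Proof. by case: dvr. Qed.
Let red_pi : red pi = 0.
Proof. by case: resid => _ ker; apply/ker; exists 1; rewrite mulr1. Qed.
Let d_gt0 : (0 < d)%N. Proof. exact: ltnW. Qed.
Let j0 : 'I_d := Ordinal d_gt0.
Local Notation n := (apt_dist a).

Local Opaque nmin fmap.

Let nE u v : nmin pi B u v = n u v. Proof. exact: nmin_apt. Qed.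

Lemma fap_mask u v x : fap pi red B u v x = mask a u v x.
Proof. by apply/rowP => i; rewrite [RHS]mxE; exact: fmap_apt. Qed.

Lemma bruhat_stratum_rank h U tau u v : bruhat_stratum pi red e a h U ->
  max_simplex pi B tau -> u \in tau -> v \in tau ->
  rankv pi red B U u v = 0%N <-> forall i, wact (h tau) (a u) 0 i <= a v 0 i + n u v.
Proof.
move=> [grU /(_ tau) H] mt ut vt; have [g [[detg gP] gU]] := H mt.
have ug : g \in unitmx by rewrite unitmxE detg unitr1.
rewrite -(orbit_rank j0 ug (gP v vt) (gU u ut)).
have [eps [gen _]] := (Gr_subrep dvr resid d_gt0 cvx U).1 grU.
rewrite (rankvE pi red B _ _ gen) /rel fap_mask gen.
split=> [|H0]; last by rewrite H0 ?memv_line ?eqxx.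
case: eqP => // m0 _ x /vlineP [c ->].
by rewrite -fap_mask (transZ (fap_lin pi red B)) fap_mask m0 scaler0.
Qed.

Lemma bruhat_rank_le h h' U U' : bruhat_stratum pi red e a h U ->
  bruhat_stratum pi red e a h' U' ->
  rank_le pi red B U U' <->
  forall tau, max_simplex pi B tau -> forall u v, u \in tau -> v \in tau ->
    wle (h' tau) (a u) (a v) (n u v) -> wle (h tau) (a u) (a v) (n u v).
Proof.
move=> sU sU'; split=> [le tau mt u v ut vt|H].
  move=> /(bruhat_stratum_rank sU' mt ut vt) r0; apply/(bruhat_stratum_rank sU mt ut vt).
  by apply/eqP; rewrite -leqn0 -r0; exact: le.
apply: (rank_le_local dvr resid d_gt0 cvx) => [||tau mt u v ut vt].
- by case: sU.
- by case: sU'.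
move=> /(bruhat_stratum_rank sU' mt ut vt) r0; apply/(bruhat_stratum_rank sU mt ut vt).
exact: H.
Qed.

(** Only [c = n u v] matters: for smaller [c] the inequality fails for [h'], which does not lower
    [a u]; for larger [c] it holds for [h], which raises [a u] by at most 1. *)
Lemma gen_bruhat_leP g I h h' :
  (forall tau, max_simplex pi B tau -> face_of a tau (g tau) (I tau)) ->
  adm1 pi e a h -> adm1 pi e a h' ->
  gen_bruhat_le pi e a g I h h' <->
  forall tau, max_simplex pi B tau -> forall u v, u \in tau -> v \in tau ->
    wle (h' tau) (a u) (a v) (n u v) -> wle (h tau) (a u) (a v) (n u v).
Proof.
move=> faces [ah _] [ah' _].
suff H tau : max_simplex pi B tau ->
    dcoset_le (to_base_alcove (g tau)) (Wsimplex a tau) (WF (g tau) (I tau))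
      (wmul (h tau) (winv (iota_w d))) (wmul (h' tau) (winv (iota_w d))) <->
    forall u v, u \in tau -> v \in tau ->
      wle (h' tau) (a u) (a v) (n u v) -> wle (h tau) (a u) (a v) (n u v).
  by split=> H0 tau mt; [apply/H | apply/H] => //; exact: H0.
move=> mt; have fE : a @` [set` tau] = face (I tau) (g tau) := faces tau mt.
have fP u : u \in tau -> face (I tau) (g tau) (a u) by move=> ut; rewrite -fE; exists u.
have [[tau0 _] _] := mt; have [u0 u0t] : exists u0, u0 \in tau.
  by have /card_gt0P [u0 u0t] := tau0; exists u0.
have [i0 i0I _] := fP u0 u0t.
have adm0 hh : (forall v, v \in tau -> adm_at (hh tau) (a v)) ->
    forall b, face (I tau) (g tau) b -> adm_at (hh tau) b.
  by move=> H b; rewrite -fE => -[v vt <-]; exact: H.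
rewrite /Wsimplex fE (dcoset_le_face d_gt1 i0I (adm0 h (ah tau mt)) (adm0 h' (ah' tau mt))).
split=> [H u v ut vt|H b b' c]; first exact: H (fP u ut) (fP v vt).
rewrite -fE => -[u ut <-] [v vt <-] w'.
have [bd _] := ah tau mt u ut; have [bd' _] := ah' tau mt u ut.
have nc : n u v <= c.
  by apply/(apt_distP a j0) => i; have /andP[le _] := bd' i; apply: le_trans (w' i).
have [nc1|nc1] := eqVneq (n u v) c; first by rewrite -nc1; apply: H => //; rewrite nc1.
move=> i; have /andP[_ le] := bd i; apply: le_trans le _.
have := apt_dist_le a j0 u v i; have : n u v + 1 <= c by rewrite lezD1 lt_neqAle nc1.
lia.
Qed.

(** Equal [Delta] gives equal ranks, and on the stratum these are prescribed by [h]; this is the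
    input of [orbit_exists] on each maximal simplex. *)
Lemma bruhat_stratum_of_Delta h U U' : adm1 pi e a h -> bruhat_stratum pi red e a h U' ->
  Gr pi red B U -> Delta pi red B U = Delta pi red B U' ->
  bruhat_stratum pi red e a h U.
Proof.
move=> [ah _] sU' grU DE; split=> // tau mt.
have grU' : Gr pi red B U' by case: sU'.
have le1 : rank_le pi red B U U' by apply/(rank_le_Delta dvr resid d_gt0 cvx grU grU'); rewrite DE.
have le2 : rank_le pi red B U' U by apply/(rank_le_Delta dvr resid d_gt0 cvx grU' grU); rewrite DE.
have [eps [gen sub]] := (Gr_subrep dvr resid d_gt0 cvx U).1 grU.
have [eps0 _] := sub.
have /choice [kk kkE] v : exists i, v \in tau -> wact (h tau) (a v) = a v + delta_mx 0 i.
  case: (boolP (v \in tau)) => vt; last by exists j0.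
  by have [bd sm] := ah tau mt v vt; have [i iE] := delta_step d_gt1 bd sm; exists i.
have adj u v : u \in tau -> v \in tau -> u != v -> n u v + n v u = 1.
  move=> ut vt uv; have [[_ adj] _] := mt.
  by have /(adjacentP dvr d_gt0 cvx) [_] := adj u v ut vt uv; rewrite !nE.
have nrefl u : n u u = 0 by rewrite -nE (nmin_refl dvr d_gt0 cvx).
have rankE u v : u \in tau -> v \in tau -> (mask a u v (eps u) == 0) =
    (a u 0 (kk u) != a v 0 (kk u) + n u v).
  move=> ut vt; rewrite -fap_mask.
  have rk : rankv pi red B U u v = 0%N <-> rankv pi red B U' u v = 0%N.
    by split=> r0; apply/eqP; rewrite -leqn0 -r0; [exact: le2 | exact: le1].
  rewrite (bruhat_stratum_rank sU' mt ut vt) kkE // (rankvE pi red B _ _ gen) /rel in rk.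
  apply/idP/idP => [m0|/eqP ne].
    have := rk.1; rewrite m0 => /(_ erefl) /(_ (kk u)); rewrite !mxE !eqxx /= => le.
    by apply/eqP; move: le; clear; lia.
  have : nat_of_bool (fap pi red B u v (eps u) != 0) = 0%N.
    apply/rk => i; rewrite !mxE eqxx /=; have := apt_dist_le a j0 u v i.
    by case: (eqVneq i (kk u)) => [->|_] /=; move: ne; clear; lia.
  by case: (_ == 0).
have [] := @orbit_exists k d V a j0 tau kk eps adj nrefl _ rankE _ _ U gen eps0.
- by move=> u v ut vt; have [_ /(_ u v) [c cE]] := sub; exists c; rewrite -fap_mask.
- move=> u v ut vt E; apply/eqP/negPn/negP => ne.
  have : wact (h tau) (a u) 0 (kk u) <= wact (h tau) (a v) 0 (kk u) + n u v.
    by rewrite !mxE addrAC lerD2r; exact: apt_dist_le.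
  rewrite !kkE // !mxE !eqxx /= eq_sym (negbTE ne) E; clear; lia.
- move=> v vt.
  have [u [ut uv umin]] := rel_minimal (nmin_refl dvr d_gt0 cvx) (nmin_pos dvr d_gt0 cvx)
    (fap_lin pi red B) (fap_refl dvr resid d_gt0 cvx) (fap_comp dvr resid d_gt0 cvx) sub vt.
  exists u; split=> //; first by rewrite -fap_mask.
  by move=> w wt wu; rewrite -fap_mask; exact: umin.
move=> g [detg gP]; exists g; split; first by split=> // v vt; case: (gP v vt).
by move=> v vt; rewrite kkE //; case: (gP v vt).
Qed.

End BruhatStrata.

Theorem proposition5p5
    (R : idomainType) (pi : R) (k : closedFieldType) (red : {rmorphism R -> k})
    (d : nat) (V : finType) :
  is_dvr_uniformizer pi -> is_residue_map pi red -> (2 <= d)%N ->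
  (forall B : V -> 'M[{fraction R}]_d, convex_config B ->
   forall M M' : V -> {vspace 'rV[k]_d}, Gr pi red B M -> Gr pi red B M' ->
     (stratum pi red B M `<=` Gr_closure pi red B (stratum pi red B M')
        <-> rank_le pi red B M M') /\
     (rank_le pi red B M M'
        <-> Delta pi red B M' `<=` Delta pi red B M))
  /\
  (forall (e : 'M[{fraction R}]_d) (a : V -> 'rV[int]_d)
          (g : {set V} -> affW d) (I : {set V} -> {set 'I_d}),
   let B := apt_config pi e a in
   e \in unitmx -> convex_config B ->
   (forall tau, max_simplex pi B tau -> chain_representatives pi e a tau) ->
   (forall tau, max_simplex pi B tau -> face_of a tau (g tau) (I tau)) ->
   forall h h' : {set V} -> affW d, adm1 pi e a h -> adm1 pi e a h' ->
   forall M M' : V -> {vspace 'rV[k]_d},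
   bruhat_stratum pi red e a h M -> bruhat_stratum pi red e a h' M' ->
     (gen_bruhat_le pi e a g I h h' <->
        bruhat_stratum pi red e a h
          `<=` Gr_closure pi red B (bruhat_stratum pi red e a h')) /\
     (gen_bruhat_le pi e a g I h h' <-> rank_le pi red B M M')).
Proof.
move=> dvr resid d_gt1; have d_gt0 : (0 < d)%N by exact: ltnW.
split=> [B cvx M M' grM grM'|e a g I B ue cvx _ faces h h' ah ah' M M' sM sM'].
  by split; [exact: stratum_closure | exact: rank_le_Delta].
have rankP := bruhat_rank_le dvr resid d_gt1 ue cvx.
have leP := gen_bruhat_leP dvr d_gt1 ue faces ah ah'.
split; last by rewrite leP (rankP _ _ _ _ sM sM').
have grM' : Gr pi red B M' by case: sM'.
rewrite leP; split=> [le U sU|/(_ M sM) clM].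
  have grU : Gr pi red B U by case: sU.
  apply: (closure_of_rank_le dvr resid d_gt0 cvx grU grM').
    by apply/(rankP _ _ _ _ sU sM').
  by move=> W grW DW; apply: (bruhat_stratum_of_Delta dvr resid d_gt1 ue cvx ah' sM').
apply/(rankP _ _ _ _ sM sM'); apply: (rank_le_of_closure dvr resid d_gt0 cvx) clM => W sW.
by split; [case: sW | apply/(rankP _ _ _ _ sW sM')].
Qed.
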